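(* Let $N\subset\mathbb R^n$ be a compact star-shaped $n$-dimensional submanifold with corners, $W$ a finite-dimensional non-positively graded real vector space, $U\subset W^0$ open, $Q$ a differential on $\mathcal A_{W|_U}$, and $r\ge1$ an integer. The map $$\kappa:\Omega_r(N,W|_U)^0\to\Omega_r(N,W)^0,\qquad \kappa(A)=A-h(C_Q(A)),$$ is a smooth open embedding of Banach manifolds.
   Context: $W=\bigoplus_{k\ge0}W^{-k}$, $W^{<0}=\bigoplus_{k>0}W^{-k}$. $\mathcal A_{W|_U}=C^\infty(U)\otimes S((W^{<0})^* )$ is the graded-commutative algebra with $(W^{-k})^*$ in degree $k$; a differential $Q$ is a degree 1 derivation with $Q^2=0$. $\Omega_r(N)$ is the Banach space of $C^r$ differential forms on $N$; $\Omega_r(N,W)^m=\bigoplus_{k\ge0}\Omega_r^{m+k}(N)\otimes W^{-k}$; $\Omega_r(N,W|_U)^0\subset\Omega_r(N,W)^0$ is the open subset of $A$ whose 0-form part is a map $N\to U\subset W^0$. Let $\xi^i$ be a homogeneous basis of $W^*$, $e_i$ the dual basis, $A^i=\langle A,\xi^i\rangle$, $C_Q^i=Q\xi^i$; $C_Q^i(A)$ is obtained by substituting $A^j$ for $\xi^j$ in $C_Q^i$, and $C_Q(A)=\sum_iC_Q^i(A)e_i\in\Omega_r(N,W)^1$. Star-shaped means $0\in N$ and $tx\in N$ for $x\in N$, $t\in[0,1]$. $h$ is the de Rham homotopy operator $h\alpha=\int_0^1 i_{\partial_t}(R^*\alpha)\,dt$, $R(x,t)=tx$, applied componentwise. *)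

(* Defs.v *)
From HB Require Import structures.
From mathcomp Require Import all_boot all_order all_algebra.
From mathcomp Require Import all_classical all_reals all_analysis.
From mathcomp Require Import ring lra.

Set Implicit Arguments.
Unset Strict Implicit.
Unset Printing Implicit Defensive.

Import Order.TTheory GRing.Theory Num.Theory.
Import numFieldNormedType.Exports.

Local Open Scope classical_set_scope.
Local Open Scope ring_scope.

HB.instance Definition _ (R : realType) m n := Complete.on 'M[R]_(m, n).

Section Smooth.
Context {R : realType}.

(* [D x [:: v_1; ...; v_k]] is the k-th derivative of [f] at [x], as a bounded
   k-linear map evaluated at (v_1, ..., v_k).  The last conjunct says that
   D^(k+1) f is the Frechet derivative of D^k f, the space of bounded k-linear
   maps carrying the operator norm (spelled out here as a bound on all [s]). *)
Definition smooth_on (E F : normedModType R) (O : set E) (f : E -> F) : Prop :=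
  exists D : E -> seq E -> F, forall x, O x ->
  [/\ D x [::] = f x,
      forall s1 s2 (a : R) u v,
        D x (s1 ++ (a *: u + v) :: s2) =
        a *: D x (s1 ++ u :: s2) + D x (s1 ++ v :: s2),
      forall k, exists M : R, forall s, size s = k ->
        `|D x s| <= M * \prod_(v <- s) `|v|
    & forall k (eps : R), 0 < eps -> \forall h \near (0 : E),
        forall s, size s = k ->
        `|D (x + h) s - D x s - D x (h :: s)|
          <= eps * `|h| * \prod_(v <- s) `|v| ].

(* [f] is a diffeomorphism from the open set [O] onto an open subset of [F]. *)
Definition smooth_open_embedding (E F : completeNormedModType R)
    (O : set E) (f : E -> F) : Prop :=
  [/\ open O, smooth_on O f, open (f @` O) &
      exists g : F -> E,
        (forall x, O x -> g (f x) = x) /\ smooth_on (f @` O) g].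

(* Submanifold with corners of codimension 0: in suitable local coordinates of
   R^n it is the set where the first [k] coordinates are nonnegative. *)
Definition codim0_with_corners n (N : set 'rV[R]_n) : Prop :=
  forall p, N p -> exists (V : set 'rV[R]_n) (phi : 'rV[R]_n -> 'rV[R]_n) k,
  [/\ V p, smooth_open_embedding V phi &
      forall x, V x ->
        (N x <-> forall i : 'I_n, (i < k)%N -> 0 <= phi x 0 i)].

Definition star_shaped n (N : set 'rV[R]_n) : Prop :=
  N 0 /\ forall x (t : R), N x -> 0 <= t <= 1 -> N (t *: x).

End Smooth.

Section CrFamilies.
Context {R : realType} {n : nat}.

Fixpoint pderiv (s : seq 'I_n) (f : 'rV[R]_n -> R) : 'rV[R]_n -> R :=
  if s is i :: s' then 'D_('e_i) (pderiv s' f) else f.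

Variables (r : nat) (N : set 'rV[R]_n) (J : finType).

Definition pdom (s : seq 'I_n) : set 'rV[R]_n := if s is [::] then N else N°.

(* Families indexed by [J] of C^r functions on [N]: the partial derivatives of
   order at most [r] exist on the interior of [N] and extend continuously to
   [N].  A function on [N] is represented by its extension by 0 to R^n.
   The boundedness condition is automatic when [N] is a compact submanifold with
   corners; it makes the sup norm below finite for every [N]. *)
Definition is_Cr (f : J -> 'rV[R]_n -> R) : Prop := forall j,
  [/\ forall x, ~ N x -> f j x = 0,
      {within N, continuous (f j)},
      forall s i x, (size s < r)%N -> N° x -> derivable (pderiv s (f j)) x 'e_i,
      forall s p, (size s <= r)%N -> N p ->
        cvg (pderiv s (f j) x @[x --> within N° (nbhs p)]) &
      forall s, (size s <= r)%N ->
        exists M, forall x, pdom s x -> `|pderiv s (f j) x| <= M ].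

Definition Cr_pred : {pred J -> 'rV[R]_n -> R} := fun f => `[< is_Cr f >].

Record Cr := MkCr { Cr_val :> J -> 'rV[R]_n -> R; _ : Cr_val \in Cr_pred }.

HB.instance Definition _ := [isSub for Cr_val].
HB.instance Definition _ := [Choice of Cr by <:].

Lemma Cr_P (f : Cr) : is_Cr f.
Proof. by case: f => f /= /asboolP. Qed.

Lemma pderiv_near (s : seq 'I_n) (f g : 'rV[R]_n -> R) x :
  N° x -> (forall y, N° y -> f y = g y) -> pderiv s f x = pderiv s g x.
Proof.
move=> + fg; elim: s x => [|i s IH] x Nx /=; first exact: fg.
apply: near_eq_derive; have := nbhs_interior Nx.
by apply: filterS => y /IH.
Qed.

Lemma pderiv_lin (a : R) (f g : 'rV[R]_n -> R) :
  (forall s i x, (size s < r)%N -> N° x -> derivable (pderiv s f) x 'e_i) ->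
  (forall s i x, (size s < r)%N -> N° x -> derivable (pderiv s g) x 'e_i) ->
  forall s x, (size s <= r)%N -> N° x ->
  pderiv s (a *: f + g) x = a * pderiv s f x + pderiv s g x.
Proof.
move=> df dg; elim=> [//|i s IH] x /= sr Nx.
rewrite (@near_eq_derive _ _ _ _ (a *: pderiv s f + pderiv s g)); last first.
  have := nbhs_interior Nx.
  by apply: filterS => y Ny; rewrite IH // ltnW.
rewrite deriveD; last 2 first.
- by apply: derivableZ; exact: df.
- exact: dg.
by rewrite deriveZ //; exact: df.
Qed.

Lemma pderiv_lin_dom (a : R) (f g : J -> 'rV[R]_n -> R) j :
  is_Cr f -> is_Cr g ->
  forall s x, (size s <= r)%N -> pdom s x ->
  pderiv s ((a *: f + g) j) x = a * pderiv s (f j) x + pderiv s (g j) x.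
Proof.
move=> /(_ j)[_ _ df _ _] /(_ j)[_ _ dg _ _] [//|i s] x sr Nx.
exact: (pderiv_lin a df dg).
Qed.

Lemma Cr_submod_closed : submod_closed Cr_pred.
Proof.
split.
  apply/asboolP => j.
  have p0 s x : pderiv s ((0 : J -> 'rV[R]_n -> R) j) x = 0.
    elim: s x => [//|i s IH] x /=.
    by rewrite (_ : pderiv s _ = cst 0) ?derive_cst //; apply/funext.
  have p0' s : pderiv s ((0 : J -> 'rV[R]_n -> R) j) = cst 0 by apply/funext.
  split => //.
  - by move=> x; exact: cst_continuous.
  - by move=> s i x _ _; rewrite p0'; exact: derivable_cst.
  - by move=> s p _ _; rewrite p0'; exact: is_cvg_cst.
  - by move=> s _; exists 0 => x _; rewrite p0 normr0.
move=> a f g /asboolP fC /asboolP gC; apply/asboolP => j.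
have lin := pderiv_lin_dom a j fC gC.
have [f0 fc df fl fb] := fC j; have [g0 gc dg gl gb] := gC j.
have linI s x : (size s <= r)%N -> N° x ->
    pderiv s ((a *: f + g) j) x = a * pderiv s (f j) x + pderiv s (g j) x.
  by move=> sr Nx; apply: lin => //; case: s {sr} => //=; exact: interior_subset.
split.
- move=> x Nx; have -> : (a *: f + g) j x = a *: f j x + g j x by [].
  by rewrite f0 // g0 // scaler0 addr0.
- apply/subspace_continuousP => x Nx.
  move/subspace_continuousP: fc => /(_ x Nx) fx.
  move/subspace_continuousP: gc => /(_ x Nx) gx.
  apply: (@cvgD _ _ _ _ _ (fun y => a * f j y) (g j)) => //.
  by apply: cvgM => //; exact: cvg_cst.
- move=> s i x sr Nx.
  apply: (@near_eq_derivable _ _ _ (a *: pderiv s (f j) + pderiv s (g j))).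
    have := nbhs_interior Nx.
    by apply: filterS => y Ny; rewrite linI // ltnW.
  by apply: derivableD; [apply: derivableZ; exact: df | exact: dg].
- move=> s p sr Np.
  have /cvg_ex[lf flf] := fl s p sr Np; have /cvg_ex[lg glg] := gl s p sr Np.
  apply/cvg_ex; exists (a * lf + lg).
  have : (a * pderiv s (f j) x + pderiv s (g j) x)
          @[x --> within N° (nbhs p)] --> a * lf + lg.
    by apply: cvgD => //; apply: cvgM => //; exact: cvg_cst.
  apply: cvg_trans; apply: near_eq_cvg.
  by rewrite near_withinE; apply: filterE => x Nx; rewrite linI.
- move=> s sr; have [Mf HMf] := fb s sr; have [Mg HMg] := gb s sr.
  exists (`|a| * Mf + Mg) => x Nx; rewrite lin //.
  apply: le_trans (ler_normD _ _) _; rewrite normrM lerD ?HMg //.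
  by rewrite ler_wpM2l ?HMf.
Qed.

HB.instance Definition _ := GRing.isSubmodClosed.Build _ _ Cr_pred
  Cr_submod_closed.
HB.instance Definition _ := [SubChoice_isSubLmodule of Cr by <:].

Definition Cr_norms (f : J -> 'rV[R]_n -> R) : set R :=
  [set y | exists j s x,
     [/\ (size s <= r)%N, pdom s x & y = `|pderiv s (f j) x|] ].

Definition Cr_norm (f : Cr) : R := sup (Cr_norms f).

Lemma fin_ub (T : finType) (S : T -> set R) :
  (forall t, has_ubound (S t)) -> exists M, forall t y, S t y -> y <= M.
Proof.
move=> /(fun h => choice (fun t => h t))[M HM].
exists (\sum_t `|M t|) => t y /HM; move=> /le_trans; apply.
rewrite (bigD1 t) //= ler_wpDr ?sumr_ge0 // ?ler_norm //.
Qed.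

Lemma Cr_norms_ub (f : Cr) : has_ubound (Cr_norms f).
Proof.
pose S (k : 'I_r.+1) (t : k.-tuple 'I_n) (j : J) :=
  [set y | exists2 x, pdom t x & y = `|pderiv t (f j) x|].
have /fin_ub[M HM] : forall k : 'I_r.+1, has_ubound
    [set y | exists t : k.-tuple 'I_n, exists j, S k t j y].
  move=> k.
  have /fin_ub[M HM] : forall t : k.-tuple 'I_n,
      has_ubound [set y | exists j, S k t j y].
    move=> t; have /fin_ub[M HM] : forall j, has_ubound (S k t j).
      move=> j; have [_ _ _ _ fb] := Cr_P f j.
      have [|M HM] := fb t; first by rewrite size_tuple -ltnS.
      by exists M => _ [x Nx ->]; exact: HM.
    by exists M => y [j /HM].
  by exists M => y [t /HM].
exists M => _ [j [s [x [sr Nx ->]]]]; rewrite -ltnS in sr.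
by apply: (HM (Ordinal sr)); exists (in_tuple s), j, x.
Qed.

Lemma Cr_norm_ge (f : Cr) j s x : (size s <= r)%N -> pdom s x ->
  `|pderiv s (f j) x| <= Cr_norm f.
Proof.
by move=> sr Nx; apply: (ub_le_sup (Cr_norms_ub f)); exists j, s, x.
Qed.

Lemma Cr_norm_le (f : Cr) M : 0 <= M ->
  (forall j s x, (size s <= r)%N -> pdom s x -> `|pderiv s (f j) x| <= M) ->
  Cr_norm f <= M.
Proof.
move=> M0 HM; have [E0|/set0P E0] := eqVneq (Cr_norms f) set0.
  by rewrite /Cr_norm E0 sup0.
by apply: ge_sup => // _ [j [s [x [sr Nx ->]]]]; exact: HM.
Qed.

Lemma Cr_norm_ge0 (f : Cr) : 0 <= Cr_norm f.
Proof.
have [E0|/set0P[_ [j [s [x [sr Nx _]]]]]] := eqVneq (Cr_norms f) set0.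
  by rewrite /Cr_norm E0 sup0.
exact: le_trans (normr_ge0 _) (Cr_norm_ge f j sr Nx).
Qed.

Lemma Cr_pderivD (f g : Cr) j s x : (size s <= r)%N -> pdom s x ->
  pderiv s ((f + g : Cr) j) x = pderiv s (f j) x + pderiv s (g j) x.
Proof.
move=> sr Nx; rewrite -[X in Cr_val (X + _)]scale1r.
by rewrite [LHS](pderiv_lin_dom 1 j (Cr_P f) (Cr_P g)) // mul1r.
Qed.

Lemma Cr_pderivZ (a : R) (f : Cr) j s x : (size s <= r)%N -> pdom s x ->
  pderiv s ((a *: f : Cr) j) x = a * pderiv s (f j) x.
Proof.
move=> sr Nx; rewrite -[X in Cr_val X]addr0.
rewrite [LHS](pderiv_lin_dom a j (Cr_P f) (Cr_P 0)) //.
suff -> : pderiv s ((0 : Cr) j) x = 0 by rewrite addr0.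
apply: (@addrI _ (pderiv s ((0 : Cr) j) x)).
by rewrite -Cr_pderivD // !addr0.
Qed.

Lemma Cr_pderivB (f g : Cr) j s x : (size s <= r)%N -> pdom s x ->
  pderiv s ((f - g : Cr) j) x = pderiv s (f j) x - pderiv s (g j) x.
Proof.
by move=> sr Nx; rewrite Cr_pderivD // -scaleN1r Cr_pderivZ // mulN1r.
Qed.

Lemma Cr_normD (f g : Cr) : Cr_norm (f + g) <= Cr_norm f + Cr_norm g.
Proof.
apply: Cr_norm_le => [|j s x sr Nx]; first by rewrite addr_ge0 ?Cr_norm_ge0.
by rewrite Cr_pderivD // (le_trans (ler_normD _ _)) // lerD ?Cr_norm_ge.
Qed.

Lemma Cr_normZ (a : R) (f : Cr) : Cr_norm (a *: f) = `|a| * Cr_norm f.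
Proof.
have le b (g : Cr) : Cr_norm (b *: g) <= `|b| * Cr_norm g.
  apply: Cr_norm_le => [|j s x sr Nx]; first by rewrite mulr_ge0 ?Cr_norm_ge0.
  by rewrite Cr_pderivZ // normrM ler_wpM2l ?Cr_norm_ge.
apply/eqP; rewrite eq_le le /=; have [->|a0] := eqVneq a 0.
  by rewrite normr0 mul0r Cr_norm_ge0.
rewrite -ler_pdivlMl ?normr_gt0 // -normfV.
by apply: le_trans (le _ _); rewrite scalerA mulVf // scale1r.
Qed.

Lemma Cr_norm0_eq0 (f : Cr) : Cr_norm f = 0 -> f = 0.
Proof.
move=> f0; apply: val_inj; apply/funext => j; apply/funext => x /=.
have [Nx|Nx] := pselect (N x); last by have [-> //] := Cr_P f j.
apply/eqP; rewrite -normr_le0 -f0.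
exact: (@Cr_norm_ge f j [::] x).
Qed.

HB.instance Definition _ :=
  Lmodule_isNormed.Build R Cr Cr_normD Cr_normZ Cr_norm0_eq0.

Lemma le_dir_derive (w : 'rV[R]_n -> R) x e M (a b : R) : a <= b ->
  (forall t, a <= t <= b -> derivable w (t *: e + x) e) ->
  (forall t, a <= t <= b -> `|'D_e w (t *: e + x)| <= M) ->
  `|w (b *: e + x) - w (a *: e + x)| <= M * (b - a).
Proof.
move=> ab dw bw; pose phi (t : R) := w (t *: e + x).
have E t : (fun h : R => h^-1 *: (phi (h *: 1 + t) - phi t)) =
           (fun h : R => h^-1 *: (w (h *: e + (t *: e + x)) - w (t *: e + x))).
  by apply/funext => h; rewrite /phi [h *: 1]mulr1 scalerDl addrA.
have dphi t : a <= t <= b -> derivable phi t 1.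
  by move=> /dw; rewrite /derivable/= E.
have Dphi t : 'D_1 phi t = 'D_e w (t *: e + x) by rewrite /derive/= E.
have [||c cab ->] := @MVT_segment R phi (fun t => 'D_1 phi t) a b ab.
- move=> t; rewrite in_itv/= => /andP[at1 tb].
  by apply: derivableP; apply: dphi; rewrite !ltW.
- by apply: derivable_within_continuous => t; rewrite in_itv/=; exact: dphi.
rewrite normrM (ger0_norm (x := b - a)) ?subr_ge0 // ler_wpM2r ?subr_ge0 //.
by rewrite Dphi; apply: bw; rewrite in_itv in cab.
Qed.

Section Completeness.
Variables (F : set_system Cr) (FF : ProperFilter F) (Fc : cauchy F).

Definition limpd j s x : R := lim (pderiv s ((f : Cr) j) x @[f --> F]).

Lemma near_pd (e : R) : 0 < e -> exists f0 : Cr, F (fun f : Cr =>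
  forall j s x, (size s <= r)%N -> pdom s x ->
   `|pderiv s (f0 j) x - pderiv s (f j) x| <= e).
Proof.
move=> e0; have /cauchyP/(_ _ e0)[f0 Ff0] := Fc.
exists f0; apply: filterS Ff0 => f; rewrite -ball_normE /= => f0f j s x sr Nx.
by rewrite -Cr_pderivB // (le_trans (Cr_norm_ge _ _ sr Nx)) // ltW.
Qed.

Lemma limpd_cvg j s x : (size s <= r)%N -> pdom s x ->
  pderiv s ((f : Cr) j) x @[f --> F] --> limpd j s x.
Proof.
move=> sr Nx; apply: cauchy_cvg.
apply: cauchy_exP => e e0.
have e2 : 0 < e / 2 by rewrite divr_gt0.
have [f0 Ff0] := near_pd e2.
exists (pderiv s (f0 j) x).
suff : F (fun f : Cr => ball (pderiv s (f0 j) x) e (pderiv s (f j) x)) by [].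
apply: filterS Ff0 => f /(_ j s x sr Nx) H.
rewrite -ball_normE /=; apply: le_lt_trans H _; lra.
Qed.

Lemma near_limpd (e : R) : 0 < e -> exists f0 : Cr,
  [/\ F (fun f : Cr => forall j s x, (size s <= r)%N -> pdom s x ->
       `|pderiv s (f0 j) x - pderiv s (f j) x| <= e) &
      forall j s x, (size s <= r)%N -> pdom s x ->
       `|pderiv s (f0 j) x - limpd j s x| <= e].
Proof.
move=> /near_pd[f0 Ff0]; exists f0; split=> // j s x sr Nx.
apply: (@cvgr_to_le _ F _ R
  (fun f : Cr => `|pderiv s (f0 j) x - pderiv s (f j) x|)).
  by apply: cvg_norm; apply: cvgB; [exact: cvg_cst|exact: limpd_cvg].
by apply: filterS Ff0 => f; exact.
Qed.

Lemma pdom_int s x : N° x -> pdom s x.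
Proof. by case: s => //=; exact: interior_subset. Qed.

Lemma limpd_derive j s i x : (size s < r)%N -> N° x ->
  is_derive x 'e_i (limpd j s) (limpd j (i :: s) x).
Proof.
move=> sr Nx; set e := 'e_i : 'rV[R]_n.
suff H : h^-1 *: (limpd j s (h *: e + x) - limpd j s x) @[h --> 0^'] -->
     limpd j (i :: s) x.
  by apply: DeriveDef; [apply/cvg_ex; exists (limpd j (i :: s) x)|exact/cvg_lim].
apply/cvgrPdist_le => eps eps0.
have e3 : 0 < eps / 3 by rewrite divr_gt0.
have [f0 [Ff0 lf0]] := near_limpd e3.
have [_ _ df0 _ _] := Cr_P f0 j.
have /cvgrPdist_le/(_ _ e3) Df0 := df0 s i x sr Nx.
have [d d0 dN] : exists2 d : R, 0 < d &
    forall t : R, `|t| < d -> N° (t *: e + x).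
  have : t *: e + x @[t --> (0 : R)] --> x.
    rewrite -[X in _ --> X]add0r -(scale0r e).
    by apply: cvgD; [apply: cvgZr_tmp; exact: cvg_id|exact: cvg_cst].
  move=> /(_ _ (nbhs_interior Nx))/nbhs_ballP[d /= d0 dN].
  by exists d => // t td; apply: dN; rewrite -ball_normE /= sub0r normrN.
near=> h.
have h0 : h != 0 by near: h; exact: nbhs_dnbhs_neq.
have hd : `|h| < d by near: h; apply: dnbhs0_lt.
have q0 : `|pderiv (i :: s) (f0 j) x -
    h^-1 *: (pderiv s (f0 j) (h *: e + x) - pderiv s (f0 j) x)| <= eps / 3.
  by near: h; exact: Df0.
have Nh : N° (h *: e + x) by exact: dN.
have mvt (f : Cr) : (forall j s x, (size s <= r)%N -> pdom s x ->
       `|pderiv s (f0 j) x - pderiv s (f j) x| <= eps / 3) ->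
    `|(pderiv s (f0 j) (h *: e + x) - pderiv s (f j) (h *: e + x)) -
      (pderiv s (f0 j) x - pderiv s (f j) x)| <= eps / 3 * `|h|.
  move=> H; pose w := pderiv s ((f0 - f : Cr) j).
  rewrite -!Cr_pderivB ?(ltnW sr) //; [|exact: pdom_int..].
  have [_ _ dw _ _] := Cr_P (f0 - f) j.
  have bw t : `|t| < d -> `|'D_e w (t *: e + x)| <= eps / 3.
    move=> td; have Nt := dN t td.
    rewrite -[X in `|X|]/(pderiv (i :: s) _ _) (@Cr_pderivB f0 f j (i :: s) _ sr Nt).
    exact: (H j (i :: s) _ sr Nt).
  have dw' t : `|t| < d -> derivable w (t *: e + x) e.
    by move=> td; exact: (dw s i _ sr (dN t td)).
  have [hp|hn] := leP 0 h.
    have := @le_dir_derive w x e (eps / 3) 0 h hp.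
    rewrite scale0r add0r subr0 (ger0_norm hp) => mv; apply: mv => t /andP[t0 th].
      by apply: dw'; rewrite ger0_norm // (le_lt_trans th) // -(ger0_norm hp).
    by apply: bw; rewrite ger0_norm // (le_lt_trans th) // -(ger0_norm hp).
  have := @le_dir_derive w x e (eps / 3) h 0 (ltW hn).
  rewrite scale0r add0r sub0r distrC (ltr0_norm hn) => mv.
  have td t : h <= t <= 0 -> `|t| < d.
    move=> /andP[ht t0]; rewrite ler0_norm // (le_lt_trans _ hd) //.
    by rewrite ltr0_norm // lerN2.
  by apply: mv => t /td; [exact: dw'|exact: bw].
have lmvt : `|(pderiv s (f0 j) (h *: e + x) - limpd j s (h *: e + x)) -
      (pderiv s (f0 j) x - limpd j s x)| <= eps / 3 * `|h|.
  apply: (@cvgr_to_le _ F _ R (fun f : Cr =>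
    `|(pderiv s (f0 j) (h *: e + x) - pderiv s (f j) (h *: e + x)) -
      (pderiv s (f0 j) x - pderiv s (f j) x)|)).
    apply: cvg_norm; apply: cvgB; apply: cvgB; try exact: cvg_cst.
      by apply: limpd_cvg; [exact: ltnW|exact: pdom_int].
    by apply: limpd_cvg; [exact: ltnW|exact: pdom_int].
  by apply: filterS Ff0 => f /mvt.
have l1 := lf0 j (i :: s) x sr Nx.
set A := limpd j (i :: s) x in l1 *; set B := pderiv (i :: s) _ _ in q0 l1.
have -> : A - h^-1 *: (limpd j s (h *: e + x) - limpd j s x) =
  - (B - A) + (B - h^-1 *: (pderiv s (f0 j) (h *: e + x) - pderiv s (f0 j) x)) +
  h^-1 * ((pderiv s (f0 j) (h *: e + x) - limpd j s (h *: e + x)) -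
      (pderiv s (f0 j) x - limpd j s x)).
  by rewrite /GRing.scale /=; ring.
have -> : eps = eps / 3 + eps / 3 + eps / 3 by field.
apply: le_trans (ler_normD _ _) _; apply: lerD.
  by apply: le_trans (ler_normD _ _) _; rewrite normrN lerD.
by rewrite normrM normfV ler_pdivrMl ?normr_gt0 // mulrC.
Unshelve. all: by end_near. Qed.

Definition limCr (j : J) (x : 'rV[R]_n) : R :=
  if `[< N x >] then limpd j [::] x else 0.

Lemma limCr_pd j s x : (size s <= r)%N -> pdom s x ->
  pderiv s (limCr j) x = limpd j s x.
Proof.
elim: s x => [|i s IH] x sr Nx; first by rewrite /= /limCr asboolT.
have dl := limpd_derive j i sr Nx; rewrite -(@derive_val _ _ _ _ _ _ _ dl) /=.
apply: near_eq_derive; have := nbhs_interior Nx.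
by apply: filterS => y Ny; rewrite IH ?(ltnW sr) //; exact: pdom_int.
Qed.

Lemma limCr_Cr : is_Cr limCr.
Proof.
move=> j; split.
- by move=> x Nx; rewrite /limCr asboolF.
- apply/subspace_continuousP => x Nx; apply/cvgrPdist_le => eps eps0.
  have e3 : 0 < eps / 3 by rewrite divr_gt0.
  have [f0 [_ lf0]] := near_limpd e3.
  have [_ /subspace_continuousP/(_ x Nx)/cvgrPdist_le/(_ _ e3) c0 _ _ _] :=
    Cr_P f0 j.
  have NN : \forall y \near within N (nbhs x), N y.
    by rewrite near_withinE; exact: filterE.
  near=> y; have Ny : N y by near: y.
  have cy : `|f0 j x - f0 j y| <= eps / 3 by near: y.
  rewrite /from_subspace /limCr !asboolT //.
  have l1 := lf0 j [::] x (leq0n r) Nx; have l2 := lf0 j [::] y (leq0n r) Ny.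
  have -> : limpd j [::] x - limpd j [::] y =
    - (f0 j x - limpd j [::] x) + (f0 j x - f0 j y) + (f0 j y - limpd j [::] y).
    by ring.
  have -> : eps = eps / 3 + eps / 3 + eps / 3 by field.
  apply: le_trans (ler_normD _ _) _; apply: lerD => //.
  by apply: le_trans (ler_normD _ _) _; rewrite normrN lerD.
- move=> s i x sr Nx; have dl := limpd_derive j i sr Nx.
  apply: (@near_eq_derivable _ _ _ (limpd j s)); last exact: ex_derive.
  have := nbhs_interior Nx; apply: filterS => y Ny.
  by rewrite limCr_pd ?(ltnW sr) //; exact: pdom_int.
- move=> s p sr Np; set G := within _ _.
  have [G0|G0] := pselect (G set0).
    apply/cvg_ex; exists 0 => A _; rewrite /=.
    by apply: filterS G0 => y [].
  have PG : ProperFilter G by apply: Build_ProperFilter_ex; move=> A GA;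
    apply: contrapT => nA; apply: G0; apply: filterS GA => y Ay; apply: nA; exists y.
  apply: cauchy_cvg; apply: cauchy_exP => e e0.
  have e3 : 0 < e / 3 by rewrite divr_gt0.
  have [f0 [_ lf0]] := near_limpd e3.
  have [_ _ _ /(_ s p sr Np)/cvg_ex[l /cvgrPdist_le/(_ _ e3) c0] _] := Cr_P f0 j.
  exists l; have NN : \forall y \near G, N° y.
    by rewrite near_withinE; exact: filterE.
  suff : \forall y \near G, ball l e (pderiv s (limCr j) y) by [].
  near=> y; have Ny : N° y by near: y.
  have cy : `|l - pderiv s (f0 j) y| <= e / 3 by near: y.
  rewrite -ball_normE /= limCr_pd //; last exact: pdom_int.
  have l1 := lf0 j s y sr (pdom_int s Ny).
  apply: (@le_lt_trans _ _ (e / 3 + e / 3)); last by lra.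
  rewrite (_ : l - _ = (l - pderiv s (f0 j) y) +
    (pderiv s (f0 j) y - limpd j s y)); last by ring.
  by apply: le_trans (ler_normD _ _) _; rewrite lerD.
- move=> s sr; have [f0 [_ lf0]] := near_limpd ltr01.
  exists (Cr_norm f0 + 1) => x Nx; rewrite limCr_pd //.
  rewrite (_ : limpd j s x = pderiv s (f0 j) x +
    - (pderiv s (f0 j) x - limpd j s x)); last by ring.
  apply: le_trans (ler_normD _ _) _; rewrite normrN lerD ?Cr_norm_ge //.
  exact: lf0.
Unshelve. all: by end_near. Qed.

Lemma Cr_cvg : cvg F.
Proof.
have limP : limCr \in Cr_pred by apply/asboolP; exact: limCr_Cr.
apply/cvg_ex; exists (MkCr limP); apply/cvgrPdist_le => e e0.
have e2 : 0 < e / 2 by rewrite divr_gt0.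
have [f0 [Ff0 lf0]] := near_limpd e2.
apply: filterS Ff0 => f H.
apply: (@Cr_norm_le (MkCr limP - f)) => [|j s x sr Nx]; first exact: ltW.
rewrite Cr_pderivB //= limCr_pd //.
rewrite (_ : _ - _ = - (pderiv s (f0 j) x - limpd j s x) +
   (pderiv s (f0 j) x - pderiv s (f j) x)); last by ring.
have -> : e = e / 2 + e / 2 by field.
apply: le_trans (ler_normD _ _) _; rewrite normrN lerD //; [exact: lf0|exact: H].
Qed.

End Completeness.

HB.instance Definition _ := Uniform_isComplete.Build Cr Cr_cvg.

End CrFamilies.

Section Graded.
Context {R : realType}.

(* A finite-dimensional graded vector space W = \bigoplus_k W^{-k}, where
   [gcomp W k] = W^{-k}, together with a homogeneous basis. *)
Record gradedVect := GradedVect {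
  gcomp :> nat -> vectType R;
  gbound : nat;
  gboundP : forall k, (gbound < k)%N -> \dim {:gcomp k} = 0%N;
  gbasis : forall k, (\dim {:gcomp k}).-tuple (gcomp k);
  gbasisP : forall k, basis_of {:gcomp k} (gbasis k)
}.

Variable W : gradedVect.

(* Index set of the homogeneous basis e_i of W: [inl j] is the j-th basis vector
   of W^0, and [inr (k; j)] the j-th basis vector of W^{-(k+1)}. *)
Definition negidx : finType := {k : 'I_(gbound W) & 'I_(\dim {:W k.+1})}.
Definition basidx : finType := ('I_(\dim {:W 0%N}) + negidx)%type.

Definition ndeg (i : negidx) : nat := (tag i).+1.
(* The degree of xi^i, so that e_i has degree [- bdeg i]. *)
Definition bdeg (i : basidx) : nat := if i is inr p then ndeg p else 0%N.

Definition W0coord (w : W 0%N) : 'rV[R]_(\dim {:W 0%N}) := passmx.rVof (gbasis W 0) w.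
Definition W0vec (u : 'rV[R]_(\dim {:W 0%N})) : W 0%N := passmx.vecof (gbasis W 0) u.

(* Openness and smoothness on W^0 refer to its canonical topology, that of R^d in
   coordinates. *)
Definition gopen (U : set (W 0%N)) : Prop := open (W0vec @^-1` U).

(* C^infty(U), a function on U being represented by its extension by 0. *)
Definition smooth_fun (U : set (W 0%N)) (f : W 0%N -> R) : Prop :=
  smooth_on (W0vec @^-1` U) (f \o W0vec) /\ forall w, ~ U w -> f w = 0.

(* The monomial [m] stands for the product of the (xi^i)^(m i) over the indices
   [i] of negative basis vectors, in the order of [enum negidx].  The nonzero
   ones, in which the odd generators occur at most once, form a basis of
   S((W^{<0})^* ). *)
Definition monom : choiceType := {ffun negidx -> nat}.

Definition monom_nz (m : monom) : bool :=
  [forall i, odd (ndeg i) ==> (m i <= 1)%N].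

Definition monom_deg (m : monom) : nat := (\sum_i m i * ndeg i)%N.

Definition monom1 (i : negidx) : monom := [ffun j => (j == i : nat)].

Definition monom_lt (i j : negidx) : bool := (enum_rank i < enum_rank j)%N.

(* The Koszul sign of xi^m1 xi^m2 = +/- xi^(m1 + m2). *)
Definition koszul (m1 m2 : monom) : R :=
  (-1) ^+ (\sum_i \sum_(j | monom_lt j i) (m1 i * ndeg i) * (m2 j * ndeg j))%N.

(* An element of A_{W|U} is a finite sum of monomials with coefficients in
   C^infty(U); [a m] is the coefficient of xi^m. *)
Definition galg : Type := monom -> W 0%N -> R.

Definition in_galg (U : set (W 0%N)) (a : galg) : Prop :=
  [/\ forall m, smooth_fun U (a m),
      forall m w, ~~ monom_nz m -> a m w = 0 &
      finite_set [set m | exists w, a m w != 0] ].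

Definition gmul (a b : galg) : galg := fun m w =>
  if monom_nz m then
    \sum_(p \in [set p : monom * monom | forall i, m i = (p.1 i + p.2 i)%N])
      koszul p.1 p.2 * a p.1 w * b p.2 w
  else 0.

Definition ghomog (d : nat) (a : galg) : Prop :=
  forall m w, a m w != 0 -> monom_deg m = d.

Definition ggen (U : set (W 0%N)) (i : basidx) : galg := fun m w =>
  if `[< U w >] then
    match i with
    | inl j => (m == [ffun=> 0%N])%:R * W0coord w 0 j
    | inr p => (m == monom1 p)%:R
    end
  else 0.

(* Only the restriction of [diff_fun] to A_{W|U} is relevant. *)
Record gdifferential (U : set (W 0%N)) := GDifferential {
  diff_fun :> galg -> galg;
  diff_in : forall a, in_galg U a -> in_galg U (diff_fun a);
  diff_linear : forall (c : R) a b, in_galg U a -> in_galg U b ->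
    diff_fun (fun m w => c * a m w + b m w) =
    (fun m w => c * diff_fun a m w + diff_fun b m w);
  diff_deg : forall d a, in_galg U a -> ghomog d a -> ghomog d.+1 (diff_fun a);
  diff_leibniz : forall d a b, in_galg U a -> in_galg U b -> ghomog d a ->
    diff_fun (gmul a b) =
    (fun m w => gmul (diff_fun a) b m w + (-1) ^+ d * gmul a (diff_fun b) m w);
  diff_square : forall a, in_galg U a -> diff_fun (diff_fun a) = (fun _ _ => 0)
}.

End Graded.
Arguments gradedVect : clear implicits.

Section Exterior.
Context {R : realType} {n : nat}.

(* The exterior algebra of (R^n)^*: [a S] is the coefficient of dx^S, the wedge
   product of the dx^i, i in S, in increasing order. *)
Definition extalg : Type := {set 'I_n} -> R.

Definition ext_one : extalg := fun S => (S == finset.set0)%:R.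

Definition shuffle_sign (S T : {set 'I_n}) : R :=
  (-1) ^+ #|[pred p : 'I_n * 'I_n | [&& p.1 \in S, p.2 \in T & (p.2 < p.1)%N]]|.

Definition wedge (a b : extalg) : extalg := fun S =>
  \sum_(T : {set 'I_n} | T \subset S) shuffle_sign T (S :\: T) * a T * b (S :\: T).

(* Interior product with the vector [v]. *)
Definition ext_contract (v : 'rV[R]_n) (a : extalg) : extalg := fun S =>
  \sum_(k | k \notin S) (-1) ^+ #|[pred l in S | (l < k)%N]| * v 0 k * a (k |: S).

End Exterior.

Section Forms.
Context {R : realType} {n : nat} (W : gradedVect R).

(* The coefficients of dx^S (x) e_i which occur in total degree [m]. *)
Definition formidx (m : nat) : finType :=
  {p : basidx W * {set 'I_n} | #|p.2| == (m + bdeg p.1)%N}.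

Definition wform (m : nat) : Type := formidx m -> 'rV[R]_n -> R.

(* The i-th component of a W-valued form at the point [x]. *)
Definition fcomp m (A : wform m) (i : basidx W) (x : 'rV[R]_n) : extalg :=
  fun S => if insub (i, S) is Some j then A j x else 0.

Definition of_fcomp m (B : basidx W -> 'rV[R]_n -> extalg) : wform m :=
  fun j x => B (val j).1 x (val j).2.

(* Omega_r(N, W)^m *)
Definition Omega (r : nat) (N : set 'rV[R]_n) (m : nat) := Cr r N (formidx m).

Definition form0 (A : wform 0) (x : 'rV[R]_n) : W 0%N :=
  W0vec (\row_j fcomp A (inl j) x finset.set0).

(* Omega_r(N, W|_U)^0 *)
Definition OmegaU r N (U : set (W 0%N)) : set (Omega r N 0) :=
  [set A | forall x, N x -> U (form0 A x)].

(* The value of xi^m when each xi^i is replaced by [al i]. *)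
Definition monom_eval (al : negidx W -> extalg) (m : monom W) : @extalg R n :=
  \big[wedge/ext_one]_(i <- enum (negidx W)) iter (m i) (wedge (al i)) ext_one.

Definition gsubst (a : galg W) (A : wform 0) (x : 'rV[R]_n) : extalg := fun S =>
  \sum_(m \in [set: monom W])
    a m (form0 A x) * monom_eval (fun i => fcomp A (inr i) x) m S.

Definition CQ (U : set (W 0%N)) (Q : gdifferential U) (A : wform 0) : wform 1 :=
  of_fcomp (fun i => gsubst (Q (ggen U i)) A).

(* With R(x, t) = tx, the differential of R maps the t-direction to [x] and is
   multiplication by [t] on R^n; hence the dx^S-coefficient of i_{d/dt} R^* al at
   (x, t) is t^#|S| times that of the contraction of al(tx) with x. *)
Definition dR_homotopy m (B : wform m.+1) : wform m :=
  of_fcomp (fun i x S =>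
    \int[lebesgue_measure]_(t in `[0, 1])
      (t ^+ #|S| * ext_contract x (fcomp B i (t *: x)) S)).

End Forms.
Arguments Omega {R n} W r N m.
Arguments OmegaU {R n W} r N U.

(* Main.v *)
(* The map A |-> h(C_Q(A)) is a Volterra operator.  Its derivative at A sends v to a
   sum of terms x_k int_0^1 t^q (c v)(t x) dt with C^r coefficients c.  In the C^r
   norm with derivatives of order s damped by e^s and functions divided by
   exp(lam |x|), lam = 1/e, such a term gains a factor O(e), because
   |x| int_0^1 exp(lam t |x|) dt <= exp(lam |x|) / lam and differentiation either
   falls on x_k, at the price of one power of e, or passes under the integral.  For
   large lam this norm, equivalent to the original one, makes the derivative a
   contraction, and a Gronwall-type iteration of the same estimate in the weighted
   sup norm shows that kappa is injective.  The contraction principle then gives that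
   kappa is open with a differentiable inverse; the same applies to the tangent map of
   kappa, so by induction the inverse is smooth.  Smoothness of C_Q itself reduces to
   that of the composition A |-> a(A) with a smooth function a of the 0-form part
   and to that of products of C^r functions. *)

Require Import Defs.
From HB Require Import structures.
From mathcomp Require Import all_boot all_order all_algebra.
From mathcomp Require Import all_classical all_reals all_analysis.
From mathcomp Require Import ring lra.

Set Implicit Arguments.
Unset Strict Implicit.
Unset Printing Implicit Defensive.

Import Order.TTheory GRing.Theory Num.Theory.
Import numFieldNormedType.Exports.

Local Open Scope classical_set_scope.
Local Open Scope ring_scope.

(** * Equations in abelian groups *)

(** The weight that makes the derivative a contraction depends on the coefficients of that
    derivative, hence on A. No single norm is available for all A, so the inversion theorem allows a
    renorming at each base point. Openness and differentiability of the inverse are local and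
    tolerate this. Injectivity is global, and the domain need not be convex, so the derivative
    cannot be integrated between two of its points; a pointwise Lipschitz bound for the given pair
    takes its place. What keeps the choice of lam from being circular is that multiplication by a
    C^r coefficient costs a constant free of lam and e: only the argument of the derivative is
    measured with weight and damping, the coefficient in the plain norm. C^r estimates are run on a
    recursive predicate that takes one derivative at a time, each continuous on all of N. Leibniz
    rule, chain rule and differentiation under the integral thereby become inductions on the order.
    Corners enter through the density of the interior in N, which determines the continued
    derivatives. *)

Inductive zexp := ZAtom of nat | Zzero | Zadd of zexp & zexp | Zopp of zexp.

Section Zexp.
Variable V : zmodType.

Fixpoint zeval (s : seq V) (e : zexp) : V :=
  match e with
  | ZAtom n => nth 0 s n
  | Zzero => 0
  | Zadd a b => zeval s a + zeval s b
  | Zopp a => - zeval s a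
  end.

Fixpoint zcoef (e : zexp) (k : nat) : int :=
  match e with
  | ZAtom n => (n == k)%:R
  | Zzero => 0
  | Zadd a b => zcoef a k + zcoef b k
  | Zopp a => - zcoef a k
  end.

Lemma zevalE s e : zeval s e = \sum_(k < size s) nth 0 s k *~ zcoef e k.
Proof.
elim: e => [n||a IHa b IHb|a IHa] /=.
- have [ns|ns] := ltnP n (size s).
    rewrite (bigD1 (Ordinal ns)) //= eqxx mulr1z big1 ?addr0 // => k.
    by rewrite -val_eqE eq_sym /= => /negbTE ->; rewrite mulr0z.
  rewrite nth_default // big1 // => k _.
  by rewrite gtn_eqF ?mulr0z // (leq_trans (ltn_ord k)).
- by rewrite big1 // => k _; rewrite mulr0z.
- by rewrite IHa IHb -big_split; apply: eq_bigr => k _; rewrite mulrzDr.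
- by rewrite IHa -sumrN; apply: eq_bigr => k _; rewrite mulrNz.
Qed.

(** Both sides are integer combinations of the same atoms, so it suffices to compare finitely many
    coefficients, a test that runs by computation. *)
Lemma zeval_eq s e1 e2 :
  all (fun k => zcoef e1 k == zcoef e2 k) (iota 0 (size s)) ->
  zeval s e1 = zeval s e2.
Proof.
move=> /allP H; rewrite !zevalE; apply: eq_bigr => k _.
by have /eqP -> := H k (ltac:(by rewrite mem_iota /=)).
Qed.
End Zexp.

Ltac zfind x s :=
  match s with
  | ?y :: _ => let _ := match goal with _ => unify x y end in constr:(O)
  | _ :: ?s' => let n := zfind x s' in constr:(S n)
  end.
Ltac zmem x s :=
  match s with
  | ?y :: _ => let _ := match goal with _ => unify x y end in constr:(true)
  | _ :: ?s' => zmem x s'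
  | nil => constr:(false)
  end.
Ltac zatoms e s :=
  lazymatch e with
  | (?a + ?b)%R => let s' := zatoms a s in zatoms b s'
  | (- ?a)%R => zatoms a s
  | 0%R => s
  | ?x => let b := zmem x s in
     lazymatch b with true => s | false => constr:(x :: s) end
  end.
Ltac zquote e s :=
  lazymatch e with
  | (?a + ?b)%R => let a' := zquote a s in let b' := zquote b s in constr:(Zadd a' b')
  | (- ?a)%R => let a' := zquote a s in constr:(Zopp a')
  | 0%R => constr:(Zzero)
  | ?x => let n := zfind x s in constr:(ZAtom n)
  end.
(* Decides equations between signed sums in an abelian group, which [ring]
   does not cover. *)
Ltac zmod :=
  lazymatch goal with
  | |- @eq ?T ?l ?r =>
    let s0 := zatoms l (@nil T) in let s := zatoms r s0 in
    let el := zquote l s in let er := zquote r s in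
    refine (@zeval_eq _ s el er _); vm_compute; reflexivity
  end.

(** * Calculus in normed spaces *)

Section NormedCalculus.
Context {R : realType}.
Implicit Types E F G : normedModType R.

Lemma near0_normP E (P : E -> Prop) :
  (\forall h \near (0 : E), P h) <-> exists2 d : R, 0 < d & forall h, `|h| < d -> P h.
Proof.
split=> [/nbhs_normP[d /= d0 dP]|[d d0 dP]].
  by exists d => // h hd; apply: dP; rewrite /= sub0r normrN.
by apply/nbhs_normP; exists d => //= h /=; rewrite sub0r normrN; exact: dP.
Qed.

Lemma near_normP E (x : E) (P : E -> Prop) :
  (\forall y \near x, P y) <-> exists2 d : R, 0 < d & forall h, `|h| < d -> P (x + h).
Proof. by rewrite nbhs0P; exact: near0_normP. Qed.

Lemma open_normP E (O : set E) (x : E) : open O -> O x ->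
  exists2 d : R, 0 < d & forall h, `|h| < d -> O (x + h).
Proof. by move=> oO Ox; apply/near_normP; exact: open_nbhs_nbhs. Qed.

(** [L] is a plain function: linearity and boundedness are supplied separately in [frechet_diff], so
    that candidate derivatives can be written as explicit formulas. *)
Definition is_frechet E F (f : E -> F) (x : E) (L : E -> F) :=
  forall e : R, 0 < e -> exists2 d : R, 0 < d &
    forall h, `|h| < d -> `|f (x + h) - f x - L h| <= e * `|h|.

Lemma differentiable_frechet E F (f : E -> F) x :
  differentiable f x -> is_frechet f x ('d f x).
Proof.
move=> /diff_locally /eqaddoP fx e e0.
have /near0_normP[d d0 H] := fx _ e0; exists d => // h /H.
by rewrite -[(f \o _ - _) h]/(f (h + x) - (f x + 'd f x h)) opprD addrA [h + x]addrC.
Qed.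

Lemma frechet_diff E F (f : E -> F) x (L : E -> F) :
  linear L -> (exists M, forall v, `|L v| <= M * `|v|) -> is_frechet f x L ->
  differentiable f x /\ 'd f x = L :> (E -> F).
Proof.
move=> Llin [M LM] fL.
pose LM' := GRing.isLinear.Build _ _ _ _ _ Llin.
pose L' : {linear E -> F} := HB.pack L LM'.
have Lc : continuous L'.
  apply: (@bounded_linear_continuous _ _ _ L').
  apply/linear_boundedP; exists (Num.max M 1); split; first exact: num_real.
  move=> r; rewrite gt_max => /andP[Mr _] v; apply: le_trans (LM v) _.
  by rewrite ler_wpM2r // ltW.
have H : f \o shift x = cst (f x) + L' +o_ 0 id.
  apply/eqaddoP => e e0; have [d d0 dH] := fL e e0.
  apply/near0_normP; exists d => // h /dH.
  by rewrite -[(f \o _ - _) h]/(f (h + x) - (f x + L h)) opprD addrA [h + x]addrC.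
have D : 'd f x = L :> (E -> F) by exact: (@diff_unique _ _ _ f L' x Lc H).
split=> //; apply/diff_locallyP; rewrite D; split => //.
Qed.

Lemma diff_bounded E F (f : E -> F) x : differentiable f x ->
  exists2 M, 0 < M & forall v, `|'d f x v| <= M * `|v|.
Proof. by move=> /diff_continuous/linear_lipschitz[k k0 H]; exists k. Qed.

Lemma near_eq_diff E F (f g : E -> F) x :
  (\forall y \near x, f y = g y) -> differentiable f x ->
  differentiable g x /\ 'd g x = 'd f x :> (E -> F).
Proof.
move=> /near_normP[d d0 fg] df; apply: frechet_diff.
- by move=> a u v; rewrite linearP.
- by have [M _ H] := diff_bounded df; exists M.
move=> e e0; have [d' d'0 H] := differentiable_frechet df e0.
exists (Num.min d d'); first by rewrite lt_min d0.
move=> h; rewrite lt_min => /andP[hd hd']; rewrite -fg // -[X in g X]addr0 -fg ?normr0 //.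
by rewrite addr0; exact: H.
Qed.

End NormedCalculus.

(** * Continuous seminorms and the mean value inequality *)

Section MeanValue.
Context {R : realType}.
Implicit Types E F G : normedModType R.

Definition seminorm E (p : E -> R) :=
  [/\ forall x y, p (x + y) <= p x + p y,
      forall (a : R) x, p (a *: x) = `|a| * p x &
      exists2 C, 0 < C & forall x, p x <= C * `|x|].

Definition equiv_norm E (p : E -> R) :=
  seminorm p /\ exists2 C, 0 < C & forall x, `|x| <= C * p x.

Lemma seminorm_norm E : seminorm (fun x : E => `|x|).
Proof.
split; [exact: ler_normD|exact: normrZ|].
by exists 1 => // x; rewrite mul1r.
Qed.

Section Seminorm.
Variables (E : normedModType R) (p : E -> R) (hp : seminorm p).

Lemma seminormN x : p (- x) = p x.
Proof. by case: hp => _ pZ _; rewrite -scaleN1r pZ normrN1 mul1r. Qed.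

Lemma seminorm0 : p 0 = 0.
Proof. by case: hp => _ pZ _; rewrite -(scale0r (0 : E)) pZ normr0 mul0r. Qed.

Lemma seminorm_ge0 x : 0 <= p x.
Proof.
case: hp => pD _ _; have := pD x (- x).
by rewrite subrr seminorm0 seminormN -mulr2n pmulrn_lge0.
Qed.

Lemma seminorm_distC x y : p (x - y) = p (y - x).
Proof. by rewrite -seminormN opprB. Qed.

End Seminorm.

(** Continuous induction along the segment, for the slope [M + e] with [e] arbitrary. The vector [w]
    turns the inequality into an estimate of Taylor remainders, and [p] allows it to be used after a
    renorming. *)
Lemma mean_value_le E F (f : E -> F) (p : F -> R) x v w M : seminorm p ->
  (forall t : R, 0 <= t <= 1 -> differentiable f (x + t *: v)) ->
  (forall t : R, 0 <= t <= 1 -> p ('d f (x + t *: v) v - w) <= M) ->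
  p (f (x + v) - f x - w) <= M.
Proof.
move=> hp df dM; have [pD pZ [C C0 pC]] := hp.
have M0 : 0 <= M.
  by apply: le_trans (seminorm_ge0 hp _) (dM 0 _); rewrite lexx ler01.
apply/ler_addgt0Pr => e e0.
pose phi (t : R) := f (x + t *: v) - t *: w.
(* Near each [t] the curve [phi] has slope at most [M + e]; the summand [e] absorbs the remainder of
   the derivative. *)
have straddle t : 0 <= t <= 1 -> exists2 d : R, 0 < d &
    forall h, `|h| < d -> p (phi (t + h) - phi t) <= (M + e) * `|h|.
  move=> t01; have k0 : 0 < C * (`|v| + 1) by rewrite mulr_gt0 // ltr_wpDl.
  have [d d0 H] := differentiable_frechet (df t t01) (divr_gt0 e0 k0).
  exists (d / (`|v| + 1)); first by rewrite divr_gt0 // ltr_wpDl.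
  move=> h; rewrite ltr_pdivlMr ?ltr_wpDl // => hd.
  have hv : `|h *: v| <= `|h| * (`|v| + 1) by rewrite normrZ ler_wpM2l ?lerDl.
  have -> : phi (t + h) - phi t =
      (f (x + t *: v + h *: v) - f (x + t *: v) - 'd f (x + t *: v) (h *: v)) +
      h *: ('d f (x + t *: v) v - w).
    rewrite /phi [(t + h) *: v]scalerDl addrA [(t + h) *: w]scalerDl.
    rewrite (scalerBr h) [in RHS](linearZZ ('d f (x + t *: v)) h v) /=.
    zmod.
  apply: le_trans (pD _ _) _; rewrite pZ mulrDl addrC lerD //.
    by rewrite mulrC ler_wpM2r // dM.
  apply: le_trans (pC _) _; rewrite -ler_pdivlMl //.
  apply: le_trans (H _ (le_lt_trans hv hd)) _.
  apply: le_trans (ler_wpM2l _ hv) _; first by rewrite divr_ge0 // ltW.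
  rewrite le_eqVlt; apply/orP; left; apply/eqP; field.
  by rewrite (gt_eqF C0) gt_eqF // ltr_wpDl.
(* The supremum [c] of [A] satisfies the bound, by [straddle] from a point just below [c]; if
   [c < 1], [straddle] would carry the bound beyond [c]. *)
pose A : set R := [set t | 0 <= t <= 1 /\
  forall s, 0 <= s <= t -> p (phi s - phi 0) <= (M + e) * s].
have A0 : A 0.
  split; first by rewrite lexx ler01.
  by move=> s; rewrite -eq_le => /eqP <-; rewrite subrr seminorm0 // mulr0.
have Aub : has_ubound A by exists 1 => t [/andP[]].
have hsA : has_sup A by split; [exists 0|].
set c := sup A.
have c01 : 0 <= c <= 1.
  by rewrite (ub_le_sup Aub) // ge_sup //; [exists 0|move=> t [/andP[]]].
have [c0 c1] := andP c01.
have below s : 0 <= s < c -> p (phi s - phi 0) <= (M + e) * s.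
  move=> /andP[s0 sc]; have := sc; rewrite -subr_gt0 => /(sup_adherent)/(_ hsA)[t [_ At]].
  by rewrite subKr => st; apply: At; rewrite s0 ltW.
have step t s : 0 <= t <= 1 -> p (phi t - phi 0) <= (M + e) * t ->
    p (phi s - phi t) <= (M + e) * (s - t) -> p (phi s - phi 0) <= (M + e) * s.
  move=> t01 pt ps; have -> : phi s - phi 0 = (phi s - phi t) + (phi t - phi 0) by zmod.
  apply: le_trans (pD _ _) _; apply: le_trans (lerD ps pt) _.
  by rewrite -mulrDr subrK.
have [d d0 H] := straddle c c01.
have cA : p (phi c - phi 0) <= (M + e) * c.
  have [c0'|c0'] := eqVneq c 0; first by rewrite c0' subrr seminorm0 // mulr0.
  have cgt : 0 < c by rewrite lt_neqAle eq_sym c0'.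
  have [s /andP[s0 sc] sd] : exists2 s, 0 <= s < c & c - s < d.
    exists (Num.max 0 (c - d / 2)).
      by rewrite le_max lexx /= gt_max cgt /= ltrBlDr ltrDl divr_gt0.
    have : c - d / 2 <= Num.max 0 (c - d / 2) by rewrite le_max lexx orbT.
    lra.
  apply: (step s); first by lra.
    by apply: below; rewrite s0.
  have := H (s - c); rewrite ltr0_norm ?subr_lt0 // opprB => /(_ sd).
  by rewrite subrKC seminorm_distC.
have cE : c = 1.
  apply/eqP; rewrite eq_le c1 /= leNgt; apply/negP => c1'.
  pose s := Num.min 1 (c + d / 2).
  have cs : c < s by rewrite lt_min c1' ltrDl divr_gt0.
  have : A s.
    split; first by rewrite ge_min lexx (ltW (le_lt_trans c0 cs)).
    move=> u /andP[u0 us]; have [uc|cu] := ltP u c; first by apply: below; rewrite u0.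
    apply: (step c) => //.
    have : s <= c + d / 2 by rewrite ge_min lexx orbT.
    move=> sd; have := H (u - c); rewrite ger0_norm ?subr_ge0 // subrKC; apply.
    lra.
  by move=> /(ub_le_sup Aub); rewrite leNgt cs.
move: cA; rewrite cE mulr1 /phi !scale1r !scale0r addr0 subr0.
by have -> : f (x + v) - f x - w = f (x + v) - w - f x by zmod.
Qed.

End MeanValue.

(** * Differentiability through iterated tangent maps *)

Section Smoothness.
Context {R : realType}.
Implicit Types E F G H : normedModType R.

(* C^k through iterated tangent maps (x, v) |-> 'd f x v, which spares spaces of
   multilinear maps: for all k this is the same as [smooth_on]. *)
Fixpoint Sm (k : nat) : forall E F, set E -> (E -> F) -> Prop :=
  if k is k'.+1 then fun E F O f =>
    (forall x, O x -> differentiable f x) /\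
    @Sm k' (E * E)%type F (O `*` setT) (fun p => 'd f (p.1) p.2)
  else fun _ _ _ _ => True.

Definition blin E F (L : E -> F) :=
  linear L /\ exists M, forall v, `|L v| <= M * `|v|.

Lemma blin_diff E F (L : E -> F) x : blin L -> differentiable L x /\ 'd L x = L :> (E -> F).
Proof.
move=> [Llin LM]; apply: frechet_diff => // e e0; exists 1 => // h _.
have LD u v : L (u + v) = L u + L v by have := Llin 1 u v; rewrite !scale1r.
have -> : L (x + h) - L x - L h = 0 by rewrite LD; zmod.
by rewrite normr0 mulr_ge0 // ltW.
Qed.

Lemma blin_cts E F (L : E -> F) : blin L -> continuous L.
Proof. by move=> /blin_diff => H x; apply/differentiable_continuous; have [] := H x. Qed.

Lemma blin_fst E F : blin (fun p : E * F => p.1).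
Proof.
split=> //; exists 1 => v; rewrite mul1r prod_normE le_max lexx //.
Qed.

Lemma blin_snd E F : blin (fun p : E * F => p.2).
Proof.
split=> //; exists 1 => v; rewrite mul1r prod_normE le_max lexx orbT //.
Qed.

Lemma blin_pair E F G (L : E -> F) (L' : E -> G) :
  blin L -> blin L' -> blin (fun x => (L x, L' x)).
Proof.
move=> [Ll [M HM]] [Ll' [M' HM']]; split.
  by move=> a u v; rewrite Ll Ll'.
exists (`|M| + `|M'|) => v; rewrite prod_normE ge_max /=.
apply/andP; split.
  apply: le_trans (HM v) _; rewrite ler_wpM2r //.
  by rewrite ler_wpDr // ler_norm.
apply: le_trans (HM' v) _; rewrite ler_wpM2r //.
by rewrite ler_wpDl // ler_norm.
Qed.

Lemma blin_comp E F G (L : E -> F) (L' : F -> G) :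
  blin L -> blin L' -> blin (L' \o L).
Proof.
move=> [Ll [M HM]] [Ll' [M' HM']]; split.
  by move=> a u v /=; rewrite Ll Ll'.
exists (`|M'| * M) => v /=; apply: le_trans (HM' _) _; rewrite -mulrA.
apply: le_trans (ler_wpM2r (normr_ge0 _) (ler_norm M')) _.
by rewrite ler_wpM2l.
Qed.

Lemma blin_id E : blin (@id E).
Proof. by split=> //; exists 1 => v; rewrite mul1r. Qed.

Lemma blin0 E F : blin (fun _ : E => 0 : F).
Proof.
split=> [a u v|]; first by rewrite scaler0 addr0.
by exists 0 => v; rewrite normr0 mul0r.
Qed.

Lemma diff_blin E F (f : E -> F) x : differentiable f x -> blin ('d f x).
Proof.
move=> /diff_bounded[M _ HM]; split; last by exists M.
by move=> a u v; rewrite linearP.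
Qed.

Lemma openTangent E (O : set E) : open O -> open (O `*` [set: E]).
Proof.
move=> oO; rewrite (_ : _ `*` _ = (fun p : E * E => p.1) @^-1` O).
  apply: open_comp => // p _; exact: blin_cts (blin_fst _ _) _.
by apply/seteqP; split=> p; rewrite /setX/=; tauto.
Qed.

Lemma Sm_congr k E F (O : set E) (f g : E -> F) : open O ->
  (forall x, O x -> f x = g x) -> Sm k O f -> Sm k O g.
Proof.
elim: k E O f g => [//|k IH] E O f g oO fg /= [df Sf].
have H x : O x -> differentiable g x /\ 'd g x = 'd f x :> (E -> F).
  move=> Ox; apply: near_eq_diff; last exact: df.
  by apply: filterS (open_nbhs_nbhs (conj oO Ox)) => y /fg.
split; first by move=> x /H[].
apply: IH Sf; first exact: openTangent.
by move=> p [/H[_ E'] _]; exact: (esym (congr1 (@^~ p.2) E')).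
Qed.

Lemma Sm_sub k E F (O O' : set E) (f : E -> F) : O' `<=` O -> Sm k O f -> Sm k O' f.
Proof.
elim: k E O O' f => [//|k IH] E O O' f sO [df Sf]; split=> [x /sO|]; first exact: df.
by apply: IH Sf => p [/= /sO].
Qed.

Lemma Sm_le k E F (O : set E) (f : E -> F) : Sm k.+1 O f -> Sm k O f.
Proof. by elim: k E O f => [//|k IH] E O f [df /IH]. Qed.

Lemma Sm_post k E F G (O : set E) (f : E -> F) (L : F -> G) : open O ->
  blin L -> Sm k O f -> Sm k O (L \o f).
Proof.
elim: k E O f => [//|k IH] E O f oO bL [df Sf].
have H x : O x -> differentiable (L \o f) x /\ 'd (L \o f) x = L \o 'd f x :> (E -> G).
  move=> /df dfx; have [dL LE] := blin_diff (f x) bL.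
  by split; [exact: differentiable_comp|rewrite diff_comp // LE].
split; first by move=> x /H[].
apply: Sm_congr (IH _ _ _ _ bL Sf); [exact: openTangent| |exact: openTangent].
by move=> p [/H[_ E'] _]; exact: (esym (congr1 (@^~ p.2) E')).
Qed.

Lemma open_blin_preimage E F (O : set F) (L : E -> F) : blin L -> open O ->
  open (L @^-1` O).
Proof. by move=> bL oO; apply: open_comp => // x _; exact: blin_cts. Qed.

Lemma blin_affine_diff E F (L : E -> F) c x : blin L ->
  differentiable (fun x => L x + c) x /\ 'd (fun x => L x + c) x = L :> (E -> F).
Proof.
move=> /(blin_diff x)[dL LE].
have dc : differentiable (fun _ : E => c) x by exact: differentiable_cst.
split; first exact: differentiableD dL dc.
rewrite (diffD dL dc) LE; apply/funext => v /=.
by rewrite (diff_cst c x) addr0.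
Qed.

Lemma open_affine_preimage E F (O : set F) (L : E -> F) c : blin L -> open O ->
  open [set x | O (L x + c)].
Proof.
move=> bL oO; apply: (@open_comp _ _ (fun x => L x + c)) => // x _.
by have [/differentiable_continuous H _] := blin_affine_diff c x bL.
Qed.

(** Affine substitutions are needed because fixing one argument of a map on a product is the
    substitution of (x, 0) + (0, h). In the induction the tangent map is again affine, with constant
    [(c, 0)]. *)
Lemma Sm_affine k E F G (O : set F) (f : F -> G) (L : E -> F) c : open O ->
  blin L -> Sm k O f -> Sm k [set x | O (L x + c)] (fun x => f (L x + c)).
Proof.
elim: k E F O f L c => [//|k IH] E F O f L c oO bL [df Sf].
have H x : O (L x + c) -> differentiable (f \o (fun x => L x + c)) x /\
    'd (f \o (fun x => L x + c)) x = 'd f (L x + c) \o L :> (E -> G).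
  move=> /df dfx; have [dL LE] := blin_affine_diff c x bL.
  by split; [exact: differentiable_comp|rewrite diff_comp // LE].
split; first by move=> x /H[].
have bLL : blin (fun p : E * E => (L p.1, L p.2)).
  by apply: blin_pair; [exact: blin_comp (blin_fst _ _) bL|exact: blin_comp (blin_snd _ _) bL].
have oT := openTangent (open_affine_preimage c bL oO).
apply: Sm_congr (Sm_sub _ (IH _ _ _ _ _ (c, 0) (openTangent oO) bLL Sf)) => //.
  move=> p [/H[_ E'] _] /=.
  by rewrite addr0; exact: (esym (congr1 (@^~ p.2) E')).
Qed.

Lemma Sm_pre k E F G (O : set F) (f : F -> G) (L : E -> F) : open O ->
  blin L -> Sm k O f -> Sm k (L @^-1` O) (f \o L).
Proof.
move=> oO bL /(Sm_affine 0 oO bL).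
have -> : (fun x => f (L x + 0)) = f \o L by apply/funext => x; rewrite addr0.
by apply: Sm_sub => x /=; rewrite addr0.
Qed.

Lemma Sm_cst k E F (O : set E) (c : F) : open O -> Sm k O (fun _ => c).
Proof.
elim: k E O c => [//|k IH] E O c oO; split=> [x _|]; first exact: differentiable_cst.
apply: Sm_congr (IH _ _ 0 _); [exact: openTangent| |exact: openTangent].
by move=> p _; rewrite (diff_cst c p.1).
Qed.

Lemma Sm_blin k E F (L : E -> F) : blin L -> Sm k setT L.
Proof.
elim: k E L => [//|k IH] E L bL; split; first by move=> x _; have [] := blin_diff x bL.
have bL2 := blin_comp (blin_snd E E) bL.
apply: Sm_congr (Sm_sub _ (IH _ _ bL2)) => //; first exact/openTangent/openT.
by move=> p _ /=; have [_ ->] := blin_diff p.1 bL.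
Qed.

Lemma SmD k E F (O : set E) (f g : E -> F) : open O ->
  Sm k O f -> Sm k O g -> Sm k O (fun x => f x + g x).
Proof.
elim: k E O f g => [//|k IH] E O f g oO [df Sf] [dg Sg].
split=> [x Ox|]; first by apply: differentiableD; [exact: df|exact: dg].
have oT := openTangent oO.
apply: Sm_congr (IH _ _ _ _ oT Sf Sg) => // p [/= Op _].
exact: (esym (congr1 (@^~ p.2) (diffD (df _ Op) (dg _ Op)))).
Qed.

Lemma Sm_sum k E F (I : Type) (s : seq I) (P : pred I) (O : set E) (f : I -> E -> F) : open O ->
  (forall i, P i -> Sm k O (f i)) -> Sm k O (fun x => \sum_(i <- s | P i) f i x).
Proof.
move=> oO Sf; elim: s => [|i s IH].
  by apply: Sm_congr (Sm_cst k 0 oO) => // x _; rewrite big_nil.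
case Pi : (P i).
  by apply: Sm_congr (SmD oO (Sf i Pi) IH) => // x _; rewrite big_cons Pi.
by apply: Sm_congr IH => // x _; rewrite big_cons Pi.
Qed.

Lemma Sm_tangent_pre k E F (O : set E) (f : E -> F) : open O ->
  Sm k O f -> Sm k (O `*` [set: E]) (fun p => f p.1).
Proof.
move=> oO /(Sm_pre oO (blin_fst E E)); apply: Sm_sub.
by move=> p [].
Qed.

Definition bbilin E F G (B : E -> F -> G) :=
  [/\ forall x, linear (B x), forall y, linear (B^~ y) &
      exists M, forall x y, `|B x y| <= M * `|x| * `|y|].

Lemma bbilin_diff E F G H (f : E -> F) (g : E -> G) (B : F -> G -> H) x :
  bbilin B -> differentiable f x -> differentiable g x ->
  differentiable (fun x => B (f x) (g x)) x /\
  'd (fun x => B (f x) (g x)) x = (fun v => B ('d f x v) (g x) + B (f x) ('d g x v)) :> (E -> H).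
Proof.
move=> bB df dg.
have [Br Bl [M0 HM0]] := bB.
pose M := `|M0| + 1; have M_gt0 : 0 < M by rewrite ltr_wpDl.
have HM u v : `|B u v| <= M * `|u| * `|v|.
  apply: le_trans (HM0 u v) _; rewrite !ler_wpM2r //.
  by rewrite ler_wpDr // ler_norm.
have BDr u v v' : B u (v + v') = B u v + B u v' by have := Br u 1 v v'; rewrite !scale1r.
have BDl u u' v : B (u + u') v = B u v + B u' v by have := Bl v 1 u u'; rewrite !scale1r.
have [Mf Mf0 HMf] := diff_bounded df; have [Mg Mg0 HMg] := diff_bounded dg.
apply: frechet_diff.
- by move=> a u v; rewrite !linearP /= Br Bl scalerDr; zmod.
- exists (M * Mf * `|g x| + M * `|f x| * Mg) => v.
  rewrite mulrDl (le_trans (ler_normD _ _)) // lerD //.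
    have -> : M * Mf * `|g x| * `|v| = M * (Mf * `|v|) * `|g x| by ring.
    by apply: le_trans (HM _ _) _; rewrite ler_wpM2r // ler_wpM2l // ltW.
  apply: le_trans (HM _ _) _; rewrite -[leRHS]mulrA ler_wpM2l //.
  by rewrite mulr_ge0 // ltW.
move=> e e0; pose K := `|g x| + `|f x| + (Mf + 1) * (Mg + 1).
have K0 : 0 < K by rewrite ltr_wpDl ?addr_ge0 // mulr_gt0 // addr_gt0.
(* [n] bounds [|h|] and the relative remainders of both factors. From [n <= 1] come the local
   Lipschitz constants [Mf + 1] and [Mg + 1], and the total error is at most [M * n * |h| * K]. *)
have [n n0 [n1 ne]] : exists2 n, 0 < n & n <= 1 /\ n <= e / (M * K).
  exists (Num.min 1 (e / (M * K))); last by rewrite !ge_min !lexx orbT.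
  by rewrite lt_min ltr01 divr_gt0 // mulr_gt0.
have [d1 d10 H1] := differentiable_frechet df n0.
have [d2 d20 H2] := differentiable_frechet dg n0.
exists (Num.min n (Num.min d1 d2)); first by rewrite !lt_min n0 d10.
move=> h; rewrite !lt_min => /andP[hn /andP[/H1 h1 /H2 h2]].
set rf := f (x + h) - _ - _ in h1; set rg := g (x + h) - _ - _ in h2.
have lip F' (u v : F') m : `|u| <= n * `|h| -> `|v| <= m * `|h| ->
    `|u + v| <= (m + 1) * `|h|.
  move=> u1 v1; apply: le_trans (ler_normD _ _) _; rewrite mulrDl addrC lerD //.
  by apply: le_trans u1 _; rewrite ler_wpM2r.
have lf := lip _ _ _ _ h1 (HMf h); have lg := lip _ _ _ _ h2 (HMg h).
have -> : f (x + h) = f x + (rf + 'd f x h) by rewrite /rf; zmod.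
have -> : g (x + h) = g x + (rg + 'd g x h) by rewrite /rg; zmod.
have -> : B (f x + (rf + 'd f x h)) (g x + (rg + 'd g x h)) - B (f x) (g x) -
   (B ('d f x h) (g x) + B (f x) ('d g x h)) =
   B rf (g x) + B (f x) rg + B (rf + 'd f x h) (rg + 'd g x h).
  by rewrite [B (f x + _) _]BDl ![B _ (g x + _)]BDr [B (f x) (rg + _)]BDr
    [B (_ + _) (g x)]BDl; zmod.
have -> : e * `|h| = M * (e / (M * K)) * `|h| * K.
  by field; rewrite (gt_eqF M_gt0) gt_eqF.
apply: (@le_trans _ _ (M * n * `|h| * K)); last first.
  have K0' := ltW K0; have M0' := ltW M_gt0.
  by do 2!apply: ler_wpM2r => //; apply: ler_wpM2l.
have -> : M * n * `|h| * K = M * (n * `|h|) * `|g x| + M * `|f x| * (n * `|h|) +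
    M * n * `|h| * ((Mf + 1) * (Mg + 1)) by rewrite /K; ring.
apply: le_trans (ler_normD _ _) _; apply: lerD; last first.
  apply: le_trans (HM _ _) _.
  apply: le_trans (ler_pM _ _ (ler_wpM2l (ltW M_gt0) lf) lg) _ => //.
    by rewrite mulr_ge0 // ltW.
  have -> : M * ((Mf + 1) * `|h|) * ((Mg + 1) * `|h|) =
    M * `|h| * ((Mf + 1) * (Mg + 1)) * `|h| by ring.
  have -> : M * n * `|h| * ((Mf + 1) * (Mg + 1)) =
    M * `|h| * ((Mf + 1) * (Mg + 1)) * n by ring.
  apply: ler_wpM2l; last exact: ltW.
  by rewrite !mulr_ge0 ?addr_ge0 // ltW.
apply: le_trans (ler_normD _ _) _; apply: lerD.
  by apply: le_trans (HM _ _) _; rewrite ler_wpM2r // ler_wpM2l // ltW.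
by apply: le_trans (HM _ _) _; rewrite ler_wpM2l // mulr_ge0 // ltW.
Qed.

Lemma Sm_bilin k E F G H (O : set E) (f : E -> F) (g : E -> G) (B : F -> G -> H) :
  bbilin B -> open O ->
  Sm k O f -> Sm k O g -> Sm k O (fun x => B (f x) (g x)).
Proof.
move=> bB; elim: k E O f g => [//|k IH] E O f g oO Sf Sg.
have [/= df Sdf] := Sf; have [/= dg Sdg] := Sg; move: Sf Sg.
move=> /Sm_le/(Sm_tangent_pre oO) Sf /Sm_le/(Sm_tangent_pre oO) Sg.
have K x (Ox : O x) := bbilin_diff bB (df x Ox) (dg x Ox).
split; first by move=> x /K[].
have oT := openTangent oO.
apply: Sm_congr (SmD oT (IH _ _ _ _ oT Sdf Sg) (IH _ _ _ _ oT Sf Sdg)) => //.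
by move=> p [/= /K[_ ->]].
Qed.

End Smoothness.

(** * Iterated directional derivatives and their multilinear bounds *)

Section SmoothOn.
Context {R : realType}.
Implicit Types E F G H : normedModType R.

Definition Smooth E F (O : set E) (f : E -> F) := forall k, Sm k O f.

Lemma Smooth_diff E F (O : set E) (f : E -> F) x : Smooth O f -> O x -> differentiable f x.
Proof. by move=> /(_ 1%N)[H _]; exact: H. Qed.

Lemma Smooth_tangent E F (O : set E) (f : E -> F) : Smooth O f ->
  Smooth (O `*` [set: E]) (fun p => 'd f (p.1) p.2).
Proof. by move=> Sf k; exact: (proj2 (Sf k.+1)). Qed.

(** The last entry of the list is the direction differentiated first, so that [Dl f (h :: s)] is the
    derivative of [Dl f s], the order that [smooth_on] prescribes. *)
Fixpoint Dl E F (f : E -> F) (s : seq E) : E -> F :=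
  if s is h :: s' then fun x => 'd (Dl f s') x h else f.

Lemma Dl_cat E F (f : E -> F) s s' : Dl f (s ++ s') = Dl (Dl f s') s.
Proof.
elim: s => [//|h s IH]; exact: (congr1 (fun g x => 'd g x h) IH).
Qed.

Lemma Smooth_dir E F (O : set E) (f : E -> F) h : open O -> Smooth O f ->
  Smooth O (fun x => 'd f x h).
Proof.
move=> oO Sf k.
have bL : blin (fun x : E => (x, 0 : E)) by apply: blin_pair; [exact: blin_id|exact: blin0].
have := Sm_affine (0, h) (openTangent oO) bL (Smooth_tangent Sf k) => S.
apply: Sm_congr (Sm_sub _ S) => //= [x Ox|x Ox].
  by rewrite addr0 add0r.
by split=> //=; rewrite addr0.
Qed.

Lemma Smooth_Dl E F (O : set E) (f : E -> F) s : open O -> Smooth O f -> Smooth O (Dl f s).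
Proof. by move=> oO Sf; elim: s => //= h s IH; exact: Smooth_dir. Qed.

Lemma Dl_congr E F (O : set E) (f g : E -> F) s x : open O -> Smooth O f ->
  (forall x, O x -> f x = g x) -> O x -> Dl f s x = Dl g s x.
Proof.
move=> oO Sf fg; elim: s x => [|h s IH] x Ox /=; first exact: fg.
have fgx : \forall y \near x, Dl f s y = Dl g s y.
  by apply: filterS (open_nbhs_nbhs (conj oO Ox)) => y /IH.
have [_ E'] := near_eq_diff fgx (Smooth_diff (Smooth_Dl s oO Sf) Ox).
exact: (esym (congr1 (@^~ h) E')).
Qed.

Lemma Dl_lin E F (O : set E) (f g : E -> F) a s x : open O -> Smooth O f -> Smooth O g ->
  O x -> Dl (fun x => a *: f x + g x) s x = a *: Dl f s x + Dl g s x.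
Proof.
move=> oO Sf Sg; elim: s x => [//|h s IH] x Ox /=.
have Sfs := Smooth_Dl s oO Sf; have Sgs := Smooth_Dl s oO Sg.
have dfs := Smooth_diff Sfs Ox; have dgs := Smooth_diff Sgs Ox.
have dafs : differentiable (a *: Dl f s) x by exact: differentiableZ.
have dD : differentiable (a *: Dl f s + Dl g s) x by exact: differentiableD.
have fgx : \forall y \near x, (a *: Dl f s + Dl g s) y = Dl (fun x => a *: f x + g x) s y.
  by apply: filterS (open_nbhs_nbhs (conj oO Ox)) => y /IH.
have [_ E'] := near_eq_diff fgx dD.
rewrite (congr1 (@^~ h) E') (congr1 (@^~ h) (diffD dafs dgs)).
exact: (congr1 (fun g : E -> F => g h + _) (diffZ a dfs)).
Qed.

(** The middle slot is a differential of [Dl f s2], linear in its direction; the outer derivatives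
    along [s1] respect linear combinations of functions. *)
Lemma Dl_multilin E F (O : set E) (f : E -> F) s1 s2 a u v x : open O -> Smooth O f -> O x ->
  Dl f (s1 ++ (a *: u + v) :: s2) x = a *: Dl f (s1 ++ u :: s2) x + Dl f (s1 ++ v :: s2) x.
Proof.
move=> oO Sf Ox; rewrite !Dl_cat /=.
have Sd h := Smooth_dir h oO (Smooth_Dl s2 oO Sf).
rewrite -(Dl_lin a s1 oO (Sd u) (Sd v) Ox).
by congr (Dl _ s1 x); apply/funext => y; rewrite linearP.
Qed.

Lemma scaleB1D (V : lmodType R) (a : R) (y : V) : (a - 1) *: y + y = a *: y.
Proof. by rewrite scalerBl scale1r subrK. Qed.

Lemma Smooth_cts E F (O : set E) (f : E -> F) x (e : R) : Smooth O f -> O x -> 0 < e ->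
  exists2 d : R, 0 < d & forall h, `|h| < d -> `|f (x + h) - f x| < e.
Proof.
move=> Sf Ox e0; have /differentiable_continuous/cvgrPdist_lt/(_ _ e0) := Smooth_diff Sf Ox.
by move=> /near_normP[d d0 H]; exists d => // h /H; rewrite distrC.
Qed.

(** Tangent maps carry no operator norm bound by definition; it is extracted by induction. The
    direction differentiated first becomes a further parameter, so that the induction hypothesis
    bounds all small directions uniformly, and homogeneity reaches the others. [V] collects these
    parameters. *)
Lemma Dl_bound k E (V : normedModType R) F (O : set E) (f : E * V -> F) x v : open O ->
  Smooth (O `*` [set: V]) f -> O x ->
  exists2 d : R, 0 < d & exists2 M, 0 <= M & forall h w, `|h| < d -> `|w| < d ->
    O (x + h) /\ forall s, size s = k ->
    `|Dl (fun z => f (z, v + w)) s (x + h)| <= M * \prod_(u <- s) `|u|.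
Proof.
elim: k V f v => [|k IH] V f v oO Sf Ox.
  have [d1 d10 H1] := open_normP oO Ox.
  have [|d2 d20 H2] := @Smooth_cts _ _ _ _ (x, v) 1 Sf _ ltr01; first by split.
  exists (Num.min d1 d2); first by rewrite lt_min d10.
  exists (`|f (x, v)| + 1) => [|h w]; first by rewrite addr_ge0.
  rewrite !lt_min => /andP[h1 h2] /andP[_ w2]; split; first exact: H1.
  move=> s /size0nil -> /=; rewrite big_nil mulr1.
  have /H2 : `|(h, w)| < d2 by rewrite prod_normE gt_max h2.
  rewrite -[(x, v) + _]/(x + h, v + w) => /ltW H.
  by rewrite -[f _](subrK (f (x, v))) addrC (le_trans (ler_normD _ _)) // lerD.
have oOV : open (O `*` [set: V]).
  rewrite (_ : _ `*` _ = (fun p : E * V => p.1) @^-1` O).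
    by apply: open_blin_preimage => //; exact: blin_fst.
  by apply/seteqP; split=> p; rewrite /setX/=; tauto.
pose g (p : E * (V * E)) := 'd f (p.1, p.2.1) (p.2.2, 0).
have Sg : Smooth (O `*` [set: V * E]) g.
  move=> m.
  have bL : blin (fun p : E * (V * E) => ((p.1, p.2.1), (p.2.2, 0 : V))).
    have b1 := blin_fst E (V * E)%type; have b2 := blin_snd E (V * E)%type.
    apply: blin_pair; apply: blin_pair => //; last exact: blin0.
      exact: blin_comp b2 (blin_fst _ _).
    exact: blin_comp b2 (blin_snd _ _).
  apply: Sm_sub (Sm_pre (openTangent oOV) bL (Smooth_tangent Sf m)).
  by move=> p [].
have [d d0 [M M0 H]] := IH _ g (v, 0) oO Sg Ox.
exists d => //; exists (M * (2 / d)); first by rewrite !mulr_ge0 // invr_ge0 ltW.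
move=> h w hd wd; have [|Oxh _] := H h (w, 0) hd.
  by rewrite prod_normE gt_max wd normr0.
split=> // s; case/lastP: s => [//|s u]; rewrite size_rcons => -[sk].
have Sfw : Smooth O (fun z => f (z, v + w)).
  have bL : blin (fun x : E => (x, 0 : V)) by apply: blin_pair; [exact: blin_id|exact: blin0].
  move=> m; apply: Sm_congr (Sm_sub _ (Sm_affine (0, v + w) oOV bL (Sf m))) => // z Oz.
    by rewrite -[(z, 0) + _]/(z + 0, 0 + (v + w)) addr0 add0r.
  by split=> //=; rewrite addr0.
have Sgu a : Smooth O (fun z => g (z, (v + w, a))).
  have bL : blin (fun x : E => (x, 0 : V * E)) by apply: blin_pair; [exact: blin_id|exact: blin0].
  move=> m; have oO' : open (O `*` [set: V * E]).
    rewrite (_ : _ `*` _ = (fun p : E * (V * E) => p.1) @^-1` O).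
      by apply: open_blin_preimage => //; exact: blin_fst.
    by apply/seteqP; split=> p; rewrite /setX/=; tauto.
  apply: Sm_congr (Sm_sub _ (Sm_affine (0, (v + w, a)) oO' bL (Sg m))) => // z Oz.
    by rewrite -[(z, 0) + _]/(z + 0, (0 + (v + w), 0 + a)) addr0 !add0r.
  by split=> //=; rewrite addr0.
rewrite -cats1 Dl_cat /= big_cat /= big_seq1.
have -> : Dl (fun z => 'd (fun z => f (z, v + w)) z u) s (x + h) =
    Dl (fun z => g (z, (v + w, u))) s (x + h).
  apply: (Dl_congr s oO) => //; first exact: Smooth_dir.
  move=> z Oz; have bL : blin (fun x : E => (x, 0 : V)) by apply: blin_pair; [exact: blin_id|exact: blin0].
  have [dL LE] := blin_affine_diff (0, v + w) z bL.
  have E0 : (fun z => (z, v + w)) = (fun x : E => (x, 0 : V) + (0, v + w)).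
    by apply/funext => y; rewrite -[RHS]/(y + 0, 0 + (v + w)) addr0 add0r.
  have df : differentiable f (z, v + w) by apply: (Smooth_diff Sf).
  rewrite -E0 in dL LE; have := diff_comp dL df.
  by move=> /(congr1 (@^~ u)); rewrite LE.
(* A zero direction cannot be rescaled. Here the function is zero, hence equal to its own negative
   plus itself, and [Dl_lin] makes its derivative vanish. *)
have [->|u0] := eqVneq u 0.
  have -> : (fun z => g (z, (v + w, 0))) = (fun z => 0 *: g (z, (v + w, 0)) + g (z, (v + w, 0))).
    by apply/funext => z; rewrite scale0r add0r.
  have : Dl (fun z => (-1) *: g (z, (v + w, 0)) + g (z, (v + w, 0))) s (x + h) =
      Dl (fun z => g (z, (v + w, 0))) s (x + h).
    by congr (Dl _ s _); apply/funext => z; rewrite /g /= (linear0 ('d f _)) scaler0 addr0.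
  rewrite (Dl_lin (-1) s oO (Sgu _) (Sgu _) Oxh) scaleN1r addrC subrr => E0.
  by rewrite (Dl_lin 0 s oO (Sgu _) (Sgu _) Oxh) -E0 scaler0 addr0 !normr0 !mulr0.
have nu : 0 < `|u| by rewrite normr_gt0.
(* [a *: u] has length [d / 2], within reach of the induction hypothesis; dividing by [a] produces
   the factor [2 / d] in the constant. *)
pose a := d / (2 * `|u|).
have a0 : 0 < a by rewrite divr_gt0 // mulr_gt0.
have [|_ /(_ s sk)] := H h (w, a *: u) hd.
  rewrite prod_normE gt_max wd /= normrZ gtr0_norm // /a.
  have -> : d / (2 * `|u|) * `|u| = d / 2 by field; rewrite gt_eqF.
  by lra.
rewrite -[(v, 0) + _]/(v + w, 0 + a *: u) add0r.
have -> : (fun z => g (z, (v + w, a *: u))) =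
    (fun z => (a - 1) *: g (z, (v + w, u)) + g (z, (v + w, u))).
  apply/funext => z; rewrite scaleB1D /g /=.
  rewrite -linearZZ; congr ('d f _ _).
  by rewrite -[RHS]/(a *: u, a *: (0 : V)) scaler0.
rewrite (Dl_lin (a - 1) s oO (Sgu _) (Sgu _) Oxh) scaleB1D.
rewrite normrZ gtr0_norm // -ler_pdivlMl //.
move=> /le_trans; apply; rewrite /a invf_div le_eqVlt; apply/orP; left; apply/eqP.
by ring.
Qed.

End SmoothOn.

(** * Inverses of perturbations of the identity *)

Section SmoothOn2.
Context {R : realType}.
Implicit Types E F G H : normedModType R.

Lemma Smooth_smooth_on E F (O : set E) (f : E -> F) : open O -> Smooth O f -> smooth_on O f.
Proof.
move=> oO Sf; exists (fun x s => Dl f s x) => x Ox.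
have bound k : exists2 d : R, 0 < d & exists2 M, 0 <= M & forall h, `|h| < d ->
    O (x + h) /\ forall s, size s = k -> `|Dl f s (x + h)| <= M * \prod_(u <- s) `|u|.
  have Sf' : Smooth (O `*` [set: E]) (fun p => f p.1) by move=> m; exact: Sm_tangent_pre.
  have [d d0 [M M0 H]] := Dl_bound k 0 oO Sf' Ox.
  by exists d => //; exists M => // h hd; apply: (H h 0) => //; rewrite normr0.
split=> //.
- by move=> s1 s2 a u v; exact: (Dl_multilin _ _ _ _ _ oO Sf Ox).
- move=> k; have [d d0 [M M0 H]] := bound k; exists M => s sk.
  by have [|_ /(_ s sk)] := H 0; rewrite ?normr0 ?addr0.
(* Two mean value estimates bound the remainder by the derivative of order [k + 2], which gives
   [M * |h| ^+ 2] times the product of norms; [|h| < e / (M + 1)] then suffices. *)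
move=> k e e0; have [d d0 [M M0 H]] := bound k.+2.
apply/near0_normP; exists (Num.min d (e / (M + 1))).
  by rewrite lt_min d0 divr_gt0 // ltr_wpDl.
move=> h; rewrite lt_min ltr_pdivlMr ?ltr_wpDl // => /andP[hd he] s sk.
have scale_lt (t : R) : 0 <= t <= 1 -> `|t *: h| < d.
  by move=> /andP[t0 t1]; rewrite normrZ ger0_norm // (le_lt_trans _ hd) // ler_piMl.
have dDl s' t : 0 <= t <= 1 -> differentiable (Dl f s') (x + t *: h).
  move=> t01; apply: (Smooth_diff (Smooth_Dl s' oO Sf)).
  by have [] := H (t *: h) (scale_lt _ t01).
have P0 : 0 <= \prod_(v <- s) `|v| by apply: prodr_ge0.
apply: (mean_value_le (seminorm_norm F)) => [t t01|t t01]; first exact: dDl.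
have -> : e * `|h| * \prod_(v <- s) `|v| = (e * \prod_(v <- s) `|v|) * `|h| by ring.
have := @mean_value_le _ _ _ (Dl f (h :: s)) _ x (t *: h) 0
  (M * (`|h| * (`|h| * \prod_(v <- s) `|v|))) (seminorm_norm F).
rewrite subr0 => le; apply: le_trans (le _ _) _.
- move=> u u01; rewrite scalerA; apply: dDl.
  have [/andP[u0 u1] /andP[t0 t1]] := (u01, t01).
  by rewrite mulr_ge0 // mulr_ile1.
- move=> u u01; rewrite scalerA subr0.
  have ut01 : 0 <= u * t <= 1.
    have [/andP[u0 u1] /andP[t0 t1]] := (u01, t01).
    by rewrite mulr_ge0 // mulr_ile1.
  rewrite linearZZ normrZ; have /andP[t0 t1] := t01; rewrite (ger0_norm t0).
  apply: le_trans (ler_piMl _ t1) _ => //.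
  have [_ /(_ (h :: h :: s))] := H _ (scale_lt _ ut01).
  by rewrite !big_cons /= sk; apply.
have -> : M * (`|h| * (`|h| * \prod_(v <- s) `|v|)) = (M * `|h|) * (\prod_(v <- s) `|v| * `|h|) by ring.
have -> : e * \prod_(v <- s) `|v| * `|h| = e * (\prod_(v <- s) `|v| * `|h|) by rewrite mulrA.
apply: ler_wpM2r; first by rewrite mulr_ge0.
by apply: le_trans (ltW he); rewrite mulrC ler_wpM2l // lerDl.
Qed.

(* Convergence of geometrically dominated series is all the completeness that the
   inversion needs; unlike the complete structure it is available on products. *)
Definition geo_complete E := forall (u : nat -> E) (C q : R), 0 <= q < 1 ->
  (forall n, `|u n| <= C * q ^+ n) -> exists l, forall e : R, 0 < e ->
  exists m, forall n, (m <= n)%N -> `|\sum_(i < n) u i - l| <= e.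

Lemma complete_geo (E : completeNormedModType R) : geo_complete E.
Proof.
move=> u C q /andP[q0 q1] uC.
have : cvgn (series u).
  apply: normed_cvg; apply: (@series_le_cvg _ _ (geometric C q)) => /= [n|n|n|].
  - exact: normr_ge0.
  - exact: le_trans (uC n).
  - exact: uC.
  - by apply: is_cvg_geometric_series; rewrite ger0_norm.
move=> /cvg_ex[l /cvgrPdist_le H]; exists l => e /H[m _ mH].
by exists m => n /mH; rewrite distrC /series /= big_mkord.
Qed.

Lemma prod_geo E F : geo_complete E -> geo_complete F -> geo_complete (E * F)%type.
Proof.
move=> cE cF u C q q01 uC.
have [|l1 H1] := cE (fun n => (u n).1) C q q01.
  by move=> n; apply: le_trans (uC n); rewrite prod_normE le_max lexx.
have [|l2 H2] := cF (fun n => (u n).2) C q q01.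
  by move=> n; apply: le_trans (uC n); rewrite prod_normE le_max lexx orbT.
exists (l1, l2) => e e0; have [m1 {}H1] := H1 e e0; have [m2 {}H2] := H2 e e0.
exists (maxn m1 m2) => n; rewrite geq_max => /andP[/H1 n1 /H2 n2].
rewrite prod_normE ge_max /=.
have E1 : (\sum_(i < n) u i).1 = \sum_(i < n) (u i).1 by elim/big_ind2: _ => //= ? ? ? ? -> ->.
have E2 : (\sum_(i < n) u i).2 = \sum_(i < n) (u i).2 by elim/big_ind2: _ => //= ? ? ? ? -> ->.
by rewrite -E1 in n1; rewrite -E2 in n2; rewrite n1.
Qed.

(** The contraction principle, with the Lipschitz bound in the equivalent norm [p] but closedness
    and convergence in the given norm: the increments of the iteration decay geometrically in [p],
    hence also in the norm. *)
Lemma fixpoint E (p : E -> R) (S : set E) (Phi : E -> E) (c : R) (x0 : E) :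
  geo_complete E -> equiv_norm p -> 0 <= c < 1 ->
  (forall x, (forall e : R, 0 < e -> exists2 y, S y & `|x - y| <= e) -> S x) ->
  S x0 -> (forall x, S x -> S (Phi x)) ->
  (forall x y, S x -> S y -> p (Phi x - Phi y) <= c * p (x - y)) ->
  exists2 x, S x & Phi x = x.
Proof.
move=> cE [sp [C C0 pC]] /andP[c0 c1] Scl Sx0 SPhi lip; have [pD pZ [C' C'0 pC']] := sp.
pose x_ n := iter n Phi x0.
have Sx_ n : S (x_ n) by elim: n => //= n; exact: SPhi.
have pu n : p (x_ n.+1 - x_ n) <= p (x_ 1%N - x_ 0%N) * c ^+ n.
  elim: n => [|n IH]; first by rewrite expr0 mulr1.
  apply: le_trans (lip (x_ n.+1) (x_ n) (Sx_ _) (Sx_ _)) _.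
  by apply: le_trans (ler_wpM2l c0 IH) _; rewrite exprS mulrCA.
have [||l Hl] := cE (fun n => x_ n.+1 - x_ n) (C * p (x_ 1%N - x_ 0%N)) c.
- by rewrite c0.
- by move=> n; apply: le_trans (pC _) _; rewrite -mulrA ler_wpM2l // ltW.
have cvgx e : 0 < e -> exists m, forall n, (m <= n)%N -> `|x_ n - (x0 + l)| <= e.
  move=> /Hl[m H]; exists m => n /H; rewrite -(big_mkord xpredT (fun i => x_ i.+1 - x_ i)).
  by rewrite telescope_sumr // (_ : x_ n - x_ 0%N - l = x_ n - (x0 + l)) //; zmod.
have Sx : S (x0 + l).
  apply: Scl => e /cvgx[m H]; exists (x_ m) => //.
  by rewrite distrC; exact: H.
exists (x0 + l) => //; apply/eqP; rewrite -subr_eq0 -normr_le0.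
suff p0 : p (Phi (x0 + l) - (x0 + l)) <= 0.
  by apply: le_trans (pC _) _; rewrite pmulr_rle0.
apply/ler_addgt0Pr => e e0; rewrite add0r.
have e1 : 0 < e / (2 * C') by rewrite divr_gt0 // mulr_gt0.
have [m H] := cvgx _ e1.
have -> : Phi (x0 + l) - (x0 + l) = (Phi (x0 + l) - Phi (x_ m)) + (x_ m.+1 - (x0 + l)).
  by rewrite /x_ [iter m.+1 _ _]iterS; zmod.
have q n : (m <= n)%N -> p (x_ n - (x0 + l)) <= e / 2.
  move=> mn; apply: le_trans (pC' _) _.
  apply: le_trans (ler_wpM2l (ltW C'0) (H n mn)) _.
  by rewrite le_eqVlt; apply/orP; left; apply/eqP; field; rewrite gt_eqF.
apply: le_trans (pD _ _) _; have -> : e = e / 2 + e / 2 by field.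
apply: lerD; last exact: q.
apply: le_trans (lip _ _ Sx (Sx_ m)) _; rewrite (seminorm_distC sp).
apply: le_trans (q m (leqnn m)); apply: ler_piMl; [exact: (seminorm_ge0 sp)|exact: ltW].
Qed.

(** [K w] is the fixed point of v |-> w + L v, and it is bounded because (1 - c) p(K v) <= p v. *)
Lemma contraction_inverse E (p : E -> R) (L : E -> E) (c : R) :
  geo_complete E -> equiv_norm p -> 0 <= c < 1 -> blin L ->
  (forall v, p (L v) <= c * p v) ->
  exists K : E -> E, [/\ blin K, forall v, K v - L (K v) = v & forall v, K (v - L v) = v].
Proof.
move=> cE ep c01 [Llin LM] Lc; have [sp [C C0 pC]] := ep; have [pD pZ [C' C'0 pC']] := sp.
have /andP[c0 c1] := c01.
have LB u v : L (u - v) = L u - L v.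
  have -> : u - v = (-1) *: v + u by rewrite scaleN1r addrC.
  by rewrite Llin scaleN1r addrC.
have inj v : v - L v = 0 -> v = 0.
  move=> vE; apply/eqP; rewrite -normr_le0; apply: le_trans (pC v) _.
  rewrite pmulr_rle0 //; have := Lc v.
  have <- : v = L v by apply/eqP; rewrite -subr_eq0 vE.
  have c1' : 0 < 1 - c by rewrite subr_gt0.
  by rewrite -(pmulr_rle0 _ c1') mulrBl mul1r subr_le0.
have /choice[K HK] : forall w, exists v, v - L v = w.
  move=> w; have [||||v _ vE] := @fixpoint E p setT (fun v => w + L v) c 0 cE ep c01 => //.
    move=> x y _ _; rewrite (_ : w + L x - (w + L y) = L (x - y)) //.
    by rewrite LB; zmod.
  by exists v; apply/eqP; rewrite subr_eq vE.
have uniq u v : u - L u = v - L v -> u = v.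
  move=> uv; apply/eqP; rewrite -subr_eq0; apply/eqP; apply: inj; rewrite LB.
  have -> : u - v - (L u - L v) = (u - L u) - (v - L v) by zmod.
  by rewrite uv subrr.
exists K; split=> //; last by move=> v; apply: uniq; rewrite HK.
split=> [a u v|].
  apply: uniq; rewrite HK Llin opprD addrACA -scalerBr HK HK //.
exists (C * ((1 - c)^-1 * C')) => v.
have pK : (1 - c) * p (K v) <= p v.
  rewrite mulrBl mul1r lerBlDr; apply: le_trans (lerD (lexx _) (Lc (K v))).
  by rewrite -[in X in X <= _](subrK (L (K v)) (K v)) HK.
have c1' : 0 < 1 - c by rewrite subr_gt0.
apply: le_trans (pC _) _; rewrite -!mulrA; apply: ler_wpM2l; first exact: ltW.
rewrite ler_pdivlMl //; apply: le_trans pK _; exact: pC'.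
Qed.

End SmoothOn2.

(** * Local inversion of x - G x *)

Section Perturbation.
Context {R : realType}.
Implicit Types E F : normedModType R.

(* The contraction condition is imposed only after a renorming that may depend on
   the base point: the derivative of a Volterra operator need not be a contraction
   in the given norm. *)
Definition good_perturbation E (O : set E) (G : E -> E) :=
  [/\ open O, Smooth O G,
      forall x y, O x -> O y -> x - G x = y - G y -> x = y &
      forall x, O x -> exists p c, [/\ equiv_norm p, 0 <= c < 1 &
        forall v, p ('d G x v) <= c * p v] ].

Lemma diff_at0 E F (f : E * E -> F) (x : E) : differentiable f (x, 0) ->
  (forall h, f (x + h, 0) = 0) -> forall h, 'd f (x, 0) (h, 0) = 0.
Proof.
move=> df f0 h; have [M M0 HM] := diff_bounded df.
apply/eqP; rewrite -normr_le0; apply/ler_addgt0Pr => e e0; rewrite add0r.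
have h1 : 0 < `|h| + 1 by rewrite ltr_wpDl.
have [d d0 H] := differentiable_frechet df (divr_gt0 e0 h1).
pose t := d / (2 * (`|h| + 1)).
have t0 : 0 < t by rewrite divr_gt0 // mulr_gt0.
have nth : `|(t *: h, 0 : E)| = t * `|h|.
  by rewrite prod_normE /= normr0 normrZ gtr0_norm // max_l // mulr_ge0 // ltW.
have := H (t *: h, 0); rewrite -[(x, 0) + _]/(x + t *: h, 0 + 0) addr0 f0.
have -> : f (x, 0) = 0 by rewrite -(f0 0) addr0.
rewrite subr0 sub0r normrN nth.
have -> : (t *: h, 0 : E) = t *: (h, 0) by rewrite -[RHS]/(t *: h, t *: 0) scaler0.
rewrite linearZZ normrZ gtr0_norm // [_ * (t * _)]mulrCA ler_pM2l // => {}H.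
apply: le_trans (H _) _.
  have -> : d = t * (`|h| + 1) * 2 by rewrite /t; field; rewrite gt_eqF.
  have : 0 <= t * `|h| by rewrite mulr_ge0 // ltW.
  lra.
rewrite mulrAC ler_pdivrMr // ler_wpM2l ?ltW //.
by rewrite ltrDl.
Qed.

Lemma diff_tangentE E F (O : set E) (G : E -> F) x v w : open O -> Smooth O G -> O x ->
  'd (fun p : E * E => 'd G (p.1) p.2) (x, v) (0, w) = 'd G x w.
Proof.
move=> oO SG Ox; set Phi := fun p : E * E => _.
have dPhi : differentiable Phi (x, v) by apply: (Smooth_diff (Smooth_tangent SG)).
have bL : blin (fun w : E => (0 : E, w)) by apply: blin_pair; [exact: blin0|exact: blin_id].
have [dL LE] := blin_affine_diff (x, 0) v bL.
have E0 : (fun w => (0, w) + (x, 0)) = (fun w : E => (x, w)).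
  by apply/funext => y; rewrite -[LHS]/(0 + x, y + 0) addr0 add0r.
rewrite E0 in dL LE.
have := diff_comp dL dPhi => /(congr1 (@^~ w)); rewrite LE => H.
have [_ bE] := blin_diff v (diff_blin (Smooth_diff SG Ox)).
by apply: etrans (esym H) _; exact: (congr1 (@^~ w) bE).
Qed.

(* The partial derivative in the linear variable of (x, v) |-> 'd G x v is
   'd G x, and the one in x vanishes at v = 0; the differentiability of this map
   at (x, 0) thus makes 'd G continuous at x in operator norm. *)
Lemma diff_op_cts E F (O : set E) (G : E -> F) x (e : R) : open O -> Smooth O G -> O x -> 0 < e ->
  exists2 d : R, 0 < d & forall h, `|h| < d -> O (x + h) /\
    forall v, `|'d G (x + h) v - 'd G x v| <= e * `|v|.
Proof.
move=> oO SG Ox e0; set Phi := fun p : E * E => 'd G (p.1) p.2.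
have dPhi : differentiable Phi (x, 0) by apply: (Smooth_diff (Smooth_tangent SG)).
have [d d0 H] := differentiable_frechet dPhi e0.
have [d' d'0 oH] := open_normP oO Ox.
exists (Num.min (d / 2) d'); first by rewrite lt_min d'0 divr_gt0.
move=> h; rewrite lt_min => /andP[hd hd']; split=> [|v]; first exact: oH.
have [->|v0] := eqVneq v 0; first by rewrite !(linear0 ('d G _)) subrr !normr0 mulr0.
have nv : 0 < `|v| by rewrite normr_gt0.
(* Differentiability at (x, 0) speaks of small vectors only, so [v] is scaled to length [d / 2] and
   the factor [t] is cancelled at the end. *)
pose t := d / 2 / `|v|; have t0 : 0 < t by rewrite !divr_gt0.
have tv : `|t *: v| = d / 2 by rewrite normrZ gtr0_norm // divfK // gt_eqF.
have := H (h, t *: v).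
have -> : `|(h, t *: v)| = d / 2.
  by rewrite prod_normE /= tv max_r // ltW.
have -> : (x, 0) + (h, t *: v) = (x + h, t *: v) by rewrite -[LHS]/(x + h, 0 + t *: v) add0r.
have -> : (h, t *: v) = (h, 0) + (0, t *: v) by rewrite -[RHS]/(h + 0, 0 + t *: v) addr0 add0r.
(* ['d G y] is a linear map at every [y], even outside [O], so [Phi] vanishes wherever its second
   argument is 0. *)
rewrite (linearD ('d Phi _)) (diff_at0 dPhi); last by move=> h'; exact: linear0.
rewrite add0r (diff_tangentE _ _ oO SG Ox) /Phi /= (linear0 ('d G x)) subr0 !(linearZZ ('d G _)) -scalerBr.
rewrite normrZ gtr0_norm // => /(_ _) H'.
rewrite -(ler_pM2l t0); apply: le_trans (H' _) _; first by lra.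
have -> : d / 2 = t * `|v| by rewrite -tv normrZ gtr0_norm.
by rewrite mulrCA.
Qed.

Section Local.
Variables (E : normedModType R) (cE : geo_complete E) (O : set E) (G : E -> E).
Hypothesis gG : good_perturbation O G.

(** The contraction principle for x |-> y + G x on a small [p]-ball around [x0]. Existence of a
    solution yields openness, and its linear bound is the Lipschitz estimate from which the inverse
    is differentiated. *)
Lemma good_local x0 : O x0 -> exists2 d : R, 0 < d & exists2 K : R, 0 < K &
  forall y, `|y - (x0 - G x0)| < d ->
  exists x, [/\ O x, x - G x = y & `|x - x0| <= K * `|y - (x0 - G x0)| ].
Proof.
move=> Ox0; have [oO SG _ /(_ x0 Ox0)[p [c [ep /andP[c0 c1] pc]]]] := gG.
have [sp [C C0 pC]] := ep; have [pD pZ [C' C'0 pC']] := sp.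
pose c' := (1 + c) / 2.
have c'01 : 0 <= c' < 1 by rewrite /c'; lra.
have /andP[c'0 c'1] := c'01.
(* After conversion by [C] and [C'] this variation of the derivative costs (1 - c) / 2 in the norm
   [p], which is exactly the gap between [c] and [c']. *)
have e0 : 0 < (1 - c) / (2 * (C * C')) by rewrite divr_gt0 ?subr_gt0 // !mulr_gt0.
have [d d0 dG] := diff_op_cts oO SG Ox0 e0.
have k0 : 0 < 1 - c' by lra.
have dp h : `|h| < d -> forall v, p ('d G (x0 + h) v) <= c' * p v.
  move=> /dG[_ H] v; rewrite -[X in p X](subrK ('d G x0 v)).
  apply: le_trans (pD _ _) _; have -> : c' = (1 - c) / 2 + c by rewrite /c'; field.
  rewrite mulrDl; apply: lerD => //.
  apply: le_trans (pC' _) _; rewrite -ler_pdivlMl //.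
  apply: le_trans (H v) _.
  have -> : C'^-1 * ((1 - c) / 2 * p v) = (1 - c) / (2 * (C * C')) * (C * p v).
    by field; rewrite !gt_eqF.
  by apply: ler_wpM2l (pC v); exact: ltW.
exists (d * (1 - c') / (2 * (C * C'))); first by rewrite divr_gt0 ?mulr_gt0.
exists (C * ((1 - c')^-1 * C')); first by rewrite !mulr_gt0 // invr_gt0.
(* [rho] solves p(y - y0) + c' rho = rho, so the [p]-ball of this radius is invariant; the bound on
   [|y - y0|] keeps the ball where [dG] holds. *)
move=> y yd; pose y0 := x0 - G x0; pose rho := (1 - c')^-1 * p (y - y0).
have p0 : 0 <= p (y - y0) by exact: (seminorm_ge0 sp).
have rho0 : 0 <= rho by rewrite mulr_ge0 // invr_ge0 ltW.
pose S := [set x | p (x - x0) <= rho].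
have Crho : C * rho < d.
  rewrite /rho; apply: (@le_lt_trans _ _ (C * ((1 - c')^-1 * (C' * `|y - y0|)))).
    by apply: ler_wpM2l; [exact: ltW|apply: ler_wpM2l; [by rewrite invr_ge0 ltW|exact: pC']].
  have K0 : 0 < C * ((1 - c')^-1 * C') by rewrite !mulr_gt0 // invr_gt0.
  rewrite (_ : _ * _ = C * ((1 - c')^-1 * C') * `|y - y0|); last by rewrite -!mulrA.
  rewrite -ltr_pdivlMl //; apply: lt_le_trans yd _.
  have -> : (C * ((1 - c')^-1 * C'))^-1 * d = d * (1 - c') / (2 * (C * C')) * 2.
    by field; rewrite !gt_eqF.
  by rewrite ler_peMr ?ler1n // divr_ge0 ?mulr_ge0 ?ltW.
have Sd x : S x -> `|x - x0| < d.
  move=> Sx; apply: le_lt_trans (pC _) _; apply: le_lt_trans Crho.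
  by rewrite ler_wpM2l // ltW.
have lip x x' : S x -> S x' -> p (G x - G x') <= c' * p (x - x').
  move=> Sx Sx'; have Sseg t : 0 <= t <= 1 -> S (x' + t *: (x - x')).
    move=> /andP[t0 t1]; rewrite /S /=.
    have -> : x' + t *: (x - x') - x0 = (1 - t) *: (x' - x0) + t *: (x - x0).
      by rewrite scalerBl scale1r !scalerBr; zmod.
    apply: le_trans (pD _ _) _; rewrite !pZ !ger0_norm ?subr_ge0 //.
    have -> : rho = (1 - t) * rho + t * rho by ring.
    by apply: lerD; apply: ler_wpM2l; rewrite ?subr_ge0.
  have xE z : z = x0 + (z - x0) by rewrite subrKC.
  have := @mean_value_le _ E E G p x' (x - x') 0 (c' * p (x - x')) sp.
  rewrite subr0 subrKC; apply.
    by move=> t /Sseg/Sd/dG[]; rewrite -xE => Ot _; exact: Smooth_diff SG Ot.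
  by move=> t /Sseg/Sd/dp H; rewrite subr0 [X in 'd G X]xE.
have [||||x Sx xE] := @fixpoint _ E p S (fun x => y + G x) c' x0 cE ep c'01.
- move=> x xS; rewrite /S /=; apply/ler_addgt0Pr => e e1.
  have [z Sz xz] := xS _ (divr_gt0 e1 C'0).
  rewrite (_ : x - x0 = (z - x0) + (x - z)); last by zmod.
  apply: le_trans (pD _ _) _; apply: lerD => //.
  by apply: le_trans (pC' _) _; rewrite mulrC -ler_pdivlMr.
- by rewrite /S /= subrr seminorm0.
- move=> x Sx; rewrite /S /=.
  have -> : y + G x - x0 = (y - y0) + (G x - G x0) by rewrite /y0; zmod.
  apply: le_trans (pD _ _) _.
  have S0 : S x0 by rewrite /S /= subrr seminorm0.
  apply: le_trans (lerD (lexx _) (le_trans (lip _ _ Sx S0) (ler_wpM2l c'0 Sx))) _.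
  have {1}-> : p (y - y0) = (1 - c') * rho by rewrite /rho mulrA divff ?mul1r // gt_eqF.
  by rewrite -mulrDl subrK mul1r.
- move=> x x' Sx Sx'; rewrite (_ : _ - _ = G x - G x'); last by zmod.
  exact: lip.
exists x; split.
- by have [] := dG _ (Sd _ Sx); rewrite subrKC.
- by rewrite -[in X in X - _]xE addrK.
- apply: le_trans (pC _) _; rewrite -!mulrA; apply: ler_wpM2l; first exact: ltW.
  apply: le_trans Sx _; apply: ler_wpM2l (pC' _).
  by rewrite invr_ge0 ltW.
Qed.

Lemma good_open : open ((fun x => x - G x) @` O).
Proof.
rewrite openE => _ [x0 Ox0 <-]; have [d d0 [K _ H]] := good_local Ox0.
apply/near_normP; exists d => // h hd.
have [|x [Ox xE _]] := H (x0 - G x0 + h); first by rewrite addrC addKr.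
by exists x.
Qed.

Lemma good_inverse_diff (g : E -> E) x0 : (forall x, O x -> g (x - G x) = x) -> O x0 ->
  differentiable g (x0 - G x0) /\ forall v, 'd g (x0 - G x0) (v - 'd G x0 v) = v.
Proof.
move=> gK Ox0; have [oO SG _ /(_ x0 Ox0)[p [c [ep c01 pc]]]] := gG.
have dG := Smooth_diff SG Ox0.
have [K [bK KK1 KK2]] := contraction_inverse cE ep c01 (diff_blin dG) pc.
have [d d0 [C C0 H]] := good_local Ox0.
have [Klin [M0 HM0]] := bK; pose M := `|M0| + 1.
have M_gt0 : 0 < M by rewrite ltr_wpDl.
have HM v : `|K v| <= M * `|v|.
  by apply: le_trans (HM0 v) _; rewrite ler_wpM2r // ler_wpDr // ler_norm.
suff fr : is_frechet g (x0 - G x0) K.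
  have [|dg ->] := frechet_diff Klin _ fr; [by exists M0|split=> // v; exact: KK2].
have KD u v : K (u - v) = K u - K v.
  have -> : u - v = (-1) *: v + u by rewrite scaleN1r addrC.
  by rewrite Klin scaleN1r addrC.
move=> e e0; have e1 : 0 < e / (M * C) by rewrite divr_gt0 // mulr_gt0.
have [d1 d10 H1] := differentiable_frechet dG e1.
exists (Num.min d (d1 / C)); first by rewrite lt_min d0 divr_gt0.
move=> h; rewrite lt_min ltr_pdivlMr // => /andP[hd hd1].
have [|x [Ox xE xx0]] := H (x0 - G x0 + h); first by rewrite addrC addKr.
rewrite -xE !gK //; rewrite [_ + h]addrC addrK in xx0; rewrite mulrC in hd1.
(* [K] maps the first two terms to [x - x0], so the error of the candidate derivative is [K] of the
   remainder of [G], which is small against [|x - x0| <= C * |h|]. *)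
have hE : h = (x - x0) - 'd G x0 (x - x0) - (G (x0 + (x - x0)) - G x0 - 'd G x0 (x - x0)).
  by rewrite subrKC -[LHS](addKr (x0 - G x0)) -xE; zmod.
rewrite {1}hE KD KK2 opprB addrC subrK.
apply: le_trans (HM _) _.
apply: le_trans (ler_wpM2l (ltW M_gt0) (H1 _ (le_lt_trans xx0 hd1))) _.
have -> : e * `|h| = M * (e / (M * C) * (C * `|h|)) by field; rewrite !gt_eqF.
by apply: ler_wpM2l; [exact: ltW|apply: ler_wpM2l xx0; exact: ltW].
Qed.

End Local.
End Perturbation.

(** * Smoothness of the inverse *)

Section InverseSmooth.
Context {R : realType}.
Implicit Types E F : normedModType R.

Lemma Smooth_pair E F1 F2 (O : set E) (f : E -> F1) (g : E -> F2) : open O ->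
  Smooth O f -> Smooth O g -> Smooth O (fun x => (f x, g x)).
Proof.
move=> oO Sf Sg k.
have b1 : blin (fun x : F1 => (x, 0 : F2)) by apply: blin_pair; [exact: blin_id|exact: blin0].
have b2 : blin (fun x : F2 => (0 : F1, x)) by apply: blin_pair; [exact: blin0|exact: blin_id].
apply: Sm_congr (SmD oO (Sm_post oO b1 (Sf k)) (Sm_post oO b2 (Sg k))) => // x _ /=.
by rewrite -[LHS]/(f x + 0, 0 + g x) addr0 add0r.
Qed.

(* The derivative of the tangent map is block triangular with diagonal 'd G x, hence
   a contraction once the first factor gets a large weight [mu]. *)
Lemma good_tangent E (O : set E) (G : E -> E) : good_perturbation O G ->
  good_perturbation (O `*` [set: E]) (fun q => (G q.1, 'd G (q.1) q.2)).
Proof.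
move=> [oO SG inj con]; set Phi := fun q : E * E => 'd G (q.1) q.2.
have oT := openTangent oO.
have SPhi : Smooth (O `*` [set: E]) Phi := Smooth_tangent SG.
split=> //.
- apply: Smooth_pair => // k; exact: Sm_tangent_pre (SG k).
- move=> [x v] [y w] [/= Ox _] [/= Oy _] [xy vw].
  have {}xy : x = y by exact: inj.
  rewrite -{}xy {Oy y} in vw *; congr (_, _).
  have [p [c [[sp [C C0 pC]] /andP[c0 c1] pc]]] := con x Ox.
  have E0 : v - w = 'd G x (v - w).
    rewrite linearB; apply/eqP; rewrite -subr_eq0; apply/eqP.
    transitivity ((v - 'd G x v) - (w - 'd G x w)); first by zmod.
    by rewrite [X in X - _]vw subrr.
  apply/eqP; rewrite -subr_eq0 -normr_le0; apply: le_trans (pC _) _.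
  rewrite pmulr_rle0 //; have := pc (v - w); rewrite -E0.
  have c1' : 0 < 1 - c by rewrite subr_gt0.
  by rewrite -(pmulr_rle0 _ c1') mulrBl mul1r subr_le0.
move=> [x v] [/= Ox _].
have [p [c [[sp [C C0 pC]] /andP[c0 c1] pc]]] := con x Ox.
have [pD pZ [C' C'0 pC']] := sp.
have p0 := seminorm_ge0 sp.
have dPhi : differentiable Phi (x, v) by apply: (Smooth_diff SPhi).
have [M M0 HM] := diff_bounded dPhi.
have k0 : 0 < 1 - c by rewrite subr_gt0.
pose K := C' * (M * C); have K0 : 0 < K by rewrite !mulr_gt0.
(* [K] bounds the off-diagonal block in the norm [p]. With this weight, raising the contraction
   factor from [c] to (1 + c) / 2 on the first component gains [mu * (1 - c) / 2 = K], which absorbs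
   the block. *)
pose mu := 2 * K / (1 - c); have mu0 : 0 < mu by rewrite divr_gt0 // mulr_gt0.
have dE h w : 'd (fun q : E * E => (G q.1, Phi q)) (x, v) (h, w) =
    ('d G x h, 'd Phi (x, v) (h, 0) + 'd G x w).
  have dfst : differentiable (fun q : E * E => G q.1) (x, v) /\
      'd (fun q : E * E => G q.1) (x, v) = 'd G x \o fst :> (E * E -> E).
    have [df dfE] := blin_diff (x, v) (blin_fst E E).
    have dG := Smooth_diff SG Ox.
    split; first exact: (differentiable_comp df dG).
    by apply: etrans (diff_comp df dG) _; rewrite dfE.
  have [df dfE] := dfst.
  apply: etrans (congr1 (@^~ (h, w)) (diff_pair df dPhi)) _.
  have -> : (h, w) = (h, 0) + (0, w) by rewrite -[RHS]/(h + 0, 0 + w) addr0 add0r.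
  rewrite (linearD ('d Phi _)) (diff_tangentE _ _ oO SG Ox).
  apply: (congr1 (fun y => (y, 'd Phi (x, v) (h, 0) + 'd G x w))).
  by apply: etrans (congr1 (@^~ _) dfE) _; rewrite /= addr0.
exists (fun q : E * E => mu * p q.1 + p q.2), ((1 + c) / 2); split.
- split; first split.
  + move=> q q' /=; have -> : mu * p q.1 + p q.2 + (mu * p q'.1 + p q'.2) =
      mu * (p q.1 + p q'.1) + (p q.2 + p q'.2) by ring.
    by apply: lerD => //; apply: ler_wpM2l; [exact: ltW|].
  + by move=> a q /=; rewrite !pZ; ring.
  + exists ((mu + 1) * C'); first by rewrite mulr_gt0 // addr_gt0.
    move=> q; have -> : (mu + 1) * C' * `|q| = mu * (C' * `|q|) + C' * `|q| by ring.
    have C'0' := ltW C'0.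
    apply: lerD; [apply: ler_wpM2l; [exact: ltW|]|];
      apply: le_trans (pC' _) _; apply: ler_wpM2l => //;
      by rewrite prod_normE le_max lexx ?orbT.
  exists (C * (mu^-1 + 1)); first by rewrite mulr_gt0 // addr_gt0 // invr_gt0.
  move=> q; have imu : 0 < mu^-1 by rewrite invr_gt0.
  have -> : C * (mu^-1 + 1) * (mu * p q.1 + p q.2) =
    C * (p q.1) + C * (p q.2) + C * (mu^-1 * p q.2 + mu * p q.1).
    by field; rewrite gt_eqF.
  have c1' : 0 <= C * p q.1 by rewrite mulr_ge0 // ltW.
  have c2' : 0 <= C * p q.2 by rewrite mulr_ge0 // ltW.
  have c3' : 0 <= C * (mu^-1 * p q.2 + mu * p q.1).
    by rewrite mulr_ge0 ?(ltW C0) // addr_ge0 // mulr_ge0 ?(ltW mu0) ?(ltW imu).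
  rewrite prod_normE ge_max; apply/andP; split.
    by apply: le_trans (pC _) _; rewrite -addrA lerDl addr_ge0.
  by apply: le_trans (pC _) _; rewrite [C * _ + C * _]addrC -addrA lerDl addr_ge0.
- lra.
move=> [h w] /=; rewrite dE /=.
have H1 : p ('d Phi (x, v) (h, 0)) <= K * p h.
  apply: le_trans (pC' _) _; rewrite /K -!mulrA; apply: ler_wpM2l; first exact: ltW.
  apply: le_trans (HM _) _; apply: ler_wpM2l; first exact: ltW.
  by rewrite prod_normE /= normr0 max_l.
have H2 : mu * p ('d G x h) <= mu * (c * p h) by apply: ler_wpM2l; [exact: ltW|].
have H3 := pD ('d Phi (x, v) (h, 0)) ('d G x w).
have H4 := pc w.
have H5 : (1 + c) / 2 * (mu * p h) = mu * (c * p h) + K * p h.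
  by rewrite /mu; field; rewrite gt_eqF.
have H6 : c * p w <= (1 + c) / 2 * p w by apply: ler_wpM2r => //; lra.
by rewrite mulrDr H5; lra.
Qed.

(** The induction applies to the tangent map on [E * E]: the second component of its inverse is the
    tangent map of [g]. *)
Lemma good_inverse_Sm k E (O : set E) (G g : E -> E) : geo_complete E ->
  good_perturbation O G -> (forall x, O x -> g (x - G x) = x) ->
  Sm k ((fun x => x - G x) @` O) g.
Proof.
elim: k E O G g => [//|k IH] E O G g cE gG gK.
have oI := good_open cE gG; have gT := good_tangent gG.
split; first by move=> _ [x Ox <-]; have [] := good_inverse_diff cE gG gK Ox.
pose h (q : E * E) := (g q.1, 'd g (q.1) q.2).
have /(IH _ _ _ h (prod_geo cE cE) gT) : forall q, (O `*` [set: E]) q ->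
    h (q - (G q.1, 'd G (q.1) q.2)) = q.
  move=> [x v] [/= Ox _]; rewrite /h /= gK //.
  by have [_ ->] := good_inverse_diff cE gG gK Ox.
move=> /(Sm_post (good_open (prod_geo cE cE) gT) (blin_snd E E)).
(* The induction hypothesis lives on the image of the tangent map. Over each point of the image of
   [O] this contains every [w], reached from [K w] because the linear part is onto. *)
apply: Sm_sub => -[y w] [/= [x Ox <-] _].
have [oO SG _ /(_ x Ox)[p [c [ep c01 pc]]]] := gG.
have [K [_ KK _]] := contraction_inverse cE ep c01 (diff_blin (Smooth_diff SG Ox)) pc.
by exists (x, K w) => //; rewrite -[LHS]/(x - G x, K w - 'd G x (K w)) KK.
Qed.

(* The inverse of the tangent map of [f] is the tangent map of the inverse of
   [f], so the inverse is as smooth as [f] once it is differentiable. *)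
Theorem good_smooth_open_embedding (E : completeNormedModType R) (O : set E) (G : E -> E) :
  good_perturbation O G -> smooth_open_embedding O (fun x => x - G x).
Proof.
move=> gG; have [oO SG inj _] := gG; have cE := complete_geo (E := E).
have oI := good_open cE gG.
split=> //.
  apply: Smooth_smooth_on => // k.
  have bN : blin (-%R : E -> E).
    split=> [a u v|]; first by rewrite opprD scalerN.
    by exists 1 => v; rewrite normrN mul1r.
  have SI := Sm_sub (@subsetT _ O) (Sm_blin k (blin_id E)).
  exact: (SmD oO SI (Sm_post oO bN (SG k))).
have /choice[g gP] : forall y, exists x, (exists2 x', O x' & x' - G x' = y) -> O x /\ x - G x = y.
  move=> y; have [[x Ox xE]|n] := pselect (exists2 x', O x' & x' - G x' = y).
    by exists x.
  by exists 0.
have gK x : O x -> g (x - G x) = x.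
  by move=> Ox; have [|Og gE] := gP (x - G x); [exists x|apply: inj].
by exists g; split=> //; apply: Smooth_smooth_on => // k; exact: good_inverse_Sm.
Qed.

End InverseSmooth.

(** * Weighted estimates for C^r functions *)

Section CrBound.
Context {R : realType} {n : nat} (N : set 'rV[R]_n).
Implicit Types (f g w : 'rV[R]_n -> R) (e M : R).

(* [crb w e m f M] says that [f] is C^m on [N] with e^|s| |d^s f| <= M w for all
   |s| <= m; like the members of [Cr], [f] and its derivatives, continued to the
   boundary, vanish outside [N]. *)
Fixpoint crb w e (m : nat) f M : Prop :=
  [/\ forall x, ~ N x -> f x = 0,
      {within N, continuous f},
      forall x, N x -> `|f x| <= M * w x &
      if m is m'.+1 then forall i : 'I_n, exists2 g,
        (forall x, N° x -> is_derive x 'e_i f (g x)) & crb w e m' g (M / e)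
      else True].

Lemma crb_base w e m f M : crb w e m f M ->
  [/\ forall x, ~ N x -> f x = 0, {within N, continuous f} &
      forall x, N x -> `|f x| <= M * w x].
Proof. by case: m => [|m] [H1 H2 H3 _]. Qed.

Lemma pderiv_rcons s i f : pderiv (rcons s i) f = pderiv s ('D_('e_i) f).
Proof. by elim: s => //= j s ->. Qed.

Hypothesis NI : N `<=` closure N°.

Lemma within_int_proper p : N p -> ProperFilter (within N° (nbhs p)).
Proof.
move=> /NI clp; apply: Build_ProperFilter_ex => A; rewrite nbhsE /=.
move=> -[B oB sB]; have [|y [Ny By]] := clp B; first exact: open_nbhs_nbhs.
by exists y; exact: sB.
Qed.

Lemma lim_int g p : N° p -> cvg (g x @[x --> within N° (nbhs p)]) ->
  lim (g x @[x --> within N° (nbhs p)]) = g p.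
Proof.
move=> Np; have PF := within_int_proper (interior_subset Np).
move=> /cvg_ex[l gl]; rewrite (cvg_lim _ gl) //.
apply/eqP; rewrite -subr_eq0 -normr_le0; apply/ler_addgt0Pr => e e0; rewrite add0r.
move/cvgrPdist_le: gl => /(_ _ e0).
rewrite near_withinE => /near_normP[d d0 H].
by have := H 0; rewrite normr0 addr0; exact.
Qed.

(** The continuous extension of a function from the interior to [N]. Partial derivatives are
    meaningful in the interior only, whereas the recursion of [crb] asks for functions continuous on
    [N] and zero outside it. *)
Definition int_ext g p : R :=
  if `[< N p >] then lim (g x @[x --> within N° (nbhs p)]) else 0.

Section Ext.
Variable g : 'rV[R]_n -> R.
Hypothesis gc : forall p, N p -> cvg (g x @[x --> within N° (nbhs p)]).

Lemma int_extE p : N° p -> int_ext g p = g p.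
Proof.
move=> Np; have Np' := interior_subset Np.
by rewrite /int_ext asboolT // lim_int //; exact: gc.
Qed.

Lemma int_ext_near p e : N p -> 0 < e -> exists2 d : R, 0 < d &
  forall y, N° y -> `|y - p| < d -> `|int_ext g p - g y| <= e.
Proof.
move=> Np e0; have PF := within_int_proper Np.
have [l gl] := (cvg_ex _).1 (gc Np); rewrite /int_ext asboolT // (cvg_lim _ gl) //.
move/cvgrPdist_le: gl => /(_ _ e0); rewrite near_withinE => /near_normP[d d0 H].
exists d => // y Ny yd; have := H (y - p) yd; rewrite subrKC => H2; exact: H2.
Qed.

Lemma int_dense p d : N p -> 0 < d -> exists2 y, N° y & `|y - p| < d.
Proof.
move=> /NI clp d0; have [|y [Ny By]] := clp (ball p d); first exact: nbhsx_ballx.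
by exists y => //; rewrite distrC; move: By; rewrite -ball_normE.
Qed.

Lemma int_ext_cts : {within N, continuous (int_ext g)}.
Proof.
apply/subspace_continuousP => p Np; apply/cvgrPdist_le => e e0.
have e2 : 0 < e / 2 by rewrite divr_gt0.
have [d d0 H] := int_ext_near Np e2.
rewrite near_withinE; apply: (proj2 (@near_normP R _ p _)); exists d => // h hd Nq.
have [d' d'0 H'] := int_ext_near Nq e2.
have k0 : 0 < Num.min d' (d - `|h|) by rewrite lt_min d'0 subr_gt0.
have [y Ny] := int_dense Nq k0; rewrite lt_min => /andP[y1 y2].
have yp : `|y - p| < d.
  rewrite (_ : y - p = (y - (p + h)) + h); last by zmod.
  by apply: le_lt_trans (ler_normD _ _) _; rewrite -ltrBrDr.
rewrite -[X in `|X|]/(int_ext g p - int_ext g (p + h)).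
have -> : int_ext g p - int_ext g (p + h) = (int_ext g p - g y) - (int_ext g (p + h) - g y) by ring.
by have := ler_normB (int_ext g p - g y) (int_ext g (p + h) - g y);
  have := H y Ny yp; have := H' y Ny y1; lra.
Qed.

Lemma int_ext_le w M : {within N, continuous w} ->
  (forall x, N° x -> `|g x| <= M * w x) -> forall x, N x -> `|int_ext g x| <= M * w x.
Proof.
move=> /subspace_continuousP wc gM p Np; apply/ler_addgt0Pr => e e0.
have e2 : 0 < e / 2 by rewrite divr_gt0.
have [d d0 H] := int_ext_near Np e2.
have k0 : 0 < e / (2 * (`|M| + 1)) by rewrite divr_gt0 // mulr_gt0 // ltr_wpDl.
have /cvgrPdist_le/(_ _ k0) := wc p Np.
rewrite near_withinE => /near_normP[d' d'0 H'].
have k1 : 0 < Num.min d d' by rewrite lt_min d0.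
have [y Ny] := int_dense Np k1; rewrite lt_min => /andP[y1 y2].
have h1 := H y Ny y1; have h2 := gM y Ny.
have := H' (y - p) y2; rewrite subrKC => /(_ (interior_subset Ny)) h3.
have h4 : `|M * (w p - w y)| <= e / 2.
  rewrite normrM; apply: le_trans (ler_wpM2l (normr_ge0 _) h3) _.
  apply: (@le_trans _ _ ((`|M| + 1) * (e / (2 * (`|M| + 1))))).
    by apply: ler_wpM2r; [exact: ltW|rewrite lerDl].
  by rewrite le_eqVlt; apply/orP; left; apply/eqP; field; rewrite gt_eqF // ltr_wpDl.
have h5 := ler_norm (- (M * (w p - w y))); rewrite normrN in h5.
have h6 := ler_normD (int_ext g p - g y) (g y); rewrite subrK in h6.
by lra.
Qed.
End Ext.

Lemma is_Cr_diff m f i : is_Cr m.+1 N (fun _ : unit => f) ->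
  is_Cr m N (fun _ : unit => int_ext ('D_('e_i) f)).
Proof.
move=> /(_ tt)[f0 fc fd fl fb] [].
have gc p : N p -> cvg ('D_('e_i) f x @[x --> within N° (nbhs p)]).
  exact: (fl [:: i] p).
have gE s x : N° x -> pderiv s (int_ext ('D_('e_i) f)) x = pderiv (rcons s i) f x.
  by move=> Nx; rewrite pderiv_rcons; apply: (pderiv_near _ Nx) => y; exact: int_extE.
split.
- by move=> x Nx; rewrite /int_ext asboolF.
- exact: int_ext_cts.
- move=> s k x sm Nx.
  apply: (@near_eq_derivable _ _ _ (pderiv (rcons s i) f)).
    by have := nbhs_interior Nx; apply: filterS => y Ny; rewrite gE.
  by apply: fd => //; rewrite size_rcons.
- move=> s p sm Np; have := fl (rcons s i) p; rewrite size_rcons => /(_ sm Np).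
  move=> /cvg_ex[l gl]; apply/cvg_ex; exists l.
  apply: cvg_trans gl; apply: near_eq_cvg.
  by rewrite near_withinE; apply: filterE => x Nx; rewrite gE.
- move=> s sm; have [|M HM] := fb (rcons s i); first by rewrite size_rcons.
  (* For the empty list [pdom] is all of [N], and the bound reaches the boundary by continuity; for
     other lists it is the interior. *)
  case: s sm HM => [|k s] sm HM.
    have wc : {within N, continuous (fun _ : 'rV[R]_n => 1 : R)}.
      by move=> y; exact: cst_continuous.
    have gM y : N° y -> `|'D_('e_i) f y| <= M * 1 by rewrite mulr1; exact: HM.
    by exists M => x Nx; have := int_ext_le gc wc gM Nx; rewrite mulr1.
  by exists M => x Nx; rewrite gE //; exact: HM.
Qed.

(** Together with [crb_pderiv] and [crb_is_Cr] this translates between the norm over all lists of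
    directions and the recursive predicate. Peeling off the last entry of a list removes the
    derivative taken first. *)
Lemma is_Cr_crb w e m f M : 0 < e -> {within N, continuous w} ->
  is_Cr m N (fun _ : unit => f) ->
  (forall s x, (size s <= m)%N -> pdom N s x -> e ^+ size s * `|pderiv s f x| <= M * w x) ->
  crb w e m f M.
Proof.
move=> e0 wc; elim: m f M => [|m IH] f M fC fM.
  have [f0 fc _ _ _] := fC tt; split=> // x Nx.
  by have := fM [::] x isT Nx; rewrite mul1r.
have [f0 fc fd fl fb] := fC tt; split=> //.
  by move=> x Nx; have := fM [::] x isT Nx; rewrite mul1r.
have gc i p : N p -> cvg ('D_('e_i) f x @[x --> within N° (nbhs p)]).
  exact: (fl [:: i] p).
move=> i; exists (int_ext ('D_('e_i) f)).
  by move=> x Nx; rewrite int_extE //; [apply/derivableP; exact: (fd [::])|exact: gc].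
apply: IH; first exact: is_Cr_diff.
have bd s x : (size s <= m)%N -> N° x ->
    e ^+ size s * `|pderiv (rcons s i) f x| <= M / e * w x.
  move=> sm Nx; have := fM (rcons s i) x; rewrite size_rcons => /(_ sm).
  have pd : pdom N (rcons s i) x by case: (s).
  move=> /(_ pd) H; rewrite mulrAC ler_pdivlMr //; apply: le_trans H.
  by rewrite exprS mulrC mulrA.
have gE s x : N° x -> pderiv s (int_ext ('D_('e_i) f)) x = pderiv (rcons s i) f x.
  by move=> Nx; rewrite pderiv_rcons; apply: (pderiv_near _ Nx) => y; apply: int_extE; exact: gc.
move=> [|k s] x sm Nx; last by rewrite gE //; exact: bd.
rewrite /= mul1r; apply: int_ext_le => //; first exact: gc.
by move=> y Ny; have := bd [::] y isT Ny; rewrite mul1r.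
Qed.

Lemma crb_pderiv w e m f M : 0 < e -> (forall x, N x -> 0 <= w x) ->
  crb w e m f M -> forall s x, (size s <= m)%N -> pdom N s x ->
  e ^+ size s * `|pderiv s f x| <= M * w x.
Proof.
move=> e0 w0; elim: m f M => [|m IH] f M [f0 fc fM fd] s x.
  by case: s => [|//] _ Nx; rewrite mul1r; exact: fM.
case/lastP: s => [|s i] sm Nx; first by rewrite mul1r; exact: fM.
have Nx' : N° x by move: Nx; case: (s).
have [g gd gC] := fd i; rewrite size_rcons in sm *.
have -> : pderiv (rcons s i) f x = pderiv s g x.
  rewrite pderiv_rcons; apply: (pderiv_near _ Nx') => y /gd Dy.
  exact: derive_val.
have pd : pdom N s x by case: (s) => //; exact: interior_subset.
have := IH g _ gC s x sm pd; rewrite -(ler_pM2l e0) mulrA -exprS => /le_trans; apply.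
by rewrite mulrA [e * _]mulrC divfK // gt_eqF.
Qed.

Lemma crb_is_Cr w e m f M : 0 < e -> (exists B, forall x, N x -> 0 <= w x <= B) ->
  crb w e m f M -> is_Cr m N (fun _ : unit => f).
Proof.
move=> e0 [B wB] fC [].
have w0 x : N x -> 0 <= w x by move=> /wB/andP[].
have fb := crb_pderiv e0 w0 fC.
have [f0 fc _] := crb_base fC.
split=> //.
- move=> s i; elim: m f M fC s {fb f0 fc} => [//|m IH] f M [_ _ _ fd] s x sm Nx.
  case/lastP: s sm => [_|s k]; first by have [g /(_ x Nx)[]] := fd i.
  rewrite size_rcons ltnS => sm; have [g gd gC] := fd k.
  apply: (@near_eq_derivable _ _ _ (pderiv s g)); last exact: IH gC s x sm Nx.
  have := nbhs_interior Nx; apply: filterS => y Ny; rewrite pderiv_rcons.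
  by apply: (pderiv_near _ Ny) => z /gd Dz; rewrite derive_val.
- move=> s p; elim: m f M fC s {fb f0 fc} => [|m IH] f M [_ fc _ fd] s.
    case: s => [_ Np|//]; apply/cvg_ex; exists (f p).
    move/subspace_continuousP: fc => /(_ p Np); apply: cvg_trans.
    apply: cvg_app; apply: within_subset; exact: interior_subset.
  case/lastP: s => [_ Np|s k].
    apply/cvg_ex; exists (f p).
    move/subspace_continuousP: fc => /(_ p Np); apply: cvg_trans.
    apply: cvg_app; apply: within_subset; exact: interior_subset.
  rewrite size_rcons ltnS => sm Np; have [g gd gC] := fd k.
  have /cvg_ex[l gl] := IH g _ gC s sm Np; apply/cvg_ex; exists l.
  apply: cvg_trans gl; apply: near_eq_cvg.
  rewrite near_withinE; apply: filterE => x Nx; rewrite pderiv_rcons.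
  by apply: (pderiv_near _ Nx) => z /gd Dz; rewrite derive_val.
- move=> s sm; exists (`|M| * B / e ^+ size s) => x Nx.
  rewrite ler_pdivlMr ?exprn_gt0 // mulrC; apply: le_trans (fb s x sm Nx) _.
  have Nx' : N x by move: Nx; case: (s) => // ? ? /interior_subset.
  have /andP[w1 w2] := wB x Nx'.
  apply: le_trans (ler_wpM2r w1 (ler_norm M)) _; exact: ler_wpM2l.
Qed.

End CrBound.

(** * Sums and products under weighted bounds *)

Section CrBoundAlgebra.
Context {R : realType} {n : nat} (N : set 'rV[R]_n).
Implicit Types (f g w : 'rV[R]_n -> R) (e M : R).
Local Notation crb := (crb N).

Section Weight.
Variables (w : 'rV[R]_n -> R) (e : R).
Hypotheses (w0 : forall x, N x -> 0 <= w x) (e0 : 0 < e).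

Lemma crb_le m f M M' : M <= M' -> crb w e m f M -> crb w e m f M'.
Proof.
elim: m f M M' => [|m IH] f M M' MM' [f0 fc fM fd].
  by split=> // x Nx; apply: le_trans (fM x Nx) _; apply: ler_wpM2r MM'; exact: w0.
split=> // [x Nx|i].
  by apply: le_trans (fM x Nx) _; apply: ler_wpM2r MM'; exact: w0.
have [g gd gC] := fd i; exists g => //; apply: IH gC.
by apply: ler_wpM2r MM'; rewrite invr_ge0 ltW.
Qed.

Lemma crb_order m f M : e <= 1 -> 0 <= M -> crb w e m.+1 f M -> crb w e m f M.
Proof.
move=> e1; elim: m f M => [|m IH] f M M0 [f0 fc fM fd]; split=> // i.
have [g gd gC] := fd i; exists g => //; apply: IH gC.
by rewrite divr_ge0 // ltW.
Qed.

Lemma crb0 m M : 0 <= M -> crb w e m (fun _ => 0) M.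
Proof.
elim: m M => [|m IH] M M0; split=> //.
- by move=> x; exact: cst_continuous.
- by move=> x Nx; rewrite normr0 mulr_ge0 ?w0.
- by move=> x; exact: cst_continuous.
- by move=> x Nx; rewrite normr0 mulr_ge0 ?w0.
move=> i; exists (fun _ => 0) => [x _|]; first exact: is_derive_cst.
by apply: IH; rewrite divr_ge0 // ltW.
Qed.

Lemma within_ctsD f g : {within N, continuous f} -> {within N, continuous g} ->
  {within N, continuous (fun x => f x + g x)}.
Proof.
move=> /subspace_continuousP fc /subspace_continuousP gc.
by apply/subspace_continuousP => x Nx; exact: (cvgD (fc x Nx) (gc x Nx)).
Qed.

Lemma within_ctsM f g : {within N, continuous f} -> {within N, continuous g} ->
  {within N, continuous (fun x => f x * g x)}.
Proof.
move=> /subspace_continuousP fc /subspace_continuousP gc.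
by apply/subspace_continuousP => x Nx; exact: (cvgM (fc x Nx) (gc x Nx)).
Qed.

Lemma within_ctsB f g : {within N, continuous f} -> {within N, continuous g} ->
  {within N, continuous (fun x => f x - g x)}.
Proof.
move=> /subspace_continuousP fc /subspace_continuousP gc.
by apply/subspace_continuousP => x Nx; exact: (cvgB (fc x Nx) (gc x Nx)).
Qed.

Lemma within_cts_sum (I : Type) (s : seq I) (f : I -> 'rV[R]_n -> R) :
  (forall i, {within N, continuous (f i)}) ->
  {within N, continuous (fun x => \sum_(i <- s) f i x)}.
Proof.
move=> fc; elim: s => [|i s IH].
  rewrite (_ : (fun _ => _) = fun _ => 0); last by apply/funext => x; rewrite big_nil.
  by move=> x; exact: cst_continuous.
rewrite (_ : (fun _ => _) = fun x => f i x + \sum_(i <- s) f i x).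
  by apply: within_ctsD.
by apply/funext => x; rewrite big_cons.
Qed.

Lemma is_derive_fsum (I : Type) (s : seq I) (f : I -> 'rV[R]_n -> R) (df : I -> R) x v :
  (forall i, is_derive x v (f i) (df i)) ->
  is_derive x v (fun y => \sum_(i <- s) f i y) (\sum_(i <- s) df i).
Proof.
move=> fd; elim: s => [|i s IH].
  rewrite big_nil (_ : (fun _ => _) = cst 0); first exact: is_derive_cst.
  by apply/funext => y; rewrite big_nil.
rewrite big_cons (_ : (fun _ => _) = f i + (fun x => \sum_(i <- s) f i x)).
  exact: is_deriveD.
by apply/funext => y; rewrite big_cons.
Qed.

Lemma crbD m f g M M' : crb w e m f M -> crb w e m g M' ->
  crb w e m (fun x => f x + g x) (M + M').
Proof.
elim: m f g M M' => [|m IH] f g M M' [f0 fc fM fd] [g0 gc gM gd]; split=> //.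
- by move=> x Nx; rewrite f0 // g0 // addr0.
- exact: within_ctsD.
- by move=> x Nx; rewrite mulrDl (le_trans (ler_normD _ _)) // lerD ?fM ?gM.
- by move=> x Nx; rewrite f0 // g0 // addr0.
- exact: within_ctsD.
- by move=> x Nx; rewrite mulrDl (le_trans (ler_normD _ _)) // lerD ?fM ?gM.
move=> i; have [f' fd' fC] := fd i; have [g' gd' gC] := gd i.
exists (fun x => f' x + g' x) => [x Nx|].
  by have := fd' x Nx; have := gd' x Nx => ? ?; exact: is_deriveD.
by rewrite mulrDl; exact: IH.
Qed.

Lemma crbZ m (a : R) f M : crb w e m f M -> crb w e m (fun x => a * f x) (`|a| * M).
Proof.
elim: m f M => [|m IH] f M [f0 fc fM fd]; split=> //.
- by move=> x Nx; rewrite f0 // mulr0.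
- by apply: within_ctsM => // x; exact: cst_continuous.
- by move=> x Nx; rewrite normrM -mulrA ler_wpM2l // fM.
- by move=> x Nx; rewrite f0 // mulr0.
- by apply: within_ctsM => // x; exact: cst_continuous.
- by move=> x Nx; rewrite normrM -mulrA ler_wpM2l // fM.
move=> i; have [g gd gC] := fd i; exists (fun x => a * g x).
  by move=> x Nx; have := gd x Nx => D; exact: is_deriveZ.
by rewrite -mulrA; exact: IH.
Qed.

Lemma crb_sum (I : Type) (s : seq I) m (f : I -> 'rV[R]_n -> R) (M : I -> R) :
  (forall i, crb w e m (f i) (M i)) ->
  crb w e m (fun x => \sum_(i <- s) f i x) (\sum_(i <- s) M i).
Proof.
move=> fM; elim: s => [|i s IH].
  rewrite big_nil (_ : (fun _ => _) = fun _ => 0); last by apply/funext => x; rewrite big_nil.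
  exact: crb0.
rewrite big_cons (_ : (fun _ => _) = fun x => f i x + \sum_(i <- s) f i x).
  exact: crbD.
by apply/funext => x; rewrite big_cons.
Qed.

End Weight.

(** Only [g] carries weight and damping, so the cost of multiplying by a fixed [f] is independent of
    [w] and [e]. Each derivative doubles the number of products, whence [2 ^+ m]; when it falls on
    [f], [e <= 1] covers the missing factor [e^-1]. *)
Lemma crbM w e m f g M M' : (forall x, N x -> 0 <= w x) -> 0 < e <= 1 ->
  0 <= M -> 0 <= M' ->
  crb (fun _ => 1) 1 m f M -> crb w e m g M' ->
  crb w e m (fun x => f x * g x) (2 ^+ m * (M * M')).
Proof.
move=> w0 /andP[e0 e1]; elim: m f g M M' => [|m IH] f g M M' M0 M'0 fC gC.
  have [f0 fc fM _] := fC; have [g0 gc gM _] := gC; split=> //.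
  - by move=> x Nx; rewrite f0 // mul0r.
  - exact: within_ctsM.
  - move=> x Nx; rewrite normrM mul1r -mulrA.
    have := fM x Nx; rewrite mulr1 => fMx.
    by apply: ler_pM => //; exact: gM.
have M'e : 0 <= M' / e by rewrite divr_ge0 // ltW.
have [f0 fc fM fd] := fC; have [g0 gc gM gd] := gC; split=> //.
- by move=> x Nx; rewrite f0 // mul0r.
- exact: within_ctsM.
- move=> x Nx; rewrite normrM; have := fM x Nx; rewrite mulr1 => fMx.
  apply: (@le_trans _ _ (M * (M' * w x))); first by apply: ler_pM => //; exact: gM.
  rewrite -!mulrA; apply: ler_peMl; last by rewrite exprn_ege1 // ler1n.
  by rewrite !mulr_ge0 // w0.
move=> i; have [f' fd' fC'] := fd i; have [g' gd' gC'] := gd i.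
exists (fun x => f' x * g x + f x * g' x) => [x Nx|].
  have := fd' x Nx; have := gd' x Nx => Dg Df.
  have -> : f' x * g x + f x * g' x = f x *: g' x + g x *: f' x.
    by rewrite addrC; congr (_ + _); rewrite mulrC.
  exact: is_deriveM.
rewrite divr1 in fC'.
have -> : 2 ^+ m.+1 * (M * M') / e = 2 ^+ m * (M * (M' / e)) + 2 ^+ m * (M * (M' / e)).
  by rewrite exprS; field; rewrite gt_eqF.
apply: crbD.
  apply: IH => //; apply: crb_le (crb_order _ _ _ gC) => //.
  by rewrite ler_pdivlMr // ler_piMr.
by apply: IH => //; apply: crb_order fC.
Qed.

Lemma crbM1 m f g M M' : 0 <= M -> 0 <= M' ->
  crb (fun _ => 1) 1 m f M -> crb (fun _ => 1) 1 m g M' ->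
  crb (fun _ => 1) 1 m (fun x => f x * g x) (2 ^+ m * (M * M')).
Proof. by move=> M0 M'0; apply: crbM => //; rewrite ltr01 lexx. Qed.

Lemma crb_cst m (c : R) :
  crb (fun _ => 1) 1 m (fun x => if `[< N x >] then c else 0) `|c|.
Proof.
have cc : {within N, continuous (fun x => if `[< N x >] then c else 0)}.
  have H : {in N, (fun _ => c) =1 (fun x => if `[< N x >] then c else 0)}.
    by move=> x /set_mem Nx; rewrite asboolT.
  by apply: (subspace_eq_continuous H) => x; exact: cst_continuous.
have cM x : N x -> `|if `[< N x >] then c else 0| <= `|c| * 1 by move=> Nx; rewrite asboolT // mulr1.
case: m => [|m]; split=> //; try by move=> x Nx; rewrite asboolF.
move=> i; exists (fun _ => 0) => [x Nx|]; last first.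
  by apply: crb0 => //; rewrite divr_ge0.
apply: (@near_eq_is_derive _ _ _ (fun _ => c)) => //.
have := nbhs_interior Nx; apply: filterS => y Ny.
by rewrite asboolT //; exact: interior_subset.
Qed.

End CrBoundAlgebra.

(** * Integrals of continuous functions over the unit interval *)

Section UnitIntegral.
Context {R : realType}.
Implicit Types (f g : R -> R).

Definition cts01 f := {within `[0, 1], continuous f}.
Definition int01 f : R := \int[lebesgue_measure]_(t in `[0, 1]) f t.

Lemma cts01_integrable f : cts01 f -> lebesgue_measure.-integrable `[0, 1] (EFin \o f).
Proof. by move=> fc; apply: continuous_compact_integrable => //; exact: segment_compact. Qed.

Lemma int01_cst (c : R) : int01 (fun _ => c) = c.
Proof.
have m01 : lebesgue_measure (`[0, 1]%classic : set R) = 1%:E.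
  by rewrite lebesgue_measure_itv /= lte01 oppr0 adde0.
rewrite /int01 Rintegral_cst //; transitivity (c * fine (1%:E : \bar R)); last by rewrite mulr1.
by congr (_ * fine _).
Qed.

Lemma le_int01 f g : cts01 f -> cts01 g -> (forall t, 0 <= t <= 1 -> f t <= g t) ->
  int01 f <= int01 g.
Proof.
move=> fc gc fg; apply: le_Rintegral => //; try exact: cts01_integrable.
Qed.

Lemma int01D f g : cts01 f -> cts01 g -> int01 (fun t => f t + g t) = int01 f + int01 g.
Proof. by move=> fc gc; apply: RintegralD => //; exact: cts01_integrable. Qed.

Lemma int01B f g : cts01 f -> cts01 g -> int01 (fun t => f t - g t) = int01 f - int01 g.
Proof. by move=> fc gc; apply: RintegralB => //; exact: cts01_integrable. Qed.

Lemma int01Z (c : R) f : cts01 f -> int01 (fun t => c * f t) = c * int01 f.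
Proof. by move=> fc; apply: RintegralZl => //; exact: cts01_integrable. Qed.

Lemma eq_int01 f g : (forall t, 0 <= t <= 1 -> f t = g t) -> int01 f = int01 g.
Proof. by move=> fg; apply: eq_Rintegral => t /set_mem /=; rewrite in_itv /=; exact: fg. Qed.

Lemma cts01P f : cts01 f <-> forall t, 0 <= t <= 1 -> forall e : R, 0 < e ->
  exists2 d : R, 0 < d & forall s, 0 <= s <= 1 -> `|s - t| < d -> `|f s - f t| <= e.
Proof.
split=> [/subspace_continuousP fc t t01 e e0|H].
  have /cvgrPdist_le/(_ _ e0) := fc t (ltac:(by rewrite /= in_itv)).
  rewrite near_withinE => /(proj1 (@near_normP R R^o t _))[d d0 H].
  exists d => // s s01 sd; have := H (s - t) sd; rewrite subrKC distrC; apply.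
  by rewrite /= in_itv.
apply/subspace_continuousP => t /=; rewrite in_itv /= => t01.
apply/cvgrPdist_le => e e0; rewrite near_withinE.
have [d d0 {}H] := H t t01 e e0.
apply: (proj2 (@near_normP R R^o t _)); exists d => // h hd; rewrite /= in_itv /= => th.
by rewrite distrC; apply: H => //; rewrite [t + h]addrC addrK.
Qed.

Lemma cts01_norm f : cts01 f -> cts01 (fun t => `|f t|).
Proof.
move=> /cts01P H; apply/cts01P => t t01 e e0; have [d d0 {}H] := H t t01 e e0.
by exists d => // s s01 sd; apply: le_trans (ler_dist_dist _ _) (H s s01 sd).
Qed.

Lemma norm_int01 f : cts01 f -> `|int01 f| <= int01 (fun t => `|f t|).
Proof. by move=> fc; apply: le_normr_Rintegral => //; exact: cts01_integrable. Qed.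

Lemma norm_int01_le f g : cts01 f -> cts01 g -> (forall t, 0 <= t <= 1 -> `|f t| <= g t) ->
  `|int01 f| <= int01 g.
Proof.
move=> fc gc fg; apply: le_trans (norm_int01 fc) _; apply: le_int01 => //.
exact: cts01_norm.
Qed.

End UnitIntegral.

(** * Means along rays in a star-shaped set *)

Section RadialMean.
Context {R : realType} {n : nat} (N : set 'rV[R]_n).
Hypotheses (cN : compact N) (sN : star_shaped N).
Implicit Types (B g w : 'rV[R]_n -> R).

Lemma star_scale x (t : R) : N x -> 0 <= t <= 1 -> N (t *: x).
Proof. by case: sN => _ H Nx; exact: H. Qed.

(** Scaling takes a ball of radius [d] in [N] to one of radius [t * d]. At t = 0 this breaks down,
    and 0 may lie on the boundary of [N]. *)
Lemma star_int x (t : R) : N° x -> 0 < t <= 1 -> N° (t *: x).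
Proof.
move=> /near_normP[d d0 H] /andP[t0 t1].
suff : \forall z \near t *: x, N z by [].
apply: (proj2 (@near_normP R _ _ _)); exists (t * d); first exact: mulr_gt0.
move=> h hd; have -> : t *: x + h = t *: (x + t^-1 *: h).
  by rewrite scalerDr scalerA divff ?scale1r // gt_eqF.
apply: star_scale; last by rewrite ltW.
by apply: H; rewrite normrZ gtr0_norm ?invr_gt0 // ltr_pdivrMl.
Qed.

Lemma uniform_cts B : {within N, continuous B} -> forall e : R, 0 < e ->
  exists2 d : R, 0 < d & forall x y, N x -> N y -> `|x - y| < d -> `|B x - B y| <= e.
Proof.
move=> /subspace_continuousP Bc e e0.
have e2 : 0 < e / 2 by rewrite divr_gt0.
pose P (d : R) x := forall y, N x -> N y -> `|x - y| < d -> `|B x - B y| <= e.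
have cov x : N x -> \forall x' \near x & d \near (0 : R)^'+, P d x'.
  move=> Nx.
  have /cvgrPdist_le/(_ _ e2) := Bc x Nx.
  rewrite near_withinE => /(proj1 (@near_normP R _ x _))[d d0 H].
  have d2 : 0 < d / 2 by rewrite divr_gt0.
  exists ([set y : 'rV[R]_n | `|y - x| < d / 2], [set s : R | s < d / 2]) => /=.
    split; last exact: nbhs_right_lt.
    apply: (proj2 (@near_normP R _ x _)); exists (d / 2) => // h hd.
    by rewrite /= [x + h]addrC addrK.
  move=> [y s] /= [yx sd] z Ny Nz yz.
  have h1 : `|B x - B y| <= e / 2.
    by have := H (y - x); rewrite subrKC; apply => //; lra.
  have h2 : `|B x - B z| <= e / 2.
    have := H (z - x); rewrite subrKC; apply => //.
    rewrite (_ : z - x = (y - x) - (y - z)); last by zmod.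
    by apply: le_lt_trans (ler_normB _ _) _; lra.
  rewrite (_ : B y - B z = (B x - B z) - (B x - B y)); last by ring.
  by apply: le_trans (ler_normB _ _) _; lra.
have H : \forall d \near (0 : R)^'+, N `<=` P d.
  by apply: (proj1 (compact_near_coveringP N)).
have H' : \forall d \near (0 : R)^'+, 0 < d by exact: nbhs_right_gt.
have [d [d0 dH]] := filter_ex (filterI H' H).
by exists d => // x y Nx Ny xy; exact: (dH x Nx y).
Qed.

Lemma radial_cts B q x : {within N, continuous B} -> N x -> cts01 (fun t => t ^+ q * B (t *: x)).
Proof.
move=> Bc Nx; rewrite /cts01.
have c1 : cts01 (fun t => B (t *: x)).
  apply/cts01P => t t01 e e0; have [d d0 H] := uniform_cts Bc e0.
  exists (d / (`|x| + 1)) => [|s s01]; first by rewrite divr_gt0 // ltr_wpDl.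
  rewrite ltr_pdivlMr ?ltr_wpDl // => sd; apply: H; try exact: star_scale.
  rewrite -scalerBl normrZ; apply: le_lt_trans sd.
  by rewrite ler_wpM2l // lerDl.
have c2 : cts01 (fun t : R => t ^+ q).
  by apply: continuous_subspaceT => t; exact: exprn_continuous.
move/subspace_continuousP: c1 => c1; move/subspace_continuousP: c2 => c2.
by apply/subspace_continuousP => t t01; exact: (cvgM (c2 t t01) (c1 t t01)).
Qed.

(** Up to sign and a factor [x 0 k], a summand of [dR_homotopy] in form degree [q]. The exponent is
    a parameter because each differentiation under the integral brings out one more [t]. *)
Definition radial q B x : R :=
  if `[< N x >] then int01 (fun t => t ^+ q * B (t *: x)) else 0.

Lemma radial_within q B : {within N, continuous B} -> {within N, continuous (radial q B)}.
Proof.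
move=> Bc; apply/subspace_continuousP => x Nx; apply/cvgrPdist_le => e e0.
have [d d0 H] := uniform_cts Bc e0.
rewrite near_withinE; apply: (proj2 (@near_normP R _ x _)); exists d => // h hd Ny.
rewrite -[X in `|X|]/(radial q B x - radial q B (x + h)) /radial !asboolT //.
have rc y := @radial_cts B q y Bc.
rewrite -int01B; [|exact: rc|exact: rc].
rewrite -[leRHS]int01_cst; apply: norm_int01_le.
- move/subspace_continuousP: (rc x Nx) => c1; move/subspace_continuousP: (rc _ Ny) => c2.
  by apply/subspace_continuousP => t t01; exact: (cvgB (c1 t t01) (c2 t t01)).
- by move=> t; exact: cst_continuous.
move=> t t01; have /andP[t0 t1] := t01.
rewrite -mulrBr normrM ger0_norm ?exprn_ge0 //.
apply: le_trans (ler_piMl _ _) _ => //; first exact: exprn_ile1.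
apply: H; try exact: star_scale.
rewrite -scalerBr normrZ ger0_norm // opprD addrA subrr sub0r normrN.
by apply: le_lt_trans hd; exact: ler_piMl.
Qed.

(** Only a directional derivative of [B] is given, so the chain rule is obtained by rescaling the
    difference quotient by [t]. *)
Lemma is_derive_radial B e (l : R) x (a t : R) : t != 0 -> is_derive (t *: (x + a *: e)) e B l ->
  is_derive a 1 (fun h : R => B (t *: (x + h *: e))) (t * l).
Proof.
move=> t0 dB; have [dB1 dB2] := dB.
suff H : h^-1 *: (B (t *: (x + (h *: 1 + a) *: e)) - B (t *: (x + a *: e))) @[h --> 0^'] --> t * l.
  by apply: DeriveDef; [apply/cvg_ex; exists (t * l)|exact/cvg_lim].
have H0 : h^-1 *: (B (h *: e + t *: (x + a *: e)) - B (t *: (x + a *: e))) @[h --> (0 : R)^'] --> l.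
  by rewrite -dB2; exact: dB1.
have tc : t * h @[h --> (0 : R)^'] --> (0 : R)^'.
  move=> A; rewrite /nbhs /= => /(proj1 (@near_normP R R^o 0 _))[d d0 dA].
  apply: (proj2 (@near_normP R R^o 0 _)); exists (d / `|t|).
    by rewrite divr_gt0 // normr_gt0.
  move=> h; rewrite ltr_pdivlMr ?normr_gt0 // add0r => hd h0.
  have := dA (t * h); rewrite add0r normrM mulrC => H1; apply: H1 => //.
  by rewrite mulf_neq0.
have := cvg_comp _ _ tc H0 => H1.
have H2 : t * ((t * h)^-1 *: (B ((t * h) *: e + t *: (x + a *: e)) - B (t *: (x + a *: e))))
    @[h --> (0 : R)^'] --> t * l.
  by apply: cvgM; [exact: cvg_cst|exact: H1].
apply: cvg_trans H2; apply: near_eq_cvg.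
near=> h; have h0 : h != 0 by near: h; exact: nbhs_dnbhs_neq.
have E1 : (h *: 1 + a : R) = h + a by rewrite [h *: 1]mulr1.
have E2 : t * ((t * h)^-1 * (B ((t * h) *: e + t *: (x + a *: e)) - B (t *: (x + a *: e)))) =
  h^-1 * (B ((t * h) *: e + t *: (x + a *: e)) - B (t *: (x + a *: e))).
  by rewrite invfM mulrA mulrA divff // mul1r.
apply: etrans E2 _; rewrite E1; congr (_ * (B _ - _)).
by rewrite !scalerDr !scalerA mulrDr scalerDl; zmod.
Unshelve. all: by end_near. Qed.

Lemma radial_derive q B g M i x : 0 <= M ->
  {within N, continuous B} -> (forall y, N y -> `|g y| <= M) ->
  (forall y, N° y -> is_derive y 'e_i B (g y)) -> N° x ->
  is_derive x 'e_i (radial q B) (radial q.+1 g x).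
Proof.
move=> M0 Bc gM dB Nx; set e := 'e_i : 'rV[R]_n.
have [d d0 dN] : exists2 d : R, 0 < d & forall h : R, `|h| < d -> N° (x + h *: e).
  have /near_normP[d d0 H] : \forall y \near x, N° y by exact: nbhs_interior.
  exists (d / (`|e| + 1)); first by rewrite divr_gt0 // ltr_wpDl.
  move=> h; rewrite ltr_pdivlMr ?ltr_wpDl // => hd; apply: H.
  by rewrite normrZ; apply: le_lt_trans hd; rewrite ler_wpM2l // lerDl.
pose f (h t : R) := t ^+ q * B (t *: (x + h *: e)).
have inI h : `]- d, d[%classic h -> `|h| < d by rewrite /= in_itv /= -ltr_norml.
have df h t : `|h| < d -> 0 <= t <= 1 ->
    is_derive h (1 : R) (fun h' : R => f h' t) (t ^+ q.+1 * g (t *: (x + h *: e))).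
  (* At t = 0 the integrand is constant in [h] and the claimed derivative has the factor 0 ^ (q +
     1); [B] itself need not be differentiable at 0, a possible boundary point. *)
  move=> hd /andP[t0 t1]; have [->|tn0] := eqVneq t 0.
    rewrite exprS !mul0r (_ : (fun h' : R => f h' 0) = cst (0 ^+ q * B 0)); first exact: is_derive_cst.
    by apply/funext => h'; rewrite /f scale0r.
  have tN : N° (t *: (x + h *: e)).
    by apply: star_int (dN _ hd) _; rewrite lt_neqAle eq_sym tn0 t0.
  have Db := is_derive_radial tn0 (dB _ tN).
  have -> : t ^+ q.+1 * g (t *: (x + h *: e)) = t ^+ q *: (t * g (t *: (x + h *: e))).
    by rewrite exprS /GRing.scale /= mulrA [t * _]mulrC.
  exact: is_deriveZ.
have m01 : measurable (`[0, 1]%classic : set R) by [].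
have dfE h t : `|h| < d -> 0 <= t <= 1 -> partial1of2 f h t = t ^+ q.+1 * g (t *: (x + h *: e)).
  by move=> hd t01; have Df := df h t hd t01; rewrite partial1of2E (@derive_val _ _ _ _ _ _ _ Df).
have I0 : `]- d, d[%classic (0 : R) by rewrite /= in_itv /= oppr_lt0 d0.
have intf h : `]- d, d[%classic h -> lebesgue_measure.-integrable `[0, 1] (EFin \o f h).
  by move=> /inI hd; apply/cts01_integrable/radial_cts => //; exact: (interior_subset (dN _ hd)).
have derf h t : `]- d, d[%classic h -> `[0, 1]%classic t -> derivable (fun h' => f h' t) h (1 : R).
  by move=> /inI hd; rewrite /= in_itv /= => t01; have [] := df h t hd t01.
have Mf h t : `]- d, d[%classic h -> `[0, 1]%classic t -> `|partial1of2 f h t| <= M.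
  move=> /inI hd; rewrite /= in_itv /= => t01; rewrite dfE // normrM.
  have /andP[t0 t1] := t01; rewrite ger0_norm ?exprn_ge0 //.
  apply: le_trans (ler_piMl _ _) _ => //; first exact: exprn_ile1.
  by apply: gM; apply: star_scale => //; exact: (interior_subset (dN _ hd)).
have intM : lebesgue_measure.-integrable `[0, 1] (EFin \o (fun _ : R => M)).
  by apply: cts01_integrable => t; exact: cst_continuous.
have L := @cvg_differentiation_under_integral R _ _ lebesgue_measure f `[0, 1] m01 0 (- d) d
  I0 intf derf (fun _ => M) (fun _ => M0) intM Mf.
have E0 : \int[lebesgue_measure]_(t in `[0, 1]) partial1of2 f 0 t = radial q.+1 g x.
  rewrite /radial asboolT; last exact: interior_subset.
  apply: eq_int01 => t t01; rewrite dfE ?normr0 //.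
  by rewrite scale0r addr0.
suff H : h^-1 *: (radial q B (h *: e + x) - radial q B x) @[h --> 0^'] --> radial q.+1 g x.
  by apply: DeriveDef; [apply/cvg_ex; exists (radial q.+1 g x)|exact/cvg_lim].
rewrite -E0; apply: cvg_trans L; apply: near_eq_cvg.
have fE h : `|h| < d -> \int[lebesgue_measure]_(t in `[0, 1]) f h t = radial q B (h *: e + x).
  by move=> hd; rewrite addrC /radial asboolT //; exact: (interior_subset (dN _ hd)).
near=> h; have hd : `|h| < d.
  by near: h; apply: dnbhs0_lt.
by rewrite /= addr0 !fE ?normr0 // scale0r add0r.
Unshelve. all: by end_near. Qed.

Section Weighted.
Variables (w : 'rV[R]_n -> R) (e eta : R).
Hypotheses (e0 : 0 < e) (e1 : e <= 1) (eta0 : 0 <= eta).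
Hypothesis wN : forall x, N x -> 0 <= w x.
Hypothesis wc : {within N, continuous w}.
Hypothesis wb : exists C, forall x, N x -> w x <= C.
Hypothesis w_mono : forall x (t : R), N x -> 0 <= t <= 1 -> w (t *: x) <= w x.
Hypothesis w_int : forall x k, N x -> `|x 0 k| * int01 (fun t => w (t *: x)) <= eta * w x.

Lemma radial_weight_cts x : N x -> cts01 (fun t => w (t *: x)).
Proof.
move=> Nx; have := radial_cts (q := 0) wc Nx.
by under eq_fun do rewrite expr0 mul1r.
Qed.

Lemma radial_le q B M x : {within N, continuous B} -> 0 <= M ->
  (forall y, N y -> `|B y| <= M * w y) -> N x ->
  `|radial q B x| <= M * int01 (fun t => w (t *: x)).
Proof.
move=> Bc M0 BM Nx; rewrite /radial asboolT //.
rewrite -int01Z; last exact: radial_weight_cts.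
apply: norm_int01_le.
- exact: radial_cts.
- have /subspace_continuousP c1 := radial_weight_cts Nx.
  by apply/subspace_continuousP => t t01; exact: (cvgM (cvg_cst M) (c1 t t01)).
move=> t t01; rewrite normrM; have /andP[t0 t1] := t01; rewrite ger0_norm ?exprn_ge0 //.
apply: le_trans (ler_piMl _ _) _ => //; first exact: exprn_ile1.
by apply: BM; exact: star_scale.
Qed.

Lemma int01_weight_le x : N x -> int01 (fun t => w (t *: x)) <= w x.
Proof.
move=> Nx; rewrite -[leRHS]int01_cst; apply: le_int01.
- exact: radial_weight_cts.
- by move=> t; exact: cst_continuous.
by move=> t; exact: w_mono.
Qed.

(** The bound survives because [w] does not exceed its value at [x] on the segment from 0 to [x]. No
    factor is gained; this serves the term of [crb_moment] in which [x 0 k] is differentiated. *)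
Lemma crb_radial m q B M : 0 <= M -> crb N w e m B M -> crb N w e m (radial q B) M.
Proof.
have [C wC] := wb.
elim: m q B M => [|m IH] q B M M0 [B0 Bc BM Bd].
all: have rM x : N x -> `|radial q B x| <= M * w x.
1,3: by move=> Nx; apply: le_trans (radial_le _ Bc M0 BM Nx) _; apply: ler_wpM2l (int01_weight_le Nx).
all: have r0 x : ~ N x -> radial q B x = 0 by move=> Nx; rewrite /radial asboolF.
all: have rc := @radial_within q B Bc.
all: split => //.
move=> i; have [g gd gC] := Bd i.
have [_ _ gM] := crb_base gC.
exists (radial q.+1 g); last by apply: IH => //; rewrite divr_ge0 // ltW.
move=> x Nx; apply: (@radial_derive q B g (`|M / e| * `|C|)) => //.
move=> y Ny; apply: le_trans (gM y Ny) _; apply: le_trans (ler_norm _) _.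
rewrite normrM ler_wpM2l // ger0_norm ?wN //.
exact: le_trans (wC y Ny) (ler_norm _).
Qed.

Lemma is_derive_coord (x : 'rV[R]_n) (i k : 'I_n) :
  is_derive x 'e_i (fun y : 'rV[R]_n => y 0 k) ((i == k)%:R : R).
Proof.
have dc := differentiable_coord x 0 k.
apply: DeriveDef; first exact: diff_derivable.
rewrite deriveE //.
have @f : {linear 'rV[R]_n -> R}.
  by exists (fun N : 'rV[R]_n => N 0 k); do 2![eexists]; do ?[constructor];
     rewrite ?mxE// => ? *; rewrite ?mxE//; move=> ?; rewrite !mxE.
rewrite (_ : (fun y : 'rV[R]_n => y 0 k) = f) //.
by rewrite diff_lin; [rewrite /= mxE eqxx eq_sym|exact: coord_continuous].
Qed.

Lemma within_coord (k : 'I_n) : {within N, continuous (fun y : 'rV[R]_n => y 0 k)}.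
Proof. by apply: continuous_subspaceT => x; exact: coord_continuous. Qed.

(* A factor [e + eta] is gained: [eta] from integrating the weight along the ray, [e]
   whenever a derivative falls on the factor [x 0 k]. *)
Lemma crb_moment m q k B M : 0 <= M -> crb N w e m B M ->
  crb N w e m (fun x => x 0 k * radial q B x) (m.+1%:R * M * (e + eta)).
Proof.
have [C wC] := wb.
elim: m q B M => [|m IH] q B M M0 BC.
all: have [B0 Bc BM] := crb_base BC.
all: have f0 x : ~ N x -> x 0 k * radial q B x = 0 by move=> Nx; rewrite /radial asboolF // mulr0.
all: have fc := within_ctsM (@within_coord k) (@radial_within q B Bc).
all: have fM x : N x -> `|x 0 k * radial q B x| <= M * (e + eta) * w x.
1,3: move=> Nx; rewrite normrM; apply: le_trans (ler_wpM2l (normr_ge0 _) (radial_le _ Bc M0 BM Nx)) _;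
  rewrite mulrCA -mulrA; apply: ler_wpM2l => //; apply: le_trans (@w_int x k Nx) _;
  by apply: ler_wpM2r; [exact: wN|rewrite lerDr ltW].
  by split=> // x Nx; rewrite mul1r; exact: fM.
split=> //.
  move=> x Nx; apply: le_trans (fM x Nx) _; rewrite -!mulrA; apply: ler_peMl.
    by rewrite !mulr_ge0 ?wN // addr_ge0 // ltW.
  by rewrite ler1n.
case: BC => _ _ _ Bd i; have [g gd gC] := Bd i; have [_ _ gM] := crb_base gC.
exists (fun x => (i == k)%:R * radial q B x + x 0 k * radial q.+1 g x).
  move=> x Nx.
  have D1 := is_derive_coord x i k.
  have D2 : is_derive x 'e_i (radial q B) (radial q.+1 g x).
    apply: (@radial_derive q B g (`|M / e| * `|C|)) => //.
    move=> y Ny; apply: le_trans (gM y Ny) _; apply: le_trans (ler_norm _) _.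
    rewrite normrM ler_wpM2l // ger0_norm ?wN //.
    exact: le_trans (wC y Ny) (ler_norm _).
  have -> : (i == k)%:R * radial q B x + x 0 k * radial q.+1 g x =
     x 0 k *: radial q.+1 g x + radial q B x *: (i == k)%:R.
    by rewrite addrC [X in _ + X]mulrC.
  exact: is_deriveM.
have Me0 : 0 <= M / e by rewrite divr_ge0 // ltW.
have BC' : crb N w e m (radial q B) M.
  by apply: (@crb_order _ _ _ w e) => //; apply: (@crb_radial m.+1) => //; split=> // j; exact: Bd.
have H1 : crb N w e m (fun x => (i == k)%:R * radial q B x) M.
  case: (i == k).
    by rewrite (_ : (fun x => _) = radial q B) //; apply/funext => x; rewrite mul1r.
  by rewrite (_ : (fun x => _) = fun=> 0); [exact: crb0|apply/funext => x; rewrite mul0r].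
(* The term from differentiating [x 0 k] has the bound [M], at most [M * (e + eta) / e]; it uses up
   the step from [m.+1] to [m.+2]. *)
apply: crb_le (crbD H1 (IH q.+1 g (M / e) Me0 gC)) => //.
rewrite -(ler_pM2l e0).
have -> : e * (M + m.+1%:R * (M / e) * (e + eta)) = M * e + m.+1%:R * M * (e + eta).
  by field; rewrite gt_eqF.
have -> : e * (m.+2%:R * M * (e + eta) / e) = M * e + M * eta + m.+1%:R * M * (e + eta).
  by rewrite -[m.+2%:R]natr1; field; rewrite gt_eqF.
by rewrite lerD2r lerDl mulr_ge0.
Qed.

End Weighted.
End RadialMean.

(** * Composition with smooth functions *)

Section SmoothOnEstimates.
Context {R : realType}.
Implicit Types E F : normedModType R.

Lemma finType_min_pos (I : finType) (d : I -> R) : (forall i, 0 < d i) ->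
  exists2 e, 0 < e & forall i, e <= d i.
Proof.
(* The initial value 1 covers an empty index type. *)
move=> d0; exists (\big[Num.min/1]_i d i).
  by elim/big_ind: _ => // x y x0 y0; rewrite lt_min x0.
by move=> i; rewrite (bigD1 i) //= ge_min lexx.
Qed.

(** What superposition needs from [smooth_on]: directional derivatives that are smooth again, by
    fixing the last slot of the multilinear derivatives, and Taylor bounds uniform near each point,
    by the mean value inequality. *)
Lemma smooth_on_local E F (V : set E) (f : E -> F) : open V -> smooth_on V f ->
  exists D : E -> E -> F,
  [/\ forall u, V u -> linear (D u), forall v, smooth_on V (D^~ v) &
      forall u, V u -> exists2 d : R, 0 < d & exists2 C, 0 <= C &
        forall u' h, `|u' - u| < d -> `|h| < d ->
        [/\ V (u' + h), `|f u'| <= C, `|f (u' + h) - f u'| <= C * `|h| &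
            `|f (u' + h) - f u' - D u' h| <= C * `|h| ^+ 2] ].
Proof.
move=> oV [D HD]; exists (fun u v => D u [:: v]); split.
- by move=> u /HD[_ H _ _] a v w; exact: (H [::] [::]).
- move=> v; exists (fun x s => D x (rcons s v)) => x Vx; have [_ H1 H2 H3] := HD x Vx.
  split=> //.
  + by move=> s1 s2 a u w; rewrite !rcons_cat !rcons_cons; exact: H1.
  + move=> k; have [M HM] := H2 k.+1; exists (M * `|v|) => s sk.
    have := HM (rcons s v); rewrite size_rcons sk => /(_ erefl).
    by rewrite -cats1 big_cat big_seq1 /= mulrA mulrAC.
  + move=> k e e0; have e1 : 0 < e / (`|v| + 1) by rewrite divr_gt0 // ltr_wpDl.
    apply: filterS (H3 k.+1 _ e1) => h Hh s sk.
    have := Hh (rcons s v); rewrite size_rcons sk => /(_ erefl) /le_trans; apply.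
    rewrite -cats1 big_cat big_seq1 /=; set P := \prod_(w <- s) _.
    have P0 : 0 <= P by apply: prodr_ge0 => ? _; exact: normr_ge0.
    have -> : e * `|h| * P = e / (`|v| + 1) * `|h| * (P * (`|v| + 1)).
      by field; rewrite gt_eqF // ltr_wpDl.
    apply: ler_wpM2l; last by apply: ler_wpM2l; rewrite ?lerDl.
    by rewrite mulr_ge0 // ltW.
have dD s u : V u -> differentiable (fun x => D x s) u /\
    'd (fun x => D x s) u = (fun h => D u (h :: s)) :> (E -> F).
  move=> Vu; have [_ H1 H2 H3] := HD u Vu; apply: frechet_diff.
  - by move=> a v w; exact: (H1 [::] s).
  - have [M HM] := H2 (size s).+1; exists (M * \prod_(v <- s) `|v|) => v.
    by have := HM (v :: s) erefl; rewrite big_cons [`|v| * _]mulrC mulrA.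
  - move=> e e0; have P0 : 0 < \prod_(v <- s) `|v| + 1.
      by rewrite ltr_wpDl // prodr_ge0 // => ? _; exact: normr_ge0.
    have /near0_normP[d d0 Hd] := H3 (size s) _ (divr_gt0 e0 P0).
    exists d => // h /Hd/(_ s erefl)/le_trans; apply.
    have -> : e * `|h| = e / (\prod_(v <- s) `|v| + 1) * `|h| * (\prod_(v <- s) `|v| + 1).
      by field; rewrite gt_eqF.
    apply: ler_wpM2l; last by rewrite lerDl.
    by rewrite mulr_ge0 // divr_ge0 // ltW.
(* A bound at [u] spreads to a neighbourhood through the remainder estimate of order [k] with eps =
   1. *)
have bnd k u : V u -> exists2 d : R, 0 < d & exists2 M, 0 <= M & forall h, `|h| < d ->
    V (u + h) /\ forall s, size s = k -> `|D (u + h) s| <= M * \prod_(v <- s) `|v|.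
  move=> Vu; have [_ _ H2 H3] := HD u Vu.
  have [M1 HM1] := H2 k; have [M2 HM2] := H2 k.+1.
  have /near0_normP[d d0 Hd] := H3 k 1 ltr01; have [d' d'0 oH] := open_normP oV Vu.
  exists (Num.min 1 (Num.min d d')); first by rewrite !lt_min ltr01 d0.
  exists (1 + `|M1| + `|M2|) => [|h]; first by rewrite !addr_ge0.
  rewrite !lt_min => /andP[h1 /andP[hd hd']]; split=> [|s sk]; first exact: oH.
  have P0 : 0 <= \prod_(v <- s) `|v| by apply: prodr_ge0 => ? _; exact: normr_ge0.
  have a1 := Hd h hd s sk; have a2 := HM1 s sk.
  have := HM2 (h :: s); rewrite /= sk => /(_ erefl); rewrite big_cons => a3.
  have -> : D (u + h) s = (D (u + h) s - D u s - D u (h :: s)) + D u s + D u (h :: s) by zmod.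
  rewrite !mulrDl; apply: le_trans (ler_normD _ _) _; apply: lerD.
    apply: le_trans (ler_normD _ _) _; apply: lerD.
      apply: le_trans a1 _; rewrite mul1r; apply: ler_wpM2r => //.
      exact: ltW.
    by apply: le_trans a2 _; apply: ler_wpM2r => //; exact: ler_norm.
  apply: le_trans a3 _; apply: le_trans (ler_wpM2r _ (ler_norm _)) _.
    by rewrite mulr_ge0.
  by apply: ler_wpM2l => //; apply: ler_piMl => //; exact: ltW.
move=> u Vu; have [d0 d00 [M0 M00 H0]] := bnd 0%N u Vu.
have [d1 d10 [M1 M10 H1]] := bnd 1%N u Vu; have [d2 d20 [M2 M20 H2]] := bnd 2%N u Vu.
pose d := Num.min d0 (Num.min d1 d2); have d_gt0 : 0 < d by rewrite !lt_min d00 d10.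
exists (d / 2); first by rewrite divr_gt0.
exists (M0 + M1 + M2) => [|u' h u'd hd]; first by rewrite !addr_ge0.
have seg t : 0 <= t <= 1 -> `|u' + t *: h - u| < d.
  move=> /andP[t0 t1]; rewrite (_ : _ - _ = (u' - u) + t *: h); last by zmod.
  apply: le_lt_trans (ler_normD _ _) _; rewrite normrZ ger0_norm //.
  have : t * `|h| <= `|h| by apply: ler_piMl.
  by move=> th; lra.
have segV t : 0 <= t <= 1 -> [/\ V (u' + t *: h),
    `|D (u' + t *: h) [::]| <= M0,
    forall v, `|D (u' + t *: h) [:: v]| <= M1 * `|v| &
    forall v v', `|D (u' + t *: h) [:: v; v']| <= M2 * (`|v| * `|v'|)].
  move=> /seg; rewrite !lt_min => /andP[s0 /andP[s1 s2]].
  have [V0 b0] := H0 _ s0; have [_ b1] := H1 _ s1; have [_ b2] := H2 _ s2.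
  rewrite !subrKC in V0 b0 b1 b2; split=> //.
  - by have := b0 [::] erefl; rewrite big_nil mulr1.
  - by move=> v; have := b1 [:: v] erefl; rewrite big_seq1.
  - by move=> v v'; have := b2 [:: v; v'] erefl; rewrite big_cons big_seq1.
have fD x : V x -> f x = D x [::] by move=> /HD[].
have t0 : 0 <= (0 : R) <= 1 by rewrite lexx ler01.
have t1 : 0 <= (1 : R) <= 1 by rewrite lexx ler01.
have [Vu' u'0 _ _] := segV 0 t0; rewrite scale0r addr0 in Vu' u'0.
have [Vh _ _ _] := segV 1 t1; rewrite scale1r in Vh.
have nh : 0 <= `|h| by [].
split=> //.
- by rewrite fD //; apply: le_trans u'0 _; rewrite -addrA lerDl addr_ge0.
- rewrite !fD //; have := @mean_value_le _ _ _ (fun x => D x [::]) _ u' h 0 (M1 * `|h|) (seminorm_norm F).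
  rewrite subr0 => le; apply: le_trans (le _ _) _.
  + by move=> t t01; have [Vt _ _ _] := segV t t01; have [] := dD [::] _ Vt.
  + by move=> t t01; have [Vt _ b1 _] := segV t t01; have [_ ->] := dD [::] _ Vt; rewrite subr0.
  + by rewrite !mulrDl; have : 0 <= M0 * `|h| by [exact: mulr_ge0]; have : 0 <= M2 * `|h| by [exact: mulr_ge0]; lra.
rewrite !fD //; have le := @mean_value_le _ _ _ (fun x => D x [::]) _ u' h (D u' [:: h]) (M2 * (`|h| * `|h|)) (seminorm_norm F).
apply: le_trans (le _ _) _.
- by move=> t t01; have [Vt _ _ _] := segV t t01; have [] := dD [::] _ Vt.
- move=> t t01; have [Vt _ _ _] := segV t t01; have [_ ->] := dD [::] _ Vt.
  have := @mean_value_le _ _ _ (fun x => D x [:: h]) _ u' (t *: h) 0 (M2 * (`|h| * `|h|)) (seminorm_norm F).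
  rewrite subr0; apply => s s01; rewrite scalerA.
  + have st01 : 0 <= s * t <= 1.
      have [/andP[? ?] /andP[? ?]] := (s01, t01); by rewrite mulr_ge0 // mulr_ile1.
    by have [Vt' _ _ _] := segV _ st01; have [] := dD [:: h] _ Vt'.
  + have st01 : 0 <= s * t <= 1.
      have [/andP[? ?] /andP[? ?]] := (s01, t01); by rewrite mulr_ge0 // mulr_ile1.
    have [Vt' _ _ b2] := segV _ st01; have [_ ->] := dD [:: h] _ Vt'; rewrite subr0.
    apply: le_trans (b2 _ _) _; apply: ler_wpM2l => //; apply: ler_wpM2r => //.
    have /andP[? ?] := t01; rewrite normrZ ger0_norm //; exact: ler_piMl.
rewrite -expr2; apply: ler_wpM2r; first exact: exprn_ge0.
by rewrite lerDr addr_ge0.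
Qed.

End SmoothOnEstimates.

Section Superposition.
Context {R : realType} {d : nat} (V : set 'rV[R]_d).
Hypothesis oV : open V.
Implicit Types (a : 'rV[R]_d -> R) (pa : 'I_d -> 'rV[R]_d -> R).

Lemma row_norm_le (x : 'rV[R]_d) (M : R) : 0 <= M -> (forall j, `|x 0 j| <= M) -> `|x| <= M.
Proof.
move=> M0 H; rewrite [leLHS]/Num.Def.normr/= mx_normrE (bigmax_le _ M0)//= => -[i j] _ /=.
by rewrite (ord1 i).
Qed.

Lemma coord_norm_le (x : 'rV[R]_d) j : `|x 0 j| <= `|x|.
Proof.
rewrite [leRHS]/Num.Def.normr/= mx_normrE.
exact: (le_bigmax _ (fun ij : 'I_1 * 'I_d => `|x ij.1 ij.2|) (0, j)).
Qed.

(** Coordinate form of the derivative: the [pa j] are scalar functions on the same [V], so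
    inductions on the order stay within scalar smooth functions. The last clause is uniform in the
    base point [u'] so that compactness can globalize it. *)
Definition has_partials a (pa : 'I_d -> 'rV[R]_d -> R) :=
  [/\ smooth_on V a, forall j, smooth_on V (pa j) &
  forall u, V u -> exists2 s : R, 0 < s & exists2 C, 0 <= C &
    forall u' h, `|u' - u| < s -> `|h| < s ->
    [/\ V (u' + h), `|a u'| <= C, `|a (u' + h) - a u'| <= C * `|h| &
        `|a (u' + h) - a u' - \sum_j h 0 j * pa j u'| <= C * `|h| ^+ 2] ].

Lemma has_partials_ex a : smooth_on V a -> exists pa, has_partials a pa.
Proof.
move=> Sa; have [D [Dlin DS Dloc]] := smooth_on_local oV Sa.
exists (fun j u => D u 'e_j); split=> // u Vu; have [s s0 [C C0 H]] := Dloc u Vu.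
exists s => //; exists C => // u' h u's hs.
have [Vuh a1 a2 a3] := H u' h u's hs; split=> //.
have Vu' : V u' by have [] := H u' 0 u's; rewrite ?normr0 ?addr0.
have -> : \sum_j h 0 j * D u' 'e_j = D u' h => //.
pose DM := GRing.isLinear.Build _ _ _ _ _ (Dlin u' Vu').
pose DL : {linear 'rV[R]_d -> R} := HB.pack (D u') DM.
rewrite {2}[h]row_sum_delta -[D u']/(DL : _ -> _) linear_sum /=.
by apply: eq_bigr => j _; exact: esym (linearZZ DL (h 0 j) 'e_j).
Qed.

Lemma has_partials_frechet a pa u : has_partials a pa -> V u ->
  differentiable a u /\ 'd a u = (fun h => \sum_j h 0 j * pa j u) :> ('rV[R]_d -> R).
Proof.
move=> [_ _ H] Vu; have [s s0 [C C0 {}H]] := H u Vu.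
apply: frechet_diff.
- move=> c x y; rewrite scaler_sumr -big_split; apply: eq_bigr => j _.
  by rewrite !mxE mulrDl -mulrA.
- exists (\sum_j `|pa j u|) => v; apply: le_trans (ler_norm_sum _ _ _) _.
  rewrite mulr_suml; apply: ler_sum => j _; rewrite normrM mulrC; apply: ler_wpM2l => //.
  exact: coord_norm_le.
- move=> e e0; have e1 : 0 < e / (C + 1) by rewrite divr_gt0 // ltr_wpDl.
  exists (Num.min s (e / (C + 1))); first by rewrite lt_min s0.
  move=> h; rewrite lt_min ltr_pdivlMr ?ltr_wpDl // => /andP[hs he].
  have [|_ _ _ T] := H u h _ hs; first by rewrite subrr normr0.
  apply: le_trans T _; rewrite expr2 mulrA; apply: ler_wpM2r => //.
  by apply: le_trans (ltW he); rewrite mulrC; apply: ler_wpM2l; rewrite ?lerDl.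
Qed.

Lemma compact_partials a pa (K : set 'rV[R]_d) : compact K -> K `<=` V ->
  has_partials a pa -> exists2 s : R, 0 < s & exists2 C, 0 <= C &
    forall u h, K u -> `|h| < s ->
    [/\ V (u + h), `|a u| <= C, `|a (u + h) - a u| <= C * `|h| &
        `|a (u + h) - a u - \sum_j h 0 j * pa j u| <= C * `|h| ^+ 2].
Proof.
move=> cK KV [_ _ Hloc].
(* One parameter serves as radius and, through [s^-1], as constant. The property improves as [s]
   decreases to 0, the form required by the covering characterization of compactness. *)
pose P (s : R) u := 0 < s -> forall h : 'rV[R]_d, `|h| < s ->
    [/\ V (u + h), `|a u| <= s^-1, `|a (u + h) - a u| <= s^-1 * `|h| &
        `|a (u + h) - a u - \sum_j h 0 j * pa j u| <= s^-1 * `|h| ^+ 2].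
have cov u : K u -> \forall u' \near u & s \near (0 : R)^'+, P s u'.
  move=> /KV Vu; have [s s0 [C C0 H]] := Hloc u Vu.
  have C1 : 0 < (C + 1)^-1 by rewrite invr_gt0 ltr_wpDl.
  exists ([set y : 'rV[R]_d | `|y - u| < s], [set t : R | t < Num.min s (C + 1)^-1]) => /=.
    split; last by apply: nbhs_right_lt; rewrite lt_min s0.
    apply: (proj2 (@near_normP R _ u _)); exists s => // h hs.
    by rewrite /= [u + h]addrC addrK.
  move=> [y t] /= [yu]; rewrite lt_min => /andP[ts tC] t0 h ht.
  have Ct : C <= t^-1.
    rewrite -(ler_pM2r t0) mulVf ?gt_eqF //.
    have : t * (C + 1) < 1 by rewrite -ltr_pdivlMr ?div1r // ltr_wpDl.
    by rewrite mulrDr mulr1 mulrC; lra.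
  have [H1 H2 H3 H4] := H y h yu (lt_trans ht ts); split=> //.
  - exact: le_trans H2 Ct.
  - by apply: le_trans H3 _; apply: ler_wpM2r.
  - by apply: le_trans H4 _; apply: ler_wpM2r => //; exact: exprn_ge0.
have H : \forall s \near (0 : R)^'+, K `<=` P s.
  by apply: (proj1 (compact_near_coveringP K)).
have H' : \forall s \near (0 : R)^'+, 0 < s by exact: nbhs_right_gt.
have [s [s0 sH]] := filter_ex (filterI H' H).
exists s => //; exists s^-1; first by rewrite invr_ge0 ltW.
by move=> u h Ku hs; exact: sH.
Qed.

End Superposition.

Section DirectionalChain.
Context {R : realType}.

Lemma is_derive_lineP (E F : normedModType R) (f : E -> F) x e (l : F) :
  is_derive x e f l <-> is_frechet (fun h : R => f (h *: e + x)) 0 (fun h => h *: l).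
Proof.
split=> [[df <-] eps e0|H].
  have : h^-1 *: (f (h *: e + x) - f x) @[h --> 0^'] --> 'D_e f x by exact: df.
  move=> /cvgrPdist_le/(_ _ e0); rewrite near_withinE => /(proj1 (@near_normP R R^o 0 _))[s s0 H].
  exists s => // h hs; rewrite add0r scale0r add0r.
  have [->|h0] := eqVneq h 0; first by rewrite !scale0r add0r !subrr !normr0 mulr0.
  have := H h hs; rewrite add0r => /(_ h0); rewrite -(ler_pM2r (_ : 0 < `|h|)) ?normr_gt0 //.


  have -> : f (h *: e + x) - f x - h *: 'D_e f x = - (h *: ('D_e f x - h^-1 *: (f (h *: e + x) - f x))).
    by rewrite scalerBr scalerA divff // scale1r opprB.
  by rewrite normrN normrZ mulrC.
suff L : h^-1 *: (f (h *: e + x) - f x) @[h --> 0^'] --> l.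
  by apply: DeriveDef; [apply/cvg_ex; exists l|exact/cvg_lim].
apply/cvgrPdist_le => eps e0; have [s s0 {}H] := H eps e0.
rewrite near_withinE; apply: (proj2 (@near_normP R R^o 0 _)); exists s => // h hs.
rewrite add0r => h0; have nh : 0 < `|h| by rewrite normr_gt0.
have := H h hs; rewrite add0r scale0r add0r => H1.
rewrite -(ler_pM2l nh) -normrZ; apply: le_trans (_ : _ <= eps * `|h|) _; last by rewrite mulrC.
by rewrite scalerBr scalerA divff // scale1r distrC.
Qed.

(** The inner functions have only a directional derivative; restricted to the line through [x] along
    [e] they form a Frechet differentiable curve, to which the usual chain rule applies. *)
Lemma is_derive_row_comp (E : normedModType R) d (a : 'rV[R]_d -> R) (L : 'rV[R]_d -> R)
    (A : 'I_d -> E -> R) x e (l : 'I_d -> R) :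
  differentiable a (\row_j A j x) -> 'd a (\row_j A j x) = L :> ('rV[R]_d -> R) ->
  (forall j, is_derive x e (A j) (l j)) ->
  is_derive x e (fun y => a (\row_j A j y)) (L (\row_j l j)).
Proof.
move=> da <- dA; pose F (h : R) : 'rV[R]_d := \row_j A j (h *: e + x).
have F0 : F 0 = \row_j A j x by rewrite /F scale0r add0r.
have [dF dFE] : differentiable F (0 : R^o) /\ 'd F (0 : R^o) = (fun h : R => h *: \row_j l j) :> (R^o -> 'rV[R]_d).
  apply: frechet_diff.
  - by move=> c u v; rewrite scalerDl scalerA.
  - by exists `|\row_j l j| => v; rewrite normrZ mulrC.
  - move=> eps e0.
    have /choice[s sH] : forall j, exists s, 0 < s /\ forall h : R, `|h| < s ->
        `|A j ((0 + h) *: e + x) - A j (0 *: e + x) - h *: l j| <= eps * `|h|.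
      by move=> j; have [s s0 H] := (proj1 (is_derive_lineP _ _ _ _)) (dA j) eps e0; exists s.
    have [t t0 tH] := finType_min_pos (fun j => proj1 (sH j)).
    exists t => // h ht; apply: row_norm_le => [|j]; first by rewrite mulr_ge0 // ltW.
    by rewrite !mxE; apply: (proj2 (sH j)); exact: lt_le_trans ht (tH j).
apply/is_derive_lineP.
have daF : differentiable a (F 0) by rewrite F0.
have dc := differentiable_comp dF daF.
have := differentiable_frechet dc; rewrite (diff_comp dF daF) dFE F0 => H eps e0.
have [s s0 {}H] := H eps e0; exists s => // h hs; have := H h hs.
by rewrite /= linearZZ.
Qed.

End DirectionalChain.

(** * Symmetry of second partial derivatives *)

Section Schwarz.
Context {R : realType} {d : nat} (V : set 'rV[R]_d).
Hypothesis oV : open V.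

(** The second difference [g t j k] is symmetric in [j] and [k], and it equals t^2 times [pb j k u]
    up to O(t^3): the mean value inequality along [e_ j] leads to a difference of [pa j], which
    Taylor's formula and the local Lipschitz bound of [pb j k] evaluate. *)
Lemma partials_sym (a : 'rV[R]_d -> R) (pa : 'I_d -> 'rV[R]_d -> R)
    (pb : 'I_d -> 'I_d -> 'rV[R]_d -> R) u j k :
  has_partials V a pa -> (forall j, has_partials V (pa j) (pb j)) -> V u ->
  pb j k u = pb k j u.
Proof.
move=> Ha Hpa Vu.
pose e_ (j : 'I_d) : 'rV[R]_d := 'e_j.
pose g (t : R) j k := a (u + t *: e_ j + t *: e_ k) - a (u + t *: e_ j) - (a (u + t *: e_ k) - a u).
have sumE (h : 'I_d -> R) (t : R) j0 : \sum_j (t *: e_ j0) 0 j * h j = t * h j0.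
  rewrite (bigD1 j0) //= big1 ?addr0; first by rewrite !mxE !eqxx mulr1.
  by move=> j1 /negbTE j1n; rewrite !mxE eqxx /= j1n mulr0 mul0r.
have ne j0 : `|e_ j0| <= 1.
  by apply: row_norm_le => // j1; rewrite mxE /=; case: (_ == _); rewrite ?normr1 ?normr0.
have nte (t : R) j0 : `|t *: e_ j0| <= `|t|.
  by rewrite normrZ; apply: ler_piMr.
have key j0 k0 : exists2 s : R, 0 < s & exists2 C, 0 <= C & forall t : R, 0 < t -> t < s ->
    `|g t j0 k0 - t * (t * pb j0 k0 u)| <= C * t ^+ 3.
  have [_ _ /(_ u Vu)[s1 s10 [C1 C10 H1]]] := Hpa j0.
  have [_ /(_ k0)/(has_partials_ex oV)[pc [_ _ /(_ u Vu)[s2 s20 [C2 C20 H2]]]] _] := Hpa j0.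
  pose s := Num.min s1 s2 / 2.
  have s0 : 0 < s by rewrite divr_gt0 // lt_min s10.
  exists s => //; exists (C1 + C2) => [|t t0 ts]; first exact: addr_ge0.
  have [ts1 ts2] : t + t < s1 /\ t + t < s2.
    have : t + t < Num.min s1 s2 by move: ts; rewrite /s; lra.
    by rewrite lt_min => /andP.
  pose F x := a (x + t *: e_ k0) - a x.
  have seg r : 0 <= r <= 1 -> `|r *: (t *: e_ j0)| <= t.
    move=> /andP[r0 r1]; rewrite normrZ ger0_norm //.
    apply: le_trans (ler_piMl _ r1) _ => //.
    by apply: le_trans (nte _ _) _; rewrite ger0_norm // ltW.
  have dF r : 0 <= r <= 1 -> [/\ V (u + r *: (t *: e_ j0)),
      differentiable F (u + r *: (t *: e_ j0)) &
      'd F (u + r *: (t *: e_ j0)) (t *: e_ j0) =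
      t * (pa j0 (u + r *: (t *: e_ j0) + t *: e_ k0) - pa j0 (u + r *: (t *: e_ j0)))].
    move=> r01; set x := u + _.
    have xu : `|x - u| <= t by rewrite /x [u + _]addrC addrK; exact: seg.
    have xu1 : `|x - u| < s1 by apply: le_lt_trans xu _; lra.
    have tk : `|t *: e_ k0| < s1.
      by apply: le_lt_trans (nte _ _) _; rewrite ger0_norm ?ltW //; lra.
    have Vx : V x by have [] := H1 x 0 xu1; rewrite ?normr0 ?addr0.
    have Vxk : V (x + t *: e_ k0) by have [] := H1 x _ xu1 tk.
    have [d1 d1E] := has_partials_frechet Ha Vx.
    have [d2 d2E] := has_partials_frechet Ha Vxk.
    have bI : blin (@id 'rV[R]_d) by exact: blin_id.
    have [dL LE] := blin_affine_diff (t *: e_ k0) x bI.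
    have d3 := differentiable_comp dL d2.
    have d3E : 'd (fun y => a (y + t *: e_ k0)) x = 'd a (x + t *: e_ k0) :> ('rV[R]_d -> R).
      by apply: etrans (diff_comp dL d2) _; rewrite LE.
    split; [exact: Vx|exact: differentiableB d3 d1|].
    apply: etrans (congr1 (@^~ (t *: e_ j0)) (diffB d3 d1)) _.
    have E1 := etrans (congr1 (@^~ (t *: e_ j0)) d3E) (congr1 (@^~ (t *: e_ j0)) d2E).
    apply: etrans (congr2 (fun p q : R => p - q) E1 (congr1 (@^~ (t *: e_ j0)) d1E)) _.
    by rewrite !sumE mulrBr.
  have gE : g t j0 k0 = F (u + t *: e_ j0) - F u by [].
  rewrite gE; apply: (mean_value_le (seminorm_norm R^o)) => [r r01|r r01]; first by have [] := dF r r01.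
  have [Vx _ ->] := dF r r01; set x := u + r *: _ in Vx *.
  have xu : `|x - u| <= t by rewrite /x [u + _]addrC addrK; exact: seg.
  have tk : `|t *: e_ k0| < s1.
    by apply: le_lt_trans (nte _ _) _; rewrite ger0_norm ?ltW //; lra.
  have [|_ _ _ T1] := H1 x _ _ tk; first by apply: le_lt_trans xu _; lra.
  rewrite sumE in T1.
  have [||_ _ T2 _] := H2 u (x - u); first by rewrite subrr normr0.
    by apply: le_lt_trans xu _; lra.
  rewrite subrKC in T2.
  rewrite -mulrBr normrM (gtr0_norm t0).
  have -> : (C1 + C2) * t ^+ 3 = t * (C1 * t ^+ 2 + C2 * t * t) by ring.
  apply: ler_wpM2l; first exact: ltW.
  set p1 := pa j0 _ in T1 *; set p0 := pa j0 x in T1 *.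
  have -> : p1 - p0 - t * pb j0 k0 u = (p1 - p0 - t * pb j0 k0 x) + t * (pb j0 k0 x - pb j0 k0 u) by ring.
  apply: le_trans (ler_normD _ _) _; apply: lerD.
    apply: le_trans T1 _; apply: ler_wpM2l => //.
    rewrite lerXn2r ?nnegrE ?(ltW t0) //.
    by apply: le_trans (nte _ _) _; rewrite ger0_norm // ltW.
  rewrite normrM (gtr0_norm t0) mulrC; apply: ler_wpM2r; first exact: ltW.
  by apply: le_trans T2 _; apply: ler_wpM2l.
have [s1 s10 [C1 C10 K1]] := key j k; have [s2 s20 [C2 C20 K2]] := key k j.
apply/eqP; rewrite -subr_eq0 -normr_le0; apply/ler_addgt0Pr => e e0; rewrite add0r.
have C0 : 0 < C1 + C2 + 1 by rewrite ltr_wpDl // addr_ge0.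
have [t t0 [t1 t2 te]] : exists2 t : R, 0 < t & [/\ t < s1, t < s2 & (C1 + C2 + 1) * t < e].
  exists (Num.min s1 (Num.min s2 (e / (C1 + C2 + 1))) / 2).
    by rewrite divr_gt0 // !lt_min s10 s20 divr_gt0.
  set m := Num.min _ _.
  have m0 : 0 < m by rewrite !lt_min s10 s20 divr_gt0.
  have m2 : m / 2 < m by rewrite ltr_pdivrMr // ltr_pMr // ltr1n.
  have : m <= m by []; rewrite {2}/m !le_min => /andP[a1 /andP[a2 a3]].
  split; [exact: lt_le_trans m2 a1|exact: lt_le_trans m2 a2|].
  by rewrite mulrC -ltr_pdivlMr //; exact: lt_le_trans m2 a3.
have gS : g t j k = g t k j.
  by rewrite /g (_ : u + t *: e_ j + t *: e_ k = u + t *: e_ k + t *: e_ j); [ring|zmod].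
have k1 := K1 t t0 t1; have k2 := K2 t t0 t2; rewrite gS in k1.
have : `|t * (t * (pb j k u - pb k j u))| <= (C1 + C2) * t ^+ 3.
  have -> : t * (t * (pb j k u - pb k j u)) = (g t k j - t * (t * pb k j u)) - (g t k j - t * (t * pb j k u)) by ring.
  by apply: le_trans (ler_normB _ _) _; rewrite mulrDl addrC; apply: lerD.
rewrite !normrM (gtr0_norm t0) mulrA.
have -> : (C1 + C2) * t ^+ 3 = t * t * ((C1 + C2) * t) by ring.
rewrite ler_pM2l ?mulr_gt0 // => H; apply: le_trans H _.
apply: le_trans (ltW te); apply: ler_wpM2r; first exact: ltW.
by rewrite lerDl.
Qed.

End Schwarz.

(** * Superposition with smooth functions: bounds and Taylor estimates *)

Section CrSuperposition.
Context {R : realType} {n d : nat} (N : set 'rV[R]_n) (V : set 'rV[R]_d).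
Hypotheses (cN : compact N) (oV : open V).
Implicit Types (a : 'rV[R]_d -> R) (A : 'I_d -> 'rV[R]_n -> R).

Local Notation crb1 := (crb N (fun _ => 1) 1).

(** The Nemytskii operator of [a], cut off outside [N] like the members of [Cr]. *)
Definition nem a A (x : 'rV[R]_n) : R := if `[< N x >] then a (\row_j A j x) else 0.

Lemma row_within A : (forall j, {within N, continuous (A j)}) ->
  {within N, continuous (fun x => \row_j A j x : 'rV[R]_d)}.
Proof.
move=> Ac; apply/subspace_continuousP => x Nx; apply/cvgrPdist_le => e e0.
have /choice[s sH] : forall j, exists s, 0 < s /\ forall h : 'rV[R]_n, `|h| < s ->
    N (x + h) -> `|A j x - A j (x + h)| <= e.
  move=> j; move/subspace_continuousP: (Ac j) => /(_ x Nx)/cvgrPdist_le/(_ _ e0).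
  by rewrite near_withinE => /(proj1 (@near_normP R _ x _))[s s0 H]; exists s.
have [t t0 tH] := finType_min_pos (fun j => proj1 (sH j)).
rewrite near_withinE; apply: (proj2 (@near_normP R _ x _)); exists t => // h ht Nh.
apply: row_norm_le => [|j]; first exact: ltW.
by rewrite !mxE; apply: (proj2 (sH j)) => //; exact: lt_le_trans ht (tH j).
Qed.

Lemma nem_out a A x : ~ N x -> nem a A x = 0.
Proof. by move=> Nx; rewrite /nem asboolF. Qed.

Lemma nem_in a A x : N x -> nem a A x = a (\row_j A j x).
Proof. by move=> Nx; rewrite /nem asboolT. Qed.

Lemma compact_row A : (forall j, {within N, continuous (A j)}) ->
  compact ((fun x => \row_j A j x : 'rV[R]_d) @` N).
Proof. by move=> /row_within Ac; apply: continuous_compact. Qed.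

Lemma nem_within a pa A : has_partials V a pa ->
  (forall j, {within N, continuous (A j)}) -> (forall x, N x -> V (\row_j A j x)) ->
  {within N, continuous (nem a A)}.
Proof.
move=> Ha Ac AV; have rc := row_within Ac.
apply/subspace_continuousP => x Nx; apply/cvgrPdist_le => e e0.
have [da _] := has_partials_frechet Ha (AV x Nx).
have /differentiable_continuous/cvgrPdist_le/(_ _ e0) := da.
move=> /(proj1 (@near_normP R _ _ _))[s s0 H].
move/subspace_continuousP: rc => /(_ x Nx)/cvgrPdist_lt/(_ _ s0).
rewrite !near_withinE; apply: filterS => y Hy Ny.
rewrite -[X in `|X|]/(nem a A x - nem a A y) !nem_in //.
have := H (\row_j A j y - \row_j A j x); rewrite subrKC; apply.
by rewrite distrC; exact: Hy.
Qed.

Lemma nem_derive a pa A (A' : 'I_d -> R) i x : has_partials V a pa -> N° x -> V (\row_j A j x) ->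
  (forall j, is_derive x 'e_i (A j) (A' j)) ->
  is_derive x 'e_i (nem a A) (\sum_j nem (pa j) A x * A' j).
Proof.
move=> Ha Nx AV dA; have [da daE] := has_partials_frechet Ha AV.
have Nx' := interior_subset Nx.
apply: (@near_eq_is_derive _ _ _ (fun y => a (\row_j A j y))).
- have := nbhs_interior Nx; apply: filterS => y Ny.
  by rewrite nem_in //; exact: interior_subset.
have := is_derive_row_comp da daE dA.
by under eq_bigr do rewrite mxE mulrC -nem_in //.
Qed.

Lemma nem_cont_bound a pa A : has_partials V a pa ->
  (forall j, {within N, continuous (A j)}) -> (forall x, N x -> V (\row_j A j x)) ->
  exists2 s : R, 0 < s & exists2 C, 0 <= C & forall x v, N x -> (forall j, `|v j| < s) ->
    [/\ V (\row_j (A j x + v j)), `|nem a A x| <= C,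
     `|a (\row_j (A j x + v j)) - nem a A x| <= C * `|(\row_j v j : 'rV[R]_d)| &
     `|a (\row_j (A j x + v j)) - nem a A x - \sum_j nem (pa j) A x * v j|
       <= C * `|(\row_j v j : 'rV[R]_d)| ^+ 2].
Proof.
move=> Ha Ac AV; have KV : (fun x => \row_j A j x : 'rV[R]_d) @` N `<=` V by move=> _ [x Nx <-]; exact: AV.
have [s s0 [C C0 H]] := compact_partials (compact_row Ac) KV Ha.
exists s => //; exists C => // x v Nx vs.
have rD : \row_j (A j x + v j) = \row_j A j x + \row_j v j by apply/rowP => j; rewrite !mxE.
have [||H1 H2 H3 H4] := H (\row_j A j x) (\row_j v j); first by exists x.
  have sv j : 0 < s - `|v j| by rewrite subr_gt0.
  have [t t0 tH] := finType_min_pos sv.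
  (* The smallest gap [t] keeps the inequality strict for the maximum norm; the value 0 covers d =
     0. *)
  apply: le_lt_trans (_ : Num.max 0 (s - t) < s).
    apply: row_norm_le => [|j]; first by rewrite le_max lexx.
    by rewrite mxE le_max; apply/orP; right; have := tH j; lra.
  by rewrite gt_max s0 /=; lra.
have E : \sum_j nem (pa j) A x * v j = \sum_j (\row_j v j : 'rV[R]_d) 0 j * pa j (\row_j A j x).
  by apply: eq_bigr => j _; rewrite nem_in // mxE mulrC.
by rewrite rD E nem_in.
Qed.

Lemma crb1_abs m f M x : crb1 m f M -> N x -> `|f x| <= M.
Proof. by move=> /crb_base[_ _ H] /H; rewrite mulr1. Qed.

Lemma crb1_partials m A (M : 'I_d -> R) i : (forall j, crb1 m.+1 (A j) (M j)) ->
  exists g : 'I_d -> 'rV[R]_n -> R,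
    (forall j x, N° x -> is_derive x 'e_i (A j) (g j x)) /\ forall j, crb1 m (g j) (M j).
Proof.
move=> AM; have /choice[g gP] : forall j, exists g,
    (forall x, N° x -> is_derive x 'e_i (A j) (g x)) /\ crb1 m g (M j).
  by move=> j; have [_ _ _ /(_ i)[g gd gC]] := AM j; exists g; rewrite divr1 in gC.
by exists g; split=> j; have [] := gP j.
Qed.

(** Induction on the order for all smooth [a] at once: one derivative replaces [a] by its partials,
    multiplied by derivatives of the [A j]. *)
Lemma crb1_nem m a A (M : 'I_d -> R) : smooth_on V a -> (forall j, 0 <= M j) ->
  (forall j, crb1 m (A j) (M j)) -> (forall x, N x -> V (\row_j A j x)) ->
  exists2 B, 0 <= B & crb1 m (nem a A) B.
Proof.
move=> + M0; elim: m a => [|m IH] a Sa AM AV; have [pa Ha] := has_partials_ex oV Sa.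
all: have Ac j : {within N, continuous (A j)} by have [] := crb_base (AM j).
all: have [s s0 [C C0 HC]] := nem_cont_bound Ha Ac AV.
all: have nc := @nem_within a pa A Ha Ac AV.
all: have nC x : N x -> `|nem a A x| <= C.
1,3: by move=> Nx; have [|_ H _ _] := HC x (fun _ => 0) Nx; first by move=> j; rewrite normr0.
  by exists C => //; split=> // [x|x Nx]; [exact: nem_out|rewrite mulr1; exact: nC].
have [_ Spa _] := Ha.
have AMm j : crb1 m (A j) (M j) by exact: crb_order (AM j).
have /choice[P HP] : forall j, exists P, 0 <= P /\ crb1 m (nem (pa j) A) P.
  by move=> j; have [P P0 H] := IH _ (Spa j) AMm AV; exists P.
pose K := \sum_j 2 ^+ m * (P j * M j).
have K0 : 0 <= K.
  by apply: sumr_ge0 => j _; rewrite !mulr_ge0 ?exprn_ge0 //; case: (HP j).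
exists (C + K); first exact: addr_ge0.
split=> // [x|x Nx|i]; first exact: nem_out.
  by rewrite mulr1; apply: le_trans (nC x Nx) _; rewrite lerDl.
have [A' [dA' CA']] := crb1_partials i AM.
exists (fun x => \sum_j nem (pa j) A x * A' j x).
  move=> x Nx; apply: nem_derive => //; first exact: (AV _ (interior_subset Nx)).
  by move=> j; exact: dA'.
rewrite divr1; apply: (@crb_le _ _ _ _ _ _ _ _ _ K) => //; first by rewrite lerDr.
apply: crb_sum => // j; have [P0 PC] := HP j.
exact: crbM1.
Qed.

Definition addf A (v : 'I_d -> 'rV[R]_n -> R) j x := A j x + v j x.

Lemma nem_add a pa A : has_partials V a pa ->
  (forall j, {within N, continuous (A j)}) -> (forall x, N x -> V (\row_j A j x)) ->
  exists2 s : R, 0 < s & exists2 C, 0 <= C & forall (t : R) m v, 0 <= t < s ->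
    (forall j, crb1 m (v j) t) ->
    [/\ forall x, N x -> V (\row_j addf A v j x),
      {within N, continuous (nem a (addf A v))},
      forall x, N x -> `|nem a (addf A v) x - nem a A x| <= C * t &
      forall x, N x ->
        `|nem a (addf A v) x - nem a A x - \sum_j nem (pa j) A x * v j x| <= C * t ^+ 2].
Proof.
move=> Ha Ac AV; have [s s0 [C C0 HC]] := nem_cont_bound Ha Ac AV.
exists s => //; exists C => // t m v /andP[t0 ts] vt.
have vs x : N x -> forall j, `|v j x| < s.
  by move=> Nx j; apply: le_lt_trans ts; exact: crb1_abs (vt j) Nx.
have AvV x : N x -> V (\row_j addf A v j x) by move=> Nx; have [] := HC x (v^~ x) Nx (vs x Nx).
have vr x : N x -> `|\row_j v j x : 'rV[R]_d| <= t.
  by move=> Nx; apply: row_norm_le => // j; rewrite mxE; exact: crb1_abs (vt j) Nx.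
split=> //.
- apply: (@nem_within a pa) => // j; apply: (@within_ctsD _ _ N (A j) (v j)) => //.
  by have [] := crb_base (vt j).
- move=> x Nx; have [_ _ H _] := HC x (v^~ x) Nx (vs x Nx).
  by rewrite [nem a (addf _ _) _]nem_in //; apply: le_trans H _; apply: ler_wpM2l => //; exact: vr.
- move=> x Nx; have [_ _ _ H] := HC x (v^~ x) Nx (vs x Nx).
  rewrite [nem a (addf _ _) _]nem_in //; apply: le_trans H _; apply: ler_wpM2l => //.
  by rewrite lerXn2r ?nnegrE //; exact: vr.
Qed.

Lemma crb1_nem_lip m a A (M : 'I_d -> R) : smooth_on V a -> (forall j, 0 <= M j) ->
  (forall j, crb1 m (A j) (M j)) -> (forall x, N x -> V (\row_j A j x)) ->
  exists2 s : R, 0 < s & exists2 C, 0 <= C & forall t v, 0 <= t < s ->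
    (forall j, crb1 m (v j) t) ->
    (forall x, N x -> V (\row_j addf A v j x)) /\
    crb1 m (fun x => nem a (addf A v) x - nem a A x) (C * t).
Proof.
move=> + M0; elim: m a => [|m IH] a Sa AM AV; have [pa Ha] := has_partials_ex oV Sa.
all: have Ac j : {within N, continuous (A j)} by have [] := crb_base (AM j).
all: have [s s0 [C C0 HC]] := nem_add Ha Ac AV.
all: have nz v x : ~ N x -> nem a (addf A v) x - nem a A x = 0
  by move=> Nx; rewrite !nem_out // subrr.
all: have nc v : {within N, continuous (nem a (addf A v))} ->
  {within N, continuous (fun x => nem a (addf A v) x - nem a A x)}
  by move=> c1; apply: (@within_ctsB _ _ N (nem a (addf A v)) (nem a A)) => //; exact: (@nem_within a pa).
  exists s => //; exists C => // t v ts vt; have [AvV vc vl _] := HC t _ v ts vt.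
  by split=> //; split=> // [x||x Nx]; [exact: nz|exact: nc|rewrite mulr1; exact: vl].
have [_ Spa _] := Ha.
have AMm j : crb1 m (A j) (M j) by exact: crb_order (AM j).
have /choice[P HP] : forall j, exists P, 0 <= P /\ crb1 m (nem (pa j) A) P.
  by move=> j; have [P P0 H] := crb1_nem (Spa j) M0 AMm AV; exists P.
have /choice[rL HrL] : forall j, exists rL : R * R, [/\ 0 < rL.1, 0 <= rL.2 & forall t v, 0 <= t < rL.1 ->
    (forall j, crb1 m (v j) t) -> crb1 m (fun x => nem (pa j) (addf A v) x - nem (pa j) A x) (rL.2 * t)].
  move=> j; have [r r0 [L L0 H]] := IH _ (Spa j) AMm AV; exists (r, L); split=> // t v tr vt.
  by have [] := H t v tr vt.
have [r0 r00 Hr0] : exists2 e, 0 < e & forall j, e <= (rL j).1.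
  by apply: finType_min_pos => j; have [] := HrL j.
pose K := \sum_j (2 ^+ m * ((rL j).2 * (M j + 1)) + 2 ^+ m * P j).
have K0 : 0 <= K.
  apply: sumr_ge0 => j _; have [_ L0 _] := HrL j; have [P0 _] := HP j.
  by rewrite addr_ge0 // !mulr_ge0 ?exprn_ge0 ?addr_ge0.
(* [t < 1] gives [M j + 1] as a bound for the derivative of [A j + v j]. *)
exists (Num.min 1 (Num.min s r0)); first by rewrite !lt_min ltr01 s0.
exists (C + K); first exact: addr_ge0.
move=> t v /andP[t0]; rewrite !lt_min => /andP[t1 /andP[ts tr]] vt.
have ts' : 0 <= t < s by rewrite t0.
have [AvV vc vl _] := HC t _ v ts' vt; split=> //.
split; [by move=> x; exact: nz|exact: nc| |].
  move=> x Nx; rewrite mulr1; apply: le_trans (vl x Nx) _.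
  by apply: ler_wpM2r => //; rewrite lerDl.
move=> i; rewrite divr1.
have [A' [dA' CA']] := crb1_partials i AM; have [v' [dv' Cv']] := crb1_partials i vt.
exists (fun x => \sum_j ((nem (pa j) (addf A v) x - nem (pa j) A x) * (A' j x + v' j x) +
    nem (pa j) A x * v' j x)).
  move=> x Nx; have Nx' := interior_subset Nx.
  have D1 : is_derive x 'e_i (nem a (addf A v)) (\sum_j nem (pa j) (addf A v) x * (A' j x + v' j x)).
    apply: nem_derive => //; first exact: AvV.
    move=> j; have d1 := dA' j x Nx; have d2 := dv' j x Nx.
    exact: is_deriveD.
  have D2 : is_derive x 'e_i (nem a A) (\sum_j nem (pa j) A x * A' j x).
    by apply: nem_derive => // [|j]; [exact: AV|exact: dA'].
  rewrite (_ : \sum_j _ = \sum_j nem (pa j) (addf A v) x * (A' j x + v' j x) - \sum_j nem (pa j) A x * A' j x).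
    exact: is_deriveB.
  by rewrite -sumrB; apply: eq_bigr => j _; ring.
rewrite mulrDl; apply: (@crb_le _ _ _ _ _ _ _ _ _ (K * t)) => //.
  by rewrite lerDr mulr_ge0.
have vtm j : crb1 m (v j) t by exact: crb_order (vt j).
rewrite /K mulr_suml; apply: crb_sum => // j.
have [_ L0 LC] := HrL j; have [P0 PC] := HP j.
have tr' : 0 <= t < (rL j).1 by rewrite t0 (lt_le_trans tr).
have -> : (2 ^+ m * ((rL j).2 * (M j + 1)) + 2 ^+ m * P j) * t =
  2 ^+ m * (((rL j).2 * t) * (M j + 1)) + 2 ^+ m * (P j * t) by ring.
apply: crbD; last by apply: crbM1 => //; exact: Cv'.
apply: crbM1; rewrite ?mulr_ge0 ?addr_ge0 //; first exact: LC.
apply: crbD; first exact: CA'.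
by apply: (@crb_le _ _ _ _ _ _ _ _ _ t) => //; exact: ltW.
Qed.

(** A derivative of the remainder consists of remainders of the partials [pa j] times derivatives of
    [A j], and of differences of the [pa j] times derivatives of [v j]. Both are O(t^2) one order
    lower, the first by induction and the second by [crb1_nem_lip]. *)
Lemma crb1_nem_taylor m a pa A (M : 'I_d -> R) : has_partials V a pa -> (forall j, 0 <= M j) ->
  (forall j, crb1 m (A j) (M j)) -> (forall x, N x -> V (\row_j A j x)) ->
  exists2 s : R, 0 < s & exists2 C, 0 <= C & forall t v, 0 <= t < s ->
    (forall j, crb1 m (v j) t) ->
    crb1 m (fun x => nem a (addf A v) x - nem a A x - \sum_j nem (pa j) A x * v j x) (C * t ^+ 2).
Proof.
move=> + M0; elim: m a pa => [|m IH] a pa Ha AM AV; have [_ Spa _] := Ha.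
all: have Ac j : {within N, continuous (A j)} by have [] := crb_base (AM j).
all: have [s s0 [C C0 HC]] := nem_add Ha Ac AV.
all: have /choice[pb Hpb] : forall j, exists pb, has_partials V (pa j) pb
  by move=> j; exact: has_partials_ex.
all: have nz v x : ~ N x -> nem a (addf A v) x - nem a A x - \sum_j nem (pa j) A x * v j x = 0
  by move=> Nx; rewrite !nem_out // subrr big1 ?subr0 // => j _; rewrite nem_out // mul0r.
all: have nc v : {within N, continuous (nem a (addf A v))} -> (forall j, {within N, continuous (v j)}) ->
  {within N, continuous (fun x => nem a (addf A v) x - nem a A x - \sum_j nem (pa j) A x * v j x)}
  by move=> c1 c2; apply: (@within_ctsB _ _ N (fun x => nem a (addf A v) x - nem a A x));
    [apply: (@within_ctsB _ _ N (nem a (addf A v)) (nem a A)) => //; exact: (@nem_within a pa)|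
     apply: within_cts_sum => j; apply: (@within_ctsM _ _ N (nem (pa j) A) (v j)) => //;
     exact: (@nem_within (pa j) (pb j))].
  exists s => //; exists C => // t v ts vt; have [AvV vc vl vT] := HC t _ v ts vt.
  split=> // [x||x Nx]; [exact: nz| |rewrite mulr1; exact: vT].
  by apply: nc => // j; have [] := crb_base (vt j).
have AMm j : crb1 m (A j) (M j) by exact: crb_order (AM j).
have /choice[rL HrL] : forall j, exists rL : R * R, [/\ 0 < rL.1, 0 <= rL.2 & forall t v, 0 <= t < rL.1 ->
    (forall j, crb1 m (v j) t) -> crb1 m (fun x => nem (pa j) (addf A v) x - nem (pa j) A x) (rL.2 * t)].
  move=> j; have [r r0 [L L0 H]] := crb1_nem_lip (Spa j) M0 AMm AV; exists (r, L); split=> // t v tr vt.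
  by have [] := H t v tr vt.
have /choice[qT HqT] : forall j, exists qT : R * R, [/\ 0 < qT.1, 0 <= qT.2 & forall t v, 0 <= t < qT.1 ->
    (forall j, crb1 m (v j) t) ->
    crb1 m (fun x => nem (pa j) (addf A v) x - nem (pa j) A x - \sum_k nem (pb j k) A x * v k x) (qT.2 * t ^+ 2)].
  by move=> j; have [r r0 [L L0 H]] := IH _ _ (Hpb j) AMm AV; exists (r, L).
have [r0 r00 Hr0] : exists2 e, 0 < e & forall j, e <= (rL j).1.
  by apply: finType_min_pos => j; have [] := HrL j.
have [q0 q00 Hq0] : exists2 e, 0 < e & forall j, e <= (qT j).1.
  by apply: finType_min_pos => j; have [] := HqT j.
pose K := \sum_j (2 ^+ m * ((qT j).2 * M j) + 2 ^+ m * (rL j).2).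
have K0 : 0 <= K.
  apply: sumr_ge0 => j _; have [_ L0 _] := HrL j; have [_ T0 _] := HqT j.
  by rewrite addr_ge0 // !mulr_ge0 ?exprn_ge0.
exists (Num.min s (Num.min r0 q0)); first by rewrite !lt_min s0 r00.
exists (C + K); first exact: addr_ge0.
move=> t v /andP[t0]; rewrite !lt_min => /andP[ts /andP[tr tq]] vt.
have ts' : 0 <= t < s by rewrite t0.
have [AvV vc vl vT] := HC t _ v ts' vt.
have vc' j : {within N, continuous (v j)} by have [] := crb_base (vt j).
split; [by move=> x; exact: nz|exact: nc| |].
  move=> x Nx; rewrite mulr1; apply: le_trans (vT x Nx) _.
  by apply: ler_wpM2r; [exact: exprn_ge0|rewrite lerDl].
move=> i; rewrite divr1.
have [A' [dA' CA']] := crb1_partials i AM; have [v' [dv' Cv']] := crb1_partials i vt.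
exists (fun x => \sum_j ((nem (pa j) (addf A v) x - nem (pa j) A x - \sum_k nem (pb j k) A x * v k x) * A' j x +
    (nem (pa j) (addf A v) x - nem (pa j) A x) * v' j x)).
  move=> x Nx; have Nx' := interior_subset Nx.
  have D1 : is_derive x 'e_i (nem a (addf A v)) (\sum_j nem (pa j) (addf A v) x * (A' j x + v' j x)).
    apply: nem_derive => //; first exact: AvV.
    move=> j; have d1 := dA' j x Nx; have d2 := dv' j x Nx.
    exact: is_deriveD.
  have D2 : is_derive x 'e_i (nem a A) (\sum_j nem (pa j) A x * A' j x).
    by apply: nem_derive => // [|j]; [exact: AV|exact: dA'].
  have D3 : is_derive x 'e_i (fun y => \sum_j nem (pa j) A y * v j y)
      (\sum_j (nem (pa j) A x * v' j x + v j x * \sum_k nem (pb j k) A x * A' k x)).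
    apply: is_derive_fsum => j.
    have d1 : is_derive x 'e_i (nem (pa j) A) (\sum_k nem (pb j k) A x * A' k x).
      by apply: nem_derive => // [|k]; [exact: AV|exact: dA'].
    have d2 := dv' j x Nx.
    exact: is_deriveM.
  have D4 := @is_deriveB _ _ _ _ _ _ _ _ _ D1 D2.
  apply: is_derive_eq (@is_deriveB _ _ _ _ _ _ _ _ _ D4 D3) _.
  (* Differentiating the linear term pairs [v j] with [A' k], while the remainder of [pa j] pairs
     [v k] with [A' j]; symmetry of the second derivatives matches them. *)
  have E : \sum_j v j x * (\sum_k nem (pb j k) A x * A' k x) =
      \sum_j (\sum_k nem (pb j k) A x * v k x) * A' j x.
    under eq_bigr do rewrite mulr_sumr.
    rewrite exchange_big; apply: eq_bigr => k _; rewrite mulr_suml; apply: eq_bigr => j _ /=.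
    by rewrite !nem_in // (partials_sym oV _ _ Ha Hpb (AV _ Nx')) mulrCA mulrA.
  rewrite [\sum_j (_ + v j x * _)]big_split /= E -!sumrB -big_split /= -sumrB.
  by apply: eq_bigr => j _; ring.
rewrite mulrDl; apply: (@crb_le _ _ _ _ _ _ _ _ _ (K * t ^+ 2)) => //.
  by rewrite lerDr mulr_ge0 // exprn_ge0.
have vtm j : crb1 m (v j) t by exact: crb_order (vt j).
rewrite /K mulr_suml; apply: crb_sum => // j.
have [_ L0 LC] := HrL j; have [_ T0 TC] := HqT j.
have tr' : 0 <= t < (rL j).1 by rewrite t0 (lt_le_trans tr).
have tq' : 0 <= t < (qT j).1 by rewrite t0 (lt_le_trans tq).
have -> : (2 ^+ m * ((qT j).2 * M j) + 2 ^+ m * (rL j).2) * t ^+ 2 =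
  2 ^+ m * (((qT j).2 * t ^+ 2) * M j) + 2 ^+ m * ((rL j).2 * t * t) by ring.
apply: crbD; apply: crbM1; rewrite ?mulr_ge0 ?exprn_ge0 //; [exact: TC|exact: LC].
Qed.
End CrSuperposition.

(** * Operators on spaces of C^r families *)

Section CrOperators.
Context {R : realType} {n : nat} (r : nat) (N : set 'rV[R]_n).
Hypotheses (cN : compact N) (sN : star_shaped N) (NI : N `<=` closure N°).
Local Notation crb1 := (crb N (fun _ => 1) 1).
Local Notation S := (Cr r N unit).

(** Families that are not C^r are sent to 0. Operators thus become total functions, and regularity
    is proved where it is used. *)
Definition toCr (J : finType) (f : J -> 'rV[R]_n -> R) : Cr r N J := insubd (0 : Cr r N J) f.

Lemma toCrE (J : finType) (f : J -> 'rV[R]_n -> R) : is_Cr r N f -> toCr f = f :> (J -> _).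
Proof. by move=> fC; rewrite /toCr insubdK //; apply/asboolP. Qed.

Lemma Cr_out (J : finType) (A : Cr r N J) j x : ~ N x -> A j x = 0.
Proof. by have [H _ _ _ _] := Cr_P A j; exact: H. Qed.

Lemma Cr_eq (J : finType) (A B : Cr r N J) : (forall j x, N x -> A j x = B j x) -> A = B.
Proof.
move=> H; apply: val_inj; apply/funext => j; apply/funext => x /=.
by have [Nx|Nx] := pselect (N x); [exact: H|rewrite !Cr_out].
Qed.

Lemma Cr_crb_weight (J : finType) (A : Cr r N J) j (w : 'rV[R]_n -> R) e M : 0 < e ->
  {within N, continuous w} ->
  (forall s x, (size s <= r)%N -> pdom N s x -> e ^+ size s * `|pderiv s (A j) x| <= M * w x) ->
  crb N w e r (A j) M.
Proof. by move=> e0 wc H; apply: is_Cr_crb => // -[]; exact: Cr_P. Qed.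

Lemma Cr_crb (J : finType) (A : Cr r N J) j : crb1 r (A j) `|A|.
Proof.
apply: Cr_crb_weight => // [x|s x sr Nx]; first exact: cst_continuous.
by rewrite expr1n mul1r mulr1; exact: Cr_norm_ge.
Qed.

Lemma crb1_is_Cr f M : crb1 r f M -> is_Cr r N (fun _ : unit => f).
Proof. by apply: crb_is_Cr => //; exists 1 => x _; rewrite ler01 lexx. Qed.

Lemma Cr_norm_crb (J : finType) (A : Cr r N J) M : 0 <= M -> (forall j, crb1 r (A j) M) -> `|A| <= M.
Proof.
move=> M0 H; apply: Cr_norm_le => // j s x sr Nx.
have := crb_pderiv (e := 1) ltr01 _ (H j) sr Nx.
by rewrite expr1n mul1r mulr1; apply => y _; exact: ler01.
Qed.

Lemma toCr_crb (J : finType) (f : J -> 'rV[R]_n -> R) M : 0 <= M ->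
  (forall j, crb1 r (f j) M) -> toCr f = f :> (J -> _) /\ `|toCr f| <= M.
Proof.
move=> M0 H; have E : toCr f = f :> (J -> _).
  by apply: toCrE => j; exact: (crb1_is_Cr (H j) tt).
by split=> //; apply: Cr_norm_crb => // j; rewrite E.
Qed.

Definition crscal (f : 'rV[R]_n -> R) : S := toCr (fun _ => f).

Lemma crscal_crb f M : 0 <= M -> crb1 r f M -> (forall x, crscal f tt x = f x) /\ `|crscal f| <= M.
Proof.
move=> M0 H; have [E Hn] := @toCr_crb unit (fun _ => f) M M0 (fun _ => H).
by split=> // x; rewrite /crscal E.
Qed.

Lemma Cr_addE (J : finType) (A B : Cr r N J) j x : (A + B) j x = A j x + B j x.
Proof. by []. Qed.
Lemma Cr_scaleE (J : finType) a (A : Cr r N J) j x : (a *: A) j x = a * A j x.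
Proof. by []. Qed.
Lemma Cr_subE (J : finType) (A B : Cr r N J) j x : (A - B) j x = A j x - B j x.
Proof. by []. Qed.
Lemma Cr_sumE (J I : finType) (s : seq I) (P : pred I) (A : I -> Cr r N J) j x :
  (\sum_(i <- s | P i) A i) j x = \sum_(i <- s | P i) A i j x.
Proof.
elim: s => [|i s IH]; first by rewrite !big_nil.
by rewrite !big_cons; case: (P i) => //; rewrite -IH.
Qed.

Section Proj.
Variable J : finType.

Definition crproj (j : J) (A : Cr r N J) : S := crscal (A j).

Lemma crprojE j A x : crproj j A tt x = A j x.
Proof. by have [-> _] := crscal_crb (normr_ge0 _) (Cr_crb A j). Qed.

Lemma crproj_blin j : blin (crproj j).
Proof.
split=> [a A B|].
  by apply: Cr_eq => -[] x _; rewrite Cr_addE Cr_scaleE !crprojE.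
by exists 1 => A; rewrite mul1r; have [_] := crscal_crb (normr_ge0 _) (Cr_crb A j).
Qed.

Definition crinj (j : J) (F : S) : Cr r N J := toCr (fun j' => if j' == j then F tt else fun _ => 0).

Lemma crinj_crb (j : J) (F : S) (j' : J) : crb1 r (if j' == j then F tt else fun _ => 0) `|F|.
Proof. by case: (j' == j); [exact: Cr_crb|exact: crb0]. Qed.

Lemma crinjE (j : J) F (j' : J) x : crinj j F j' x = if j' == j then F tt x else 0.
Proof. by rewrite /crinj; have [-> _] := toCr_crb (normr_ge0 _) (crinj_crb j F); case: (j' == j). Qed.

Lemma crinj_blin j : blin (crinj j).
Proof.
split=> [a A B|].
  apply: Cr_eq => j' x _; rewrite Cr_addE Cr_scaleE !crinjE.
  by case: (j' == j) => //; rewrite mulr0 addr0.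
by exists 1 => F; rewrite mul1r; have [_] := toCr_crb (normr_ge0 _) (crinj_crb j F).
Qed.
End Proj.

Definition crmul (F G : S) : S := crscal (fun x => F tt x * G tt x).

Lemma crmul_crb (F G : S) : crb1 r (fun x => F tt x * G tt x) (2 ^+ r * (`|F| * `|G|)).
Proof. by apply: crbM1 => //; exact: Cr_crb. Qed.

Lemma crmulE F G x : crmul F G tt x = F tt x * G tt x.
Proof.
have M0 : 0 <= 2 ^+ r * (`|F| * `|G|) by rewrite mulr_ge0 ?exprn_ge0 ?mulr_ge0.
by have [-> _] := crscal_crb M0 (crmul_crb F G).
Qed.

Lemma crmul_bbilin : bbilin crmul.
Proof.
split=> [F a G H|F a G H|].
- by apply: Cr_eq => -[] x _; rewrite Cr_addE Cr_scaleE !crmulE Cr_addE Cr_scaleE; ring.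
- by apply: Cr_eq => -[] x _; rewrite Cr_addE Cr_scaleE !crmulE Cr_addE Cr_scaleE; ring.
exists (2 ^+ r) => F G.
have M0 : 0 <= 2 ^+ r * (`|F| * `|G|) by rewrite mulr_ge0 ?exprn_ge0 ?mulr_ge0.
by rewrite -mulrA; have [_] := crscal_crb M0 (crmul_crb F G).
Qed.

Definition crcst (c : R) : S := crscal (fun x => if `[< N x >] then c else 0).

Lemma crcstE c x : N x -> crcst c tt x = c.
Proof.
move=> Nx; have [E _] := crscal_crb (normr_ge0 c) (@crb_cst _ _ N r c).
by rewrite /crcst E asboolT.
Qed.

Definition crmom (k : 'I_n) (q : nat) (F : S) : S := crscal (fun x => x 0 k * radial N q (F tt) x).

Lemma Cr_within (J : finType) (A : Cr r N J) j : {within N, continuous (A j)}.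
Proof. by have [_ H _ _ _] := Cr_P A j. Qed.

Lemma norm_bounded : exists2 K : R, 0 <= K & forall x, N x -> `|x| <= K.
Proof.
have [K [_ HK]] := compact_bounded cN; exists (`|K| + 1) => [|x Nx]; first exact: addr_ge0.
by apply: HK => //; rewrite ltr_pwDr // ler_norm.
Qed.

(** [crb_moment] with the trivial weight 1 and e = 1, where [eta] is a bound for [|x|] on [N]. *)
Lemma crmom_crb : exists2 K : R, 0 <= K & forall k q (F : S) ,
  crb1 r (fun x => x 0 k * radial N q (F tt) x) (K * `|F|).
Proof.
have [K K0 HK] := norm_bounded.
exists (r.+1%:R * (1 + K)) => [|k q F]; first by rewrite mulr_ge0 // addr_ge0.
rewrite mulrAC; apply: (@crb_moment R n N cN sN (fun _ => 1) 1 K) => //.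
- by move=> x; exact: cst_continuous.
- by exists 1.
- by move=> x j Nx; rewrite int01_cst mulr1 mulr1; apply: le_trans (coord_norm_le _ _) (HK x Nx).
- exact: Cr_crb.
Qed.

Lemma crmomE k q F x : crmom k q F tt x = x 0 k * radial N q (F tt) x.
Proof.
have [K K0 /(_ k q F) H] := crmom_crb.
by have [-> _] := crscal_crb (mulr_ge0 K0 (normr_ge0 F)) H.
Qed.

Lemma radialD q a (f g : 'rV[R]_n -> R) x : {within N, continuous f} -> {within N, continuous g} ->
  N x -> radial N q (fun y => a * f y + g y) x = a * radial N q f x + radial N q g x.
Proof.
move=> fc gc Nx; rewrite /radial !asboolT //.
have c1 := radial_cts cN sN (q := q) fc Nx; have c2 := radial_cts cN sN (q := q) gc Nx.
rewrite -int01Z // -int01D //; first by apply: eq_int01 => t _; ring.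
by move/subspace_continuousP: c1 => c1; apply/subspace_continuousP => t t01; exact: (cvgM (cvg_cst a) (c1 t t01)).
Qed.

Lemma crmom_blin k q : blin (crmom k q).
Proof.
split=> [a F G|].
  apply: Cr_eq => -[] x Nx; rewrite Cr_addE Cr_scaleE !crmomE.
  have -> : (a *: F + G) tt = (fun y => a * F tt y + G tt y) by [].
  by rewrite radialD //; [ring|exact: Cr_within|exact: Cr_within].
have [K K0 H] := crmom_crb; exists K => F.
by have [_] := crscal_crb (mulr_ge0 K0 (normr_ge0 F)) (H k q F).
Qed.

End CrOperators.

(** * Superposition on the Banach spaces, and realizable operations *)

Section Nemytskii.
Context {R : realType} {n d : nat} (r : nat) (N : set 'rV[R]_n).
Hypotheses (cN : compact N) (sN : star_shaped N) (NI : N `<=` closure N°).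
Variables (J : finType) (V : set 'rV[R]_d) (sigma : 'I_d -> J).
Hypothesis oV : open V.
Local Notation crb1 := (crb N (fun _ => 1) 1).
Local Notation E := (Cr r N J).
Local Notation S := (Cr r N unit).
Local Notation sub A := (fun i : 'I_d => (A : E) (sigma i)).

(** An abstract [OmegaU]: [sigma] selects the components that make up the 0-form part with values in
    W^0. *)
Definition dom : set E := [set A | forall x, N x -> V (\row_i A (sigma i) x)].

Lemma smooth_on_cst (c : R) : smooth_on V (fun _ => c).
Proof.
exists (fun _ s => if s is [::] then c else 0) => x Vx; split=> //.
- by move=> s1 s2 a u v; case: s1; rewrite /= ?scaler0 addr0.
- case=> [|k]; first by exists `|c| => s /size0nil ->; rewrite big_nil mulr1.
  by exists 0 => -[//|h s] _; rewrite normr0 mul0r.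
move=> k e e0; apply: filterE => h s _.
have P0 : 0 <= \prod_(v <- s) `|v| by apply: prodr_ge0 => ? _; exact: normr_ge0.
by rewrite /= !subrr normr0 !mulr_ge0 // ltW.
Qed.

Lemma nem_lip a A : smooth_on V a -> dom A ->
  exists2 s : R, 0 < s & exists2 C, 0 <= C & forall v : E, `|v| < s ->
    dom (A + v) /\ crb1 r (fun x => nem N a (sub (A + v)) x - nem N a (sub A) x) (C * `|v|).
Proof.
move=> Sa AV.
have [s s0 [C C0 H]] := crb1_nem_lip cN oV (M := fun=> `|A|) Sa (fun=> normr_ge0 A)
   (fun i => Cr_crb NI A (sigma i)) AV.
exists s => //; exists C => // v vs.
have tv : 0 <= `|v| < s by rewrite normr_ge0.
exact: (H `|v| (sub v) tv (fun i => Cr_crb NI v (sigma i))).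
Qed.

(** The constant function 0 is smooth on [V], and the first conclusion of [nem_lip] for it is a
    uniform neighbourhood inside the domain; this rests on the compact image of [N]. *)
Lemma dom_open : open dom.
Proof.
rewrite openE => A AV; have [s s0 [C C0 H]] := nem_lip (smooth_on_cst 0) AV.
suff : \forall B \near A, dom B by [].
by apply/near_normP; exists s => // v /H[].
Qed.

Definition nemS a (A : E) : S := crscal r N (nem N a (sub A)).

Lemma nemS_crb a A : smooth_on V a -> dom A ->
  exists2 M, 0 <= M & crb1 r (nem N a (sub A)) M.
Proof.
move=> Sa AV; exact: (crb1_nem cN oV (M := fun=> `|A|) Sa (fun=> normr_ge0 A)
   (fun i => Cr_crb NI A (sigma i)) AV).
Qed.

Lemma nemSE a A x : smooth_on V a -> dom A -> nemS a A tt x = nem N a (sub A) x.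
Proof. by move=> Sa AV; have [M M0 H] := nemS_crb Sa AV; have [-> _] := crscal_crb M0 H. Qed.

Lemma blin_sum (E1 F1 : normedModType R) (I : Type) (s : seq I) (L : I -> E1 -> F1) :
  (forall i, blin (L i)) -> blin (fun v => \sum_(i <- s) L i v).
Proof.
move=> bL; elim: s => [|i s [IHl [M HM]]].
  rewrite (_ : (fun _ => _) = fun _ => 0); first exact: blin0.
  by apply/funext => v; rewrite big_nil.
have [Ll [M' HM']] := bL i; split.
  by move=> a u v; rewrite !big_cons Ll IHl scalerDr; zmod.
exists (M' + M) => v; rewrite big_cons mulrDl; apply: le_trans (ler_normD _ _) _.
exact: lerD.
Qed.

Lemma bbilin_blin (E1 F1 G1 : normedModType R) (B : E1 -> F1 -> G1) c : bbilin B -> blin (B c).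
Proof.
move=> [Br _ [M HM]]; split; first exact: Br.
by exists (M * `|c|) => v; exact: HM.
Qed.

Lemma nemS_diff a pa A : has_partials V a pa -> dom A ->
  differentiable (nemS a) A /\
  'd (nemS a) A = (fun v => \sum_i crmul (nemS (pa i) A) (crproj (sigma i) v)) :> (E -> S).
Proof.
move=> Ha AV; have [Sa Spa _] := Ha.
have [Llin Lbd] : blin (fun v => \sum_i crmul (nemS (pa i) A) (crproj (sigma i) v)).
  apply: blin_sum => i.
  exact: (blin_comp (crproj_blin r NI (sigma i)) (bbilin_blin (nemS (pa i) A) (crmul_bbilin r NI))).
apply: frechet_diff => // e e0.
have [s s0 [C C0 H]] := nem_lip Sa AV.
have [s' s'0 [C' C'0 HT]] := crb1_nem_taylor cN oV (M := fun=> `|A|) Ha (fun=> normr_ge0 A)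
   (fun i => Cr_crb NI A (sigma i)) AV.
have C1 : 0 < C' + 1 by rewrite ltr_wpDl.
exists (Num.min (Num.min s s') (e / (C' + 1))); first by rewrite !lt_min s0 s'0 divr_gt0.
move=> v; rewrite !lt_min ltr_pdivlMr // => /andP[/andP[vs vs'] ve].
have [AvV _] := H v vs.
have tv : 0 <= `|v| < s' by rewrite normr_ge0.
have T := HT `|v| (sub v) tv (fun i => Cr_crb NI v (sigma i)).
apply: (@le_trans _ _ (C' * `|v| ^+ 2)); last first.
  rewrite expr2 mulrA; apply: ler_wpM2r => //; apply: le_trans (ltW ve).
  by rewrite mulrC; apply: ler_wpM2l; rewrite ?lerDl.
apply: Cr_norm_crb; first by rewrite mulr_ge0 // exprn_ge0.
case; rewrite (_ : (_ : S) tt = fun x => nem N a (addf (sub A) (sub v)) x - nem N a (sub A) x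
    - \sum_i nem N (pa i) (sub A) x * v (sigma i) x).
  exact: T.
apply/funext => x; rewrite !Cr_subE !nemSE //; congr (_ - _).
rewrite Cr_sumE; apply: eq_bigr => i _.
by rewrite crmulE // nemSE // crprojE.
Qed.

(** The tangent map is a sum of products of operators [nemS (pa i)] with linear projections, so the
    induction runs over all smooth [a] simultaneously. *)
Lemma nemS_Sm k a : smooth_on V a -> Sm k dom (nemS a).
Proof.
elim: k a => [//|k IH] a Sa; have [pa Ha] := has_partials_ex oV Sa; have [_ Spa _] := Ha.
split; first by move=> A /(nemS_diff Ha)[].
have oT := openTangent dom_open.
apply: (@Sm_congr _ k _ _ _ (fun p : E * E => \sum_i crmul (nemS (pa i) p.1) (crproj (sigma i) p.2))) => //.
  by move=> p [/(nemS_diff Ha)[_ E'] _]; exact: (esym (congr1 (@^~ p.2) E')).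
apply: Sm_sum => // i _; apply: Sm_bilin => //; first exact: crmul_bbilin.
  by apply: Sm_tangent_pre; [exact: dom_open|exact: IH].
apply: Sm_sub (@subsetT _ _) (Sm_blin k _).
exact: (blin_comp (blin_snd E E) (crproj_blin r NI (sigma i))).
Qed.

(* The third clause says that the derivative of [th] involves no derivatives of its
   argument [v]; this is what makes it small after composition with the homotopy
   operator, in norms with a steep weight. *)
Definition realizes (Th : E -> 'rV[R]_n -> R) (th : E -> S) :=
  [/\ forall A x, dom A -> N x -> th A tt x = Th A x,
      Smooth dom th,
      forall A, dom A -> exists c : J -> S, forall v x, N x ->
        ('d th A v) tt x = \sum_j c j tt x * v j x &
      forall A B, dom A -> dom B -> exists2 L, 0 <= L & forall x, N x ->
        `|Th A x - Th B x| <= L * \sum_j `|A j x - B j x| ].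

(** These pointwise operations are closed under sums, products and superposition, enough to reach
    every coefficient of C_Q(A). *)
Definition realizable Th := exists th, realizes Th th.

Lemma sum_dist_ge0 (A B : E) x : 0 <= \sum_j `|A j x - B j x|.
Proof. by apply: sumr_ge0. Qed.

Lemma realizable_eq Th Th' : (forall A x, dom A -> N x -> Th A x = Th' A x) ->
  realizable Th -> realizable Th'.
Proof.
move=> H [th [h1 h2 h3 h4]]; exists th; split=> //.
  by move=> A x OA Nx; rewrite h1 // H.
move=> A B OA OB; have [L L0 HL] := h4 A B OA OB; exists L => // x Nx.
by rewrite -!H //; exact: HL.
Qed.

Lemma realizable_cst c : realizable (fun _ _ => c).
Proof.
exists (fun _ => crcst r N c); split.
- by move=> A x _ Nx; rewrite crcstE.
- by move=> k; apply: Sm_cst; exact: dom_open.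
- move=> A _; exists (fun _ => 0) => v x Nx; rewrite (diff_cst (crcst r N c) A) big1 // => j _.
  exact: mul0r.
- by move=> A B _ _; exists 0 => // x _; rewrite subrr normr0 mul0r.
Qed.

Lemma realizable_proj j : realizable (fun A x => A j x).
Proof.
exists (crproj j); split.
- by move=> A x _ _; rewrite crprojE.
- by move=> k; apply: Sm_sub (@subsetT _ _) (Sm_blin k (crproj_blin r NI j)).
- move=> A _; exists (fun i => crcst r N (i == j)%:R) => v x Nx.
  have [_ ->] := blin_diff A (crproj_blin r NI j); rewrite crprojE //.
  rewrite (bigD1 j) //= crcstE // eqxx mul1r big1 ?addr0 // => i /negbTE ij.
  by rewrite crcstE // ij mul0r.
- move=> A B _ _; exists 1 => // x _; rewrite mul1r (bigD1 j) //= lerDl.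
  exact: sumr_ge0.
Qed.

Lemma realizableD Th1 Th2 : realizable Th1 -> realizable Th2 ->
  realizable (fun A x => Th1 A x + Th2 A x).
Proof.
move=> [t1 [a1 b1 c1 d1]] [t2 [a2 b2 c2 d2]]; exists (fun A => t1 A + t2 A); split.
- by move=> A x OA Nx; rewrite Cr_addE a1 // a2.
- by move=> k; apply: SmD => //; exact: dom_open.
- move=> A OA; have [k1 H1] := c1 A OA; have [k2 H2] := c2 A OA.
  exists (fun j => k1 j + k2 j) => v x Nx.
  have df1 := Smooth_diff b1 OA; have df2 := Smooth_diff b2 OA.
  apply: etrans (congr1 (fun F : S => F tt x) (congr1 (@^~ v) (diffD df1 df2))) _.
  apply: etrans (Cr_addE ('d t1 A v) ('d t2 A v) tt x) _.
  apply: etrans (congr2 (fun p q : R => p + q) (H1 v x Nx) (H2 v x Nx)) _.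
  rewrite -big_split.
  by apply: eq_bigr => j _; rewrite Cr_addE mulrDl.
- move=> A B OA OB; have [L1 L10 H1] := d1 A B OA OB; have [L2 L20 H2] := d2 A B OA OB.
  exists (L1 + L2) => [|x Nx]; first exact: addr_ge0.
  rewrite (_ : _ - _ = (Th1 A x - Th1 B x) + (Th2 A x - Th2 B x)); last by ring.
  by rewrite mulrDl; apply: le_trans (ler_normD _ _) _; apply: lerD; [exact: H1|exact: H2].
Qed.

Lemma realizableM Th1 Th2 : realizable Th1 -> realizable Th2 ->
  realizable (fun A x => Th1 A x * Th2 A x).
Proof.
move=> [t1 [a1 b1 c1 d1]] [t2 [a2 b2 c2 d2]]; exists (fun A => crmul (t1 A) (t2 A)); split.
- by move=> A x OA Nx; rewrite crmulE // a1 // a2.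
- by move=> k; apply: Sm_bilin => //; [exact: crmul_bbilin|exact: dom_open].
- move=> A OA; have [k1 H1] := c1 A OA; have [k2 H2] := c2 A OA.
  exists (fun j => crmul (k1 j) (t2 A) + crmul (t1 A) (k2 j)) => v x Nx.
  have df1 := Smooth_diff b1 OA; have df2 := Smooth_diff b2 OA.
  have [_ dE] := bbilin_diff (crmul_bbilin r NI) df1 df2.
  apply: etrans (congr1 (fun F : S => F tt x) (congr1 (@^~ v) dE)) _.
  apply: etrans (Cr_addE (crmul ('d t1 A v) (t2 A)) (crmul (t1 A) ('d t2 A v)) tt x) _.
  apply: etrans (congr2 (fun p q : R => p + q) (crmulE NI _ _ x) (crmulE NI _ _ x)) _.
  apply: etrans (congr2 (fun p q : R => p * t2 A tt x + t1 A tt x * q) (H1 v x Nx) (H2 v x Nx)) _.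
  rewrite mulr_suml mulr_sumr -big_split.
  by apply: eq_bigr => j _; rewrite Cr_addE !(crmulE NI) /=; ring.
- move=> A B OA OB; have [L1 L10 H1] := d1 A B OA OB; have [L2 L20 H2] := d2 A B OA OB.
  exists (L1 * `|t2 A| + `|t1 B| * L2) => [|x Nx]; first by rewrite addr_ge0 // mulr_ge0.
  rewrite (_ : _ - _ = (Th1 A x - Th1 B x) * Th2 A x + Th1 B x * (Th2 A x - Th2 B x)); last by ring.
  rewrite [leRHS]mulrDl; apply: le_trans (ler_normD _ _) _; apply: lerD; rewrite normrM.
    rewrite mulrAC; apply: ler_pM => //; first exact: H1.
    by rewrite -a2 //; exact: crb1_abs (Cr_crb NI _ tt) Nx.
  rewrite -mulrA; apply: ler_pM => //; last exact: H2.
  by rewrite -a1 //; exact: crb1_abs (Cr_crb NI _ tt) Nx.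
Qed.

Lemma realizable_sum (I : Type) (s : seq I) (P : pred I) Th : (forall i, P i -> realizable (Th i)) ->
  realizable (fun A x => \sum_(i <- s | P i) Th i A x).
Proof.
move=> H; elim: s => [|i s IH].
  by apply: realizable_eq (realizable_cst 0) => A x _ _; rewrite big_nil.
case Pi : (P i).
  by apply: realizable_eq (realizableD (H i Pi) IH) => A x _ _; rewrite big_cons Pi.
by apply: realizable_eq IH => A x _ _; rewrite big_cons Pi.
Qed.

Lemma realizable_nem a : smooth_on V a -> realizable (fun A x => a (\row_i A (sigma i) x)).
Proof.
move=> Sa; have [pa Ha] := has_partials_ex oV Sa; have [_ Spa _] := Ha.
exists (nemS a); split.
- by move=> A x OA Nx; rewrite nemSE // nem_in.
- by move=> k; exact: nemS_Sm.
- move=> A OA; have [_ dE] := nemS_diff Ha OA.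
  exists (fun j => \sum_(i | sigma i == j) nemS (pa i) A) => v x Nx.
  apply: etrans (congr1 (fun F : S => F tt x) (congr1 (@^~ v) dE)) _.
  rewrite Cr_sumE (partition_big sigma xpredT) //=.
  apply: eq_bigr => j _; rewrite Cr_sumE mulr_suml.
  by apply: eq_bigr => i /eqP <-; rewrite (crmulE NI) (crprojE NI).
move=> A B OA OB.
have Ac (C : E) i : {within N, continuous (C (sigma i))} by exact: Cr_within.
have cA := compact_row cN (Ac A); have cB := compact_row cN (Ac B).
set KA := _ @` N in cA; set KB := _ @` N in cB.
have KV : KA `|` KB `<=` V.
  by move=> _ [[x Nx <-]|[x Nx <-]]; [exact: OA|exact: OB].
have [s s0 [C C0 H]] := compact_partials (compactU cA cB) KV Ha.
exists (C + 2 * C / s) => [|x Nx]; first by rewrite addr_ge0 // divr_ge0 ?mulr_ge0 // ltW.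
set u := \row_i A _ x; set v := \row_i B _ x.
have D0 := sum_dist_ge0 A B x.
have uv : `|u - v| <= \sum_j `|A j x - B j x|.
  apply: row_norm_le => // i; rewrite !mxE (bigD1 (sigma i)) //= lerDl.
  exact: sumr_ge0.
have Ku : (KA `|` KB) u by left; exists x.
have Kv : (KA `|` KB) v by right; exists x.
have n0 : `|(0 : 'rV[R]_d)| < s by rewrite normr0.
(* [V] need not be convex, so no segment joins [u] and [v]. Close values are compared by the local
   Lipschitz bound; for the others the crude bound 2 C is at most (2 C / s) times their distance. *)
have [uvs|uvs] := ltP `|u - v| s.
  have [_ _ L _] := H v (u - v) Kv uvs; rewrite subrKC in L.
  apply: le_trans L _; apply: ler_pM => //.
  by rewrite lerDl divr_ge0 ?mulr_ge0 // ltW.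
have [_ au _ _] := H u 0 Ku n0; have [_ av _ _] := H v 0 Kv n0.
apply: le_trans (ler_normB _ _) _; apply: le_trans (lerD au av) _.
have -> : C + C = 2 * C / s * s by rewrite divfK ?gt_eqF //; ring.
have Cs0 : 0 <= 2 * C / s by rewrite divr_ge0 ?mulr_ge0 // ltW.
apply: ler_pM => //; [exact: ltW|by rewrite lerDr|exact: le_trans uvs uv].
Qed.

End Nemytskii.

(** * Volterra operators *)

Section ExpWeight.
Context {R : realType} {n : nat}.

Definition expw (lam : R) (x : 'rV[R]_n) : R := expR (lam * `|x|).

Variable lam : R.
Hypothesis lam0 : 0 < lam.

Lemma expw_ge1 x : 1 <= expw lam x.
Proof. by rewrite -expR0 ler_expR mulr_ge0 // ltW. Qed.

Lemma expw_mono (x : 'rV[R]_n) (t : R) : 0 <= t <= 1 -> expw lam (t *: x) <= expw lam x.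
Proof.
move=> /andP[t0 t1]; rewrite ler_expR; apply: ler_wpM2l; first exact: ltW.
by rewrite normrZ ger0_norm //; exact: ler_piMl.
Qed.

Lemma expw_cts : continuous (expw lam).
Proof.
move=> x; apply: continuous_comp; last exact: continuous_expR.
exact: (cvgM (cvg_cst lam) (@norm_continuous _ _ x)).
Qed.

(** The left side equals exp(c) - 1. *)
Lemma int01_expR (c : R) : 0 <= c -> c * int01 (fun t => expR (c * t)) <= expR c.
Proof.
move=> c0; have dF (t : R) : is_derive t 1 (fun t : R => expR (c * t)) (c * expR (c * t)).
  have -> : c * expR (c * t) = expR (c * t) * (c *: 1) by rewrite mulrC [c *: 1]mulr1.
  exact: is_derive1_comp.
have cF : cts01 (fun t : R => expR (c * t)).
  by apply: derivable_within_continuous => t _; have [] := dF t.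
have Fc (t : R) : {for t, continuous (fun t : R => expR (c * t))}.
  by apply/differentiable_continuous/derivable1_diffP; have [] := dF t.
have cf : cts01 (fun t : R => c * expR (c * t)).
  move/subspace_continuousP: cF => cF.
  by apply/subspace_continuousP => t t01; exact: (cvgM (cvg_cst c) (cF t t01)).
rewrite -int01Z //; have := @continuous_FTC2 R _ (fun t : R => expR (c * t)) 0 1 ltr01 cf.
move=> /(_ _ _)H; rewrite /int01 /Rintegral H.
- by rewrite /= mulr0 expR0 mulr1 gerBl.
- split.
  + by move=> t _; have [] := dF t.
  + by apply: cvg_at_right_filter; exact: Fc.
  + by apply: cvg_at_left_filter; exact: Fc.
- by move=> t _; rewrite derive1E; have := dF t => D; rewrite derive_val.
Qed.

Lemma expw_int (x : 'rV[R]_n) (k : 'I_n) : `|x 0 k| * int01 (fun t => expw lam (t *: x)) <= lam^-1 * expw lam x.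
Proof.
rewrite ler_pdivlMl //; set I := int01 _.
have I0 : 0 <= I by apply: Rintegral_ge0 => t _; exact: expR_ge0.
apply: (@le_trans _ _ (lam * (`|x| * I))).
  by apply: ler_wpM2l; [exact: ltW|apply: ler_wpM2r => //; exact: coord_norm_le].
rewrite mulrA /I (_ : int01 _ = int01 (fun t => expR (lam * `|x| * t))).
  by apply: int01_expR; rewrite mulr_ge0 // ltW.
apply: eq_int01 => t /andP[t0 _]; rewrite /expw normrZ ger0_norm //.
by congr expR; ring.
Qed.

End ExpWeight.

Section WeightedNorm.
Context {R : realType} {n : nat} (r : nat) (N : set 'rV[R]_n).
Hypothesis NI : N `<=` closure N°.
Variables (J : finType) (w : 'rV[R]_n -> R) (e : R).
Hypotheses (e0 : 0 < e) (e1 : e <= 1) (wc : {within N, continuous w}).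
Hypotheses (w1 : forall x, N x -> 1 <= w x) (wb : exists W, forall x, N x -> w x <= W).
Local Notation E := (Cr r N J).

(** The norm is an infimum of admissible constants, itself admissible; it is therefore the least
    constant in [crb], and estimates pass directly between the two. *)
Definition wbounds (v : E) : set R := [set M | 0 <= M /\
  forall j s x, (size s <= r)%N -> pdom N s x -> e ^+ size s * `|pderiv s (v j) x| <= M * w x].

Definition wnorm (v : E) : R := inf (wbounds v).

Let pdom_in s x : pdom N s x -> N x.
Proof. by case: s => // i s /interior_subset. Qed.

Let w_gt0 x : N x -> 0 < w x.
Proof. by move=> /w1; exact: lt_le_trans. Qed.

Lemma wbounds_norm v : wbounds v `|v|.
Proof.
split=> // j s x sr Nx; have Nx' := pdom_in Nx.
apply: (@le_trans _ _ (1 * `|v|)).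
  apply: ler_pM => //; first by rewrite exprn_ge0 // ltW.
    by apply: exprn_ile1 => //; exact: ltW.
  exact: Cr_norm_ge.
by rewrite mul1r; apply: ler_peMr => //; exact: w1.
Qed.

Lemma wnorm_le v M : wbounds v M -> wnorm v <= M.
Proof. by move=> H; apply: ge_inf => //; exists 0 => y []. Qed.

Lemma wbounds_wnorm v : wbounds v (wnorm v).
Proof.
have ne : wbounds v !=set0 by exists `|v|; exact: wbounds_norm.
split; first by apply: lb_le_inf => // y [].
move=> j s x sr Nx; have Nx' := pdom_in Nx.
rewrite -ler_pdivrMr ?w_gt0 //; apply: lb_le_inf => // M [_ H].
by rewrite ler_pdivrMr ?w_gt0 //; exact: H.
Qed.

Lemma wnorm_equiv : equiv_norm wnorm.
Proof.
have wZ a v : wnorm (a *: v) <= `|a| * wnorm v.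
  apply: wnorm_le; have [M0 H] := wbounds_wnorm v; split; first exact: mulr_ge0.
  move=> j s x sr Nx; rewrite Cr_pderivZ // normrM mulrCA -mulrA.
  by apply: ler_wpM2l => //; exact: H.
have [W HW] := wb.
split; first split.
- move=> u v; apply: wnorm_le; have [M0 H] := wbounds_wnorm u; have [M0' H'] := wbounds_wnorm v.
  split; first exact: addr_ge0.
  move=> j s x sr Nx; rewrite Cr_pderivD // mulrDl.
  apply: le_trans (ler_wpM2l _ (ler_normD _ _)) _; first by rewrite exprn_ge0 // ltW.
  by rewrite mulrDr; apply: lerD; [exact: H|exact: H'].
- move=> a v; apply/eqP; rewrite eq_le wZ /=; have [->|a0] := eqVneq a 0.
    by rewrite normr0 mul0r; have [] := wbounds_wnorm (0 *: v).
  rewrite -ler_pdivlMl ?normr_gt0 // -normfV; apply: le_trans (wZ _ _).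
  by rewrite scalerA mulVf // scale1r.
- by exists 1 => // v; rewrite mul1r; apply: wnorm_le; exact: wbounds_norm.
have er : 0 < (e ^+ r)^-1 by rewrite invr_gt0 exprn_gt0.
exists ((e ^+ r)^-1 * (`|W| + 1)); first by rewrite mulr_gt0 // ltr_wpDl.
move=> v; have [M0 H] := wbounds_wnorm v.
apply: Cr_norm_le; first by rewrite !mulr_ge0 ?addr_ge0 // ltW.
move=> j s x sr Nx; have Nx' := pdom_in Nx.
rewrite -mulrA ler_pdivlMl ?exprn_gt0 //.
apply: (@le_trans _ _ (e ^+ size s * `|pderiv s (v j) x|)).
  by apply: ler_wpM2r => //; apply: ler_wiXn2l => //; exact: ltW.
apply: le_trans (H j s x sr Nx) _; rewrite mulrC; apply: ler_wpM2r => //.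
apply: le_trans (HW x Nx') _; apply: le_trans (ler_norm W) _.
by rewrite lerDl.
Qed.

Lemma wnorm_crb (v : E) j : crb N w e r (v j) (wnorm v).
Proof.
have [_ H] := wbounds_wnorm v.
by apply: Cr_crb_weight => // s x; exact: H.
Qed.

Lemma wnorm_crb_le (v : E) M : 0 <= M -> (forall j, crb N w e r (v j) M) -> wnorm v <= M.
Proof.
move=> M0 H; apply: wnorm_le; split=> // j s x sr Nx.
by apply: crb_pderiv (H j) _ _ sr Nx => // y /w_gt0/ltW.
Qed.

End WeightedNorm.

(** * The Volterra operator: smoothness, contraction, injectivity *)

Section Volterra.
Context {R : realType} {n d : nat} (r : nat) (N : set 'rV[R]_n).
Hypotheses (cN : compact N) (sN : star_shaped N) (NI : N `<=` closure N°).
Variables (J : finType) (V : set 'rV[R]_d) (sigma : 'I_d -> J).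
Hypothesis oV : open V.
Local Notation E := (Cr r N J).
Local Notation S := (Cr r N unit).
Local Notation dom := (@dom R n d r N J V sigma).
Variables (Th : J -> 'I_n -> E -> 'rV[R]_n -> R) (th : J -> 'I_n -> E -> S).
Variables (b : J -> 'I_n -> R) (q : J -> nat).
Hypothesis thP : forall j k, realizes V sigma (Th j k) (th j k).

Definition vlin j k (F : S) : E := crinj j (b j k *: crmom k (q j) F).

Lemma vlin_blin j k : blin (vlin j k).
Proof.
have bZ : blin (fun F : S => b j k *: F).
  split=> [a F G|]; first by rewrite scalerDr !scalerA mulrC.
  by exists `|b j k| => F; rewrite normrZ.
exact: (blin_comp (blin_comp (crmom_blin r cN sN NI k (q j)) bZ) (crinj_blin r NI j)).
Qed.

Lemma vlin_sumE (u : J -> 'I_n -> S) j x :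
  (\sum_j \sum_k vlin j k (u j k)) j x =
  \sum_k b j k * (x 0 k * radial N (q j) (u j k tt) x).
Proof.
have E1 j' k : vlin j' k (u j' k) j x =
    if j' == j then b j k * (x 0 k * radial N (q j) (u j k tt) x) else 0.
  rewrite /vlin (crinjE NI) eq_sym; have [->|//] := eqVneq j' j.
  by rewrite Cr_scaleE (crmomE cN sN NI).
have E2 j' : (\sum_k vlin j' k (u j' k)) j x =
    if j' == j then \sum_k b j k * (x 0 k * radial N (q j) (u j k tt) x) else 0.
  rewrite Cr_sumE; under eq_bigr do rewrite E1.
  by case: (j' == j) => //; rewrite big1.
by rewrite Cr_sumE (eq_bigr _ (fun j' _ => E2 j')) -big_mkcond big_pred1_eq.
Qed.

(** For the homotopy operator, [b j k] will be the sign of the contraction, [q j] the form degree of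
    the component [j], and [th j k] a coefficient of C_Q. *)
Definition volterra (A : E) : E := \sum_j \sum_k vlin j k (th j k A).

Lemma volterraE A j x :
  volterra A j x = \sum_k b j k * (x 0 k * radial N (q j) (th j k A tt) x).
Proof. exact: vlin_sumE. Qed.

Lemma volterra_smooth : Smooth dom volterra.
Proof.
have oD : open dom by exact: dom_open.
move=> m; apply: (@Sm_sum _ m E E J _ _ dom (fun j A => \sum_k vlin j k (th j k A)) oD) => j _.
apply: (@Sm_sum _ m E E 'I_n _ _ dom (fun k A => vlin j k (th j k A)) oD) => k _.
by have [_ St _ _] := thP j k; exact: (Sm_post oD (vlin_blin j k) (St m)).
Qed.

Lemma diff_bigsum (E1 F1 : normedModType R) (I : Type) (s : seq I) (f : I -> E1 -> F1) x :
  (forall i, differentiable (f i) x) ->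
  differentiable (fun y => \sum_(i <- s) f i y) x /\
  'd (fun y => \sum_(i <- s) f i y) x = (fun v => \sum_(i <- s) 'd (f i) x v) :> (E1 -> F1).
Proof.
move=> df; elim: s => [|i s [IHd IHE]].
  have -> : (fun y => \sum_(i <- [::]) f i y) = cst 0 by apply/funext => y; rewrite big_nil.
  split; first exact: differentiable_cst.
  by rewrite diff_cst; apply/funext => v; rewrite big_nil.
have -> : (fun y => \sum_(i <- i :: s) f i y) = f i + (fun y => \sum_(i <- s) f i y).
  by apply/funext => y; rewrite big_cons.
split; first exact: differentiableD.
apply: etrans (diffD (df i) IHd) _; apply/funext => v; rewrite big_cons.
exact: (congr1 (fun z => 'd (f i) x v + z) (congr1 (@^~ v) IHE)).
Qed.

Lemma volterra_diff A v : dom A ->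
  'd volterra A v = \sum_j \sum_k vlin j k ('d (th j k) A v).
Proof.
move=> OA.
have dt j k : differentiable (th j k) A by have [_ St _ _] := thP j k; exact: Smooth_diff St OA.
have dv j k : differentiable (vlin j k \o th j k) A /\
    'd (vlin j k \o th j k) A = vlin j k \o 'd (th j k) A :> (E -> E).
  have [dl lE] := blin_diff (th j k A) (vlin_blin j k).
  split; first exact: (differentiable_comp (dt j k) dl).
  exact: etrans (diff_comp (dt j k) dl) (congr1 (fun g : S -> E => g \o 'd (th j k) A) lE).
have ds j := @diff_bigsum _ _ _ (index_enum 'I_n) (fun k => vlin j k \o th j k) A (fun k => proj1 (dv j k)).
have [_ dE] := @diff_bigsum _ _ _ (index_enum J) _ A (fun j => proj1 (ds j)).
apply: etrans (congr1 (@^~ v) dE) _; apply: eq_bigr => j _.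
apply: etrans (congr1 (@^~ v) (proj2 (ds j))) _; apply: eq_bigr => k _.
exact: (congr1 (@^~ v) (proj2 (dv j k))).
Qed.

Lemma expw_le lam : 0 < lam -> exists W, forall x, N x -> expw lam x <= W.
Proof.
move=> l0; have [K K0 HK] := norm_bounded cN; exists (expR (lam * K)) => x Nx.
by rewrite ler_expR; apply: ler_wpM2l; [exact: ltW|exact: HK].
Qed.

Lemma expw_within lam : {within N, continuous (expw lam)}.
Proof. by apply: continuous_subspaceT; exact: expw_cts. Qed.

Lemma volterra_contraction A : dom A -> exists p c, [/\ equiv_norm p, 0 <= c < 1 &
  forall v, p ('d volterra A v) <= c * p v].
Proof.
move=> OA; have /choice[c cP] : forall jk : J * 'I_n, exists c : J -> S, forall v x, N x ->
    ('d (th jk.1 jk.2) A v) tt x = \sum_j c j tt x * v j x.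
  by move=> [j k]; have [_ _ H _] := thP j k; exact: H.
(* This cost of multiplying by the coefficients [c] involves neither [lam] nor [e], so [lam] can be
   chosen after it. *)
pose D jk := \sum_j' 2 ^+ r * `|c jk j'|.
have D0 jk : 0 <= D jk by apply: sumr_ge0 => j' _; rewrite mulr_ge0 ?exprn_ge0.
pose K := \sum_j \sum_k `|b j k| * (r.+1%:R * D (j, k)).
have K0 : 0 <= K by apply: sumr_ge0 => j _; apply: sumr_ge0 => k _; rewrite !mulr_ge0.
(* With e = eta = 1 / lam the gain is e + eta = 2 / lam, and 2 K / lam <= 1 / 2; moreover lam >= 4
   ensures [e <= 1]. *)
pose lam := 4 * (K + 1); have l0 : 0 < lam by rewrite mulr_gt0 // ltr_wpDl.
pose e := lam^-1; have e0 : 0 < e by rewrite invr_gt0.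
have e1 : e <= 1 by rewrite invf_le1 // /lam; lra.
pose w := @expw R n lam.
have wc : {within N, continuous w} := @expw_within lam.
have w1 x : N x -> 1 <= w x by move=> _; exact: expw_ge1.
have w0 x : N x -> 0 <= w x by move=> _; exact: expR_ge0.
have wb := expw_le l0.
exists (@wnorm _ _ r N J w e), (1 / 2); split.
- exact: wnorm_equiv.
- by lra.
move=> v; set p := wnorm _ _ v.
have p0 : 0 <= p by have [] := wbounds_wnorm e0 e1 w1 v.
have pc j : crb N w e r (v j) p := wnorm_crb NI e0 e1 wc w1 v j.
apply: wnorm_crb_le => //; first by rewrite mulr_ge0 // divr_ge0.
move=> j; pose u k : S := 'd (th j k) A v.
have uc k : crb N w e r (u k tt) (D (j, k) * p).
  have -> : u k tt = fun x => \sum_j' c (j, k) j' tt x * v j' x.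
    apply/funext => x; have [Nx|Nx] := pselect (N x); first exact: (cP (j, k) v x Nx).
    by rewrite Cr_out // big1 // => j' _; rewrite (Cr_out v) // mulr0.
  rewrite /D mulr_suml; apply: crb_sum => // j'; rewrite -mulrA.
  by apply: crbM => //; [rewrite e0|exact: Cr_crb].
have -> : ('d volterra A v) j = fun x => \sum_k b j k * (x 0 k * radial N (q j) (u k tt) x).
  apply/funext => x; rewrite volterra_diff //.
  exact: (vlin_sumE (fun j k => 'd (th j k) A v) j x).
have H : crb N w e r (fun x => \sum_k b j k * (x 0 k * radial N (q j) (u k tt) x))
    (\sum_k `|b j k| * (r.+1%:R * (D (j, k) * p) * (e + e))).
  apply: crb_sum => // k; apply: crbZ.
  apply: (crb_moment cN sN e0 e1 (ltW e0) w0 wc wb) => //.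
  - by move=> x t _; exact: expw_mono.
  - by move=> x i _; exact: expw_int.
  - by rewrite mulr_ge0.
apply: crb_le H => //.
have -> : \sum_k `|b j k| * (r.+1%:R * (D (j, k) * p) * (e + e)) =
    (\sum_k `|b j k| * (r.+1%:R * D (j, k))) * (e + e) * p.
  by rewrite -mulrA mulr_suml; apply: eq_bigr => k _; ring.
apply: ler_wpM2r => //.
apply: (@le_trans _ _ (K * (e + e))).
  apply: ler_wpM2r; first by rewrite addr_ge0 // ltW.
  rewrite /K [leRHS](bigD1 j) //= lerDl.
  by apply: sumr_ge0 => j' _; apply: sumr_ge0 => k _; rewrite !mulr_ge0.
have -> : K * (e + e) = K / (K + 1) * (1 / 2).
  by rewrite /e /lam; field; rewrite gt_eqF // ltr_wpDl.
by rewrite ler_piMl // ?divr_ge0 // ler_pdivrMr ?ltr_wpDl // mul1r lerDl.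
Qed.

(** The domain need not be convex, so the bound on the derivative does not compare [A] with [B]. The
    Lipschitz clause of [realizes] for this pair is inserted into the integral equation for [A - B];
    in the weighted sup norm each pass halves the bound. *)
Lemma volterra_inj A B : dom A -> dom B -> A - volterra A = B - volterra B -> A = B.
Proof.
move=> OA OB AB.
have E1 j x : N x -> A j x - B j x =
    \sum_k b j k * (x 0 k * radial N (q j) (th j k A tt) x) -
    \sum_k b j k * (x 0 k * radial N (q j) (th j k B tt) x).
  move=> Nx; rewrite -!volterraE.
  move: (volterra A) (volterra B) AB => a c AB; rewrite -!Cr_subE.
  have -> : A - B = (A - a) - (B - c) + (a - c) by zmod.
  by rewrite AB subrr add0r.
move: AB => _.
have /choice[L LP] : forall jk : J * 'I_n, exists L, 0 <= L /\ forall x, N x ->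
    `|th jk.1 jk.2 A tt x - th jk.1 jk.2 B tt x| <= L * \sum_j `|A j x - B j x|.
  move=> [j k]; have [H1 _ _ H] := thP j k; have [L L0 HL] := H A B OA OB; exists L.
  split=> [|x Nx]; first exact: L0.
  by rewrite (H1 A x OA Nx) (H1 B x OB Nx); exact: (HL x Nx).
pose K := \sum_j \sum_k `|b j k| * (L (j, k) * #|J|%:R).
have L0 jk : 0 <= L jk by case: (LP jk).
have K0 : 0 <= K by apply: sumr_ge0 => j _; apply: sumr_ge0 => k _; rewrite !mulr_ge0.
(* Integration along the ray gains 1 / lam, and K / lam <= 1 / 2. The factor [#|J|] in [K] comes
   from the sum of the component distances. *)
pose lam := 2 * (K + 1); have l0 : 0 < lam by rewrite mulr_gt0 // ltr_wpDl.
pose w := @expw R n lam.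
have wc : {within N, continuous w} := @expw_within lam.
have w1 x : N x -> 1 <= w x by move=> _; exact: expw_ge1.
have w0 x : 0 <= w x by exact: expR_ge0.
have step M : 0 <= M -> (forall j x, N x -> `|A j x - B j x| <= M * w x) ->
    forall j x, N x -> `|A j x - B j x| <= M / 2 * w x.
  move=> M0 HM j x Nx.
  rewrite (E1 j x Nx) -sumrB.
  have tb k x' : N x' -> `|th j k A tt x' - th j k B tt x'| <= L (j, k) * #|J|%:R * M * w x'.
    move=> Nx'; have [_ H] := LP (j, k); apply: le_trans (H x' Nx') _.
    rewrite -!mulrA; apply: ler_wpM2l => //.
    apply: le_trans (ler_sum _ (fun j' _ => HM j' x' Nx')) _.
    by rewrite sumr_const mulr_natl.
  apply: le_trans (ler_norm_sum _ _ _) _.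
  apply: (@le_trans _ _ (\sum_k `|b j k| * (L (j, k) * #|J|%:R * M * (lam^-1 * w x)))).
    apply: ler_sum => k _; rewrite -mulrBr normrM; apply: ler_wpM2l => //.
    rewrite -mulrBr normrM.
    have cA : {within N, continuous (th j k A tt)} by exact: (@Cr_within R n r N unit (th j k A) tt).
    have cB : {within N, continuous (th j k B tt)} by exact: (@Cr_within R n r N unit (th j k B) tt).
    have -> : radial N (q j) (th j k A tt) x - radial N (q j) (th j k B tt) x =
        radial N (q j) (fun y => th j k A tt y - th j k B tt y) x.
      have := @radialD R n N cN sN (q j) (-1) (th j k B tt) (th j k A tt) x cB cA Nx.
      rewrite mulN1r addrC => <-; congr (radial _ _ _ _); apply/funext => y.
      by rewrite mulN1r addrC.
    have cAB : {within N, continuous (fun y => th j k A tt y - th j k B tt y)}.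
      exact: (@within_ctsB _ _ N (th j k A tt) (th j k B tt)).
    have C0 : 0 <= L (j, k) * #|J|%:R * M by rewrite !mulr_ge0.
    apply: le_trans (ler_wpM2l _ (radial_le cN sN wc _ cAB C0 (tb k) Nx)) _ => //.
    by rewrite mulrCA; apply: ler_wpM2l => //; exact: expw_int.
  have -> : \sum_k `|b j k| * (L (j, k) * #|J|%:R * M * (lam^-1 * w x)) =
      (\sum_k `|b j k| * (L (j, k) * #|J|%:R)) * (lam^-1 * (M * w x)).
    by rewrite mulr_suml; apply: eq_bigr => k _; ring.
  have Mw : 0 <= M * w x by rewrite mulr_ge0.
  apply: (@le_trans _ _ (K * (lam^-1 * (M * w x)))).
    apply: ler_wpM2r; first by rewrite mulr_ge0 // invr_ge0 ltW.
    rewrite /K [leRHS](bigD1 j) //= lerDl.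
    by apply: sumr_ge0 => j' _; apply: sumr_ge0 => k _; rewrite !mulr_ge0.
  rewrite mulrA [leRHS]mulrAC -[leRHS]mulrC; apply: ler_wpM2r => //.
  by rewrite ler_pdivrMr // /lam; lra.
have base j x : N x -> `|A j x - B j x| <= `|A - B| * w x.
  move=> Nx; apply: (@le_trans _ _ `|A - B|).
    by rewrite -Cr_subE; exact: crb1_abs (Cr_crb NI _ j) Nx.
  by apply: ler_peMr => //; exact: w1.
have iter m j x : N x -> `|A j x - B j x| <= `|A - B| / 2 ^+ m * w x.
  elim: m j x => [|m IH] j x Nx; first by rewrite expr0 divr1; exact: base.
  have M0 : 0 <= `|A - B| / 2 ^+ m by rewrite divr_ge0 ?exprn_ge0.
  by have := step _ M0 IH j x Nx; rewrite exprSr invfM mulrA.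
apply: Cr_eq => j x Nx; apply/eqP; rewrite -subr_eq0 -normr_le0.
have lim0 : `|A - B| * w x * (2^-1) ^+ m @[m --> \oo] --> `|A - B| * w x * 0.
  by apply: cvgM; [exact: cvg_cst|apply: cvg_expr; rewrite ger0_norm ?invr_ge0 // invf_lt1 // ltr1n].
rewrite mulr0 in lim0; apply: (@cvgr_to_ge _ _ _ _ _ _ _ lim0).
by apply: nearW => m; have := iter m j x Nx; rewrite exprVn mulrAC.
Qed.

Theorem volterra_good : good_perturbation dom volterra.
Proof.
split; [exact: dom_open|exact: volterra_smooth|exact: volterra_inj|exact: volterra_contraction].
Qed.

End Volterra.

(** * Corners, substitution, and the homotopy operator *)

Section Corners.
Context {R : realType}.

Lemma smooth_on_continuous (E F : normedModType R) (O : set E) (f : E -> F) x :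
  open O -> smooth_on O f -> O x -> {for x, continuous f}.
Proof.
move=> oO [D HD] Ox; have [D0 _ Db Dd] := HD x Ox.
have [M HM] := Db 1%N; have M0 : 0 < `|M| + 1 by rewrite ltr_wpDl.
have /near_normP[d d0 Hd] : \forall y \near x, O y by exact: open_nbhs_nbhs.
have := Dd 0%N 1 ltr01; move=> /(proj1 (@near_normP R E 0 _))[d' d'0 Hd'].
apply/cvgrPdist_le => e e0; apply/near_normP.
exists (Num.min (Num.min d d') (e / (`|M| + 2))).
  by rewrite !lt_min d0 d'0 divr_gt0 // ltr_wpDl.
move=> h; rewrite !lt_min => /andP[/andP[hd hd'] he].
have Oh := Hd h hd; have [Dh _ _ _] := HD _ Oh.
have := Hd' h hd' [::] erefl; rewrite add0r big_nil mulr1 mul1r D0 Dh => H1.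
have := HM [:: h] erefl; rewrite big_seq1 => H2.
rewrite distrC -(subrK (D x [:: h]) (_ - _)).
apply: le_trans (ler_normD _ _) _; apply: le_trans (lerD H1 H2) _.
apply: (@le_trans _ _ ((`|M| + 2) * `|h|)).
  have := ler_wpM2r (normr_ge0 h) (ler_norm M); have := normr_ge0 h; lra.
by rewrite mulrC -ler_pdivlMr ?ltr_wpDl //; exact: ltW.
Qed.

(** Raising all chart coordinates of [p] by [d / 2] makes the constrained ones strictly positive.
    They stay nonnegative nearby, so the shifted point is interior, and it is close to [p]. *)
Lemma corners_closure n (N : set 'rV[R]_n) : codim0_with_corners N -> N `<=` closure N°.
Proof.
move=> HN p Np B Bp; have [V [phi [k [Vp [oV Sphi oW [g [gK Sg]]] NE]]]] := HN p Np.
have Wp : (phi @` V) (phi p) by exists p.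
have cg := smooth_on_continuous oW Sg Wp; rewrite /prop_for /continuous_at gK // in cg.
have /near_normP[d d0 Hd] : \forall y \near phi p, (phi @` V) y /\ B (g y).
  by apply: filterI; [exact: open_nbhs_nbhs|exact: cg].
pose y := phi p + const_mx (d / 2).
have [[x Vx xy] Bx] : (phi @` V) y /\ B (g y).
  apply: Hd; apply: (@le_lt_trans _ _ (d / 2)); last by rewrite ltr_pdivrMr // ltr_pMr // ltr1n.
  by apply: row_norm_le => [|j]; rewrite ?mxE ?ger0_norm // divr_ge0 // ltW.
rewrite -xy gK // in Bx; exists x; split=> //.
have cx := smooth_on_continuous oV Sphi Vx.
have /cvgrPdist_le/(_ (d / 2)) := cx; rewrite divr_gt0 // => /(_ isT) nx.
suff : \forall z \near x, N z by [].
have nV : \forall z \near x, V z by exact: open_nbhs_nbhs.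
apply: filterS2 nV nx => z Vz Hz; apply/(NE z Vz) => i ik.
have := le_trans (coord_norm_le _ i) Hz; rewrite !mxE xy mxE mxE ler_norml.
have := proj1 (NE p Vp) Np i ik; lra.
Qed.

End Corners.

Section Generators.
Context {R : realType} (W : gradedVect R) (U : set (W 0%N)).
Hypothesis oU : gopen U.
Local Notation d := (\dim {:W 0%N}).
Local Notation V := (@W0vec R W @^-1` U).

Lemma smooth_on_eq (E F : normedModType R) (O : set E) (f g : E -> F) :
  (forall x, O x -> f x = g x) -> smooth_on O f -> smooth_on O g.
Proof.
by move=> fg [D HD]; exists D => x Ox; have [H1 H2 H3 H4] := HD x Ox; split=> //; rewrite H1 fg.
Qed.

Lemma smooth_on_coord (c : R) (j : 'I_d) : smooth_on V (fun u => c * u 0 j).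
Proof.
apply: Smooth_smooth_on => // k; apply: Sm_sub (@subsetT _ _) (Sm_blin k _); split.
  by move=> a u v; rewrite !mxE mulrDr /GRing.scale /= mulrCA.
by exists `|c| => v; rewrite normrM; apply: ler_wpM2l => //; exact: coord_norm_le.
Qed.

Lemma in_galg_ggen i : in_galg U (ggen U i).
Proof.
split.
- move=> m; split; last by move=> w Uw; rewrite /ggen asboolF.
  case: i => [j|p].
    apply: (smooth_on_eq _ (smooth_on_coord (m == [ffun=> 0%N])%:R j)) => u Vu.
    by rewrite /= /ggen asboolT // /W0coord /W0vec passmx.vecofK //; exact: gbasisP.
  apply: (smooth_on_eq _ (smooth_on_cst V (m == monom1 p)%:R)) => u Vu.
  by rewrite /= /ggen asboolT.
- move=> m w nz; rewrite /ggen; case: ifP => // _; case: i => [j|p].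
    case: eqP => [mE|_]; last by rewrite mul0r.
    by move: nz; rewrite mE /monom_nz => /forallP[]p; rewrite ffunE leq0n implybT.
  case: eqP => // mE; move: nz; rewrite mE /monom_nz => /forallP[] q.
  by rewrite ffunE; case: (q == p); rewrite implybT.
- pose m0 : monom W := if i is inr p then monom1 p else [ffun=> 0%N].
  apply: (sub_finite_set _ (finite_set1 m0)) => m [w]; rewrite /ggen /m0.
  case: ifP => [_|_]; last by rewrite eqxx.
  by case: i {m0} => [j|p]; case: (m =P _) => [-> //|_]; rewrite /= ?mul0r eqxx.
Qed.

End Generators.

(** * Substitution of forms into elements of the graded algebra *)

Section Substitution.
Context {R : realType} {n : nat} (r : nat) (N : set 'rV[R]_n).
Hypotheses (cN : compact N) (NI : N `<=` closure N°).
Context (W : gradedVect R) (U : set (W 0%N)).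
Hypothesis oU : gopen U.
Local Notation d := (\dim {:W 0%N}).
Local Notation V := (@W0vec R W @^-1` U).
Local Notation J := (formidx (n := n) W 0).
Local Notation E := (Cr r N J).

Lemma idx0_proof (j : 'I_d) :
  #|(inl j : basidx W, finset.set0 : {set 'I_n}).2| == (0 + bdeg (inl j : basidx W))%N.
Proof. by rewrite cards0. Qed.
Definition idx0 (j : 'I_d) : J := Sub (inl j, finset.set0) (idx0_proof j).

Local Notation realizable := (@realizable R n d r N J V idx0).

Lemma form0E (A : E) x : form0 A x = W0vec (\row_j A (idx0 j) x).
Proof. by rewrite /form0; congr W0vec; apply/rowP => j; rewrite !mxE /fcomp -[(inl j, _)]/(val (idx0 j)) valK. Qed.

Lemma OmegaU_dom : OmegaU r N U = dom V idx0.
Proof. by apply/seteqP; split=> A OA x Nx; have := OA x Nx; rewrite form0E. Qed.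

Lemma realizable_wedge (al be : E -> 'rV[R]_n -> @extalg R n) :
  (forall S, realizable (fun A x => al A x S)) -> (forall S, realizable (fun A x => be A x S)) ->
  forall S, realizable (fun A x => wedge (al A x) (be A x) S).
Proof.
move=> ra rb S; apply: realizable_sum => // T _.
by do 2![apply: realizableM => //]; exact: realizable_cst.
Qed.

Lemma realizable_one S : realizable (fun A x => @ext_one R n S).
Proof. exact: realizable_cst. Qed.

Lemma realizable_iter m (al : E -> 'rV[R]_n -> @extalg R n) :
  (forall S, realizable (fun A x => al A x S)) ->
  forall S, realizable (fun A x => iter m (wedge (al A x)) ext_one S).
Proof. by move=> ra; elim: m => [|m IH] S; [exact: realizable_one|exact: realizable_wedge]. Qed.

Lemma realizable_fcomp i S : realizable (fun A x => fcomp A i x S).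
Proof.
rewrite /fcomp; case: insub => [j|]; [exact: realizable_proj|exact: realizable_cst].
Qed.

Lemma realizable_monom m S :
  realizable (fun A x => monom_eval (fun i => fcomp A (inr i) x) m S).
Proof.
rewrite /monom_eval; elim: (enum _) S => [|i s IH] S.
  by apply: realizable_eq (realizable_one S) => A x _ _; rewrite big_nil.
apply: (@realizable_eq _ _ _ _ _ _ _ _ (fun A x => wedge (iter (m i) (wedge (fcomp A (inr i) x)) ext_one)
  (\big[wedge/ext_one]_(i <- s) iter (m i) (wedge (fcomp A (inr i) x)) ext_one) S)).
  by move=> A x _ _; rewrite big_cons.
apply: (@realizable_wedge (fun A x => iter (m i) (wedge (fcomp A (inr i) x)) ext_one)
  (fun A x => \big[wedge/ext_one]_(i <- s) iter (m i) (wedge (fcomp A (inr i) x)) ext_one)) => //.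
by apply: (@realizable_iter _ (fun A x => fcomp A (inr i) x)) => T; exact: realizable_fcomp.
Qed.

Lemma realizable_gsubst a S : in_galg U a -> realizable (fun A x => gsubst a A x S).
Proof.
(* [T] is finite and independent of [A] and [x], so a single finite sum represents the substitution
   for all of them. *)
move=> [sa _ fa]; pose T := [set m | exists w, a m w != 0].
apply: (@realizable_eq _ _ _ _ _ _ _ _ (fun A x => \sum_(m <- finmap.enum_fset (fset_set T))
   a m (W0vec (\row_j A (idx0 j) x)) * monom_eval (fun i => fcomp A (inr i) x) m S)).
  move=> A x _ _; rewrite /gsubst -(fsbig_widen T) ?fsbig_finite //.
    by apply: eq_bigr => m _; rewrite form0E.
  move=> m [_ /= mT]; have [->|am] := eqVneq (a m (form0 A x)) 0; first by rewrite mul0r.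
  by case: mT; exists (form0 A x).
apply: realizable_sum => // m _; apply: realizableM => //; last exact: realizable_monom.
by have [sm _] := sa m; exact: (realizable_nem r cN NI idx0 oU sm).
Qed.

Lemma realizable_CQ (Q : gdifferential U) i S : realizable (fun A x => fcomp (CQ Q A) i x S).
Proof.
rewrite /fcomp; case: insub => [j|]; last exact: realizable_cst.
by apply: realizable_gsubst; apply: diff_in; exact: in_galg_ggen.
Qed.

End Substitution.

Section Homotopy.
Context {R : realType} {n : nat} (N : set 'rV[R]_n).
Hypotheses (cN : compact N) (sN : star_shaped N).
Context (W : gradedVect R).

(** The value 0 for [k] in [S] lets the contraction be summed over all [k]. *)
Definition contract_sign (S : {set 'I_n}) (k : 'I_n) : R :=
  if k \notin S then (-1) ^+ #|[pred l in S | (l < k)%N]| else 0.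

Lemma cts01Z (c : R) f : cts01 f -> cts01 (fun t => c * f t).
Proof.
move=> /subspace_continuousP cf; apply/subspace_continuousP => t t01.
exact: (cvgM (cvg_cst c) (cf t t01)).
Qed.

Lemma int01_sum (I : Type) (s : seq I) (f : I -> R -> R) : (forall i, cts01 (f i)) ->
  cts01 (fun t => \sum_(i <- s) f i t) /\
  int01 (fun t => \sum_(i <- s) f i t) = \sum_(i <- s) int01 (f i).
Proof.
move=> cf; elim: s => [|i s [IHc IHE]].
  have -> : (fun t => \sum_(i <- [::]) f i t) = cst 0 by apply/funext => t; rewrite big_nil.
  by rewrite big_nil int01_cst; split=> //; apply: continuous_subspaceT => t; exact: cst_continuous.
have -> : (fun t => \sum_(i <- i :: s) f i t) = fun t => f i t + \sum_(i <- s) f i t.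
  by apply/funext => t; rewrite big_cons.
split; last by rewrite big_cons int01D // IHE.
move/subspace_continuousP: (cf i) => c1; move/subspace_continuousP: IHc => c2.
by apply/subspace_continuousP => t t01; exact: (cvgD (c1 t t01) (c2 t t01)).
Qed.

(** The coefficients of [B] are known to be regular only through functions that agree with them on
    [N]. This suffices, since the ray from 0 to [x] stays in [N]. *)
Lemma dR_homotopyE m (B : wform W m.+1) (j : formidx W m) (f : 'I_n -> 'rV[R]_n -> R) x : N x ->
  (forall k, {within N, continuous (f k)}) ->
  (forall k y, N y -> fcomp B (val j).1 y (k |: (val j).2)%SET = f k y) ->
  dR_homotopy B j x =
  \sum_k contract_sign (val j).2 k * (x 0 k * radial N #|(val j).2| (f k) x).
Proof.
move=> Nx fc fE; rewrite /dR_homotopy /of_fcomp; set S := (val j).2; set q := #|S|.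
pose F k t := contract_sign S k * x 0 k * (t ^+ q * f k (t *: x)).
have cF k : cts01 (F k) by apply: cts01Z; exact: (@radial_cts R n N cN sN (f k) q x (fc k) Nx).
transitivity (int01 (fun t => \sum_k F k t)).
  apply: eq_int01 => t t01; rewrite /ext_contract mulr_sumr [RHS]big_mkcond /= [LHS]big_mkcond /=.
  apply: eq_bigr => k _; rewrite /F /contract_sign; case: (k \notin S); last by rewrite !mul0r.
  by rewrite fE; [ring|exact: star_scale].
have [_ ->] := int01_sum (index_enum 'I_n) cF; apply: eq_bigr => k _.
rewrite /F int01Z; last exact: (@radial_cts R n N cN sN (f k) q x (fc k) Nx).
by rewrite /radial asboolT // mulrA.
Qed.

End Homotopy.

(** The witness is A - [volterra] A, a total map whose values off [OmegaU] are immaterial. Its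
    formula is asserted on [N]: members of [Omega] vanish outside, whereas the integral at an outer
    point may still see points of [N]. *)
Theorem proposition4p2 (R : realType) (n : nat) (N : set 'rV[R]_n)
    (W : gradedVect R) (U : set (W 0%N)) (Q : gdifferential U) (r : nat) :
  compact N -> star_shaped N -> codim0_with_corners N ->
  gopen U -> (1 <= r)%N ->
  exists kappa : Omega W r N 0 -> Omega W r N 0,
    (forall A, OmegaU r N U A -> forall j x, N x ->
       kappa A j x = A j x - dR_homotopy (CQ Q A) j x) /\
    smooth_open_embedding (OmegaU r N U) kappa.
Proof.
move=> cN sN /corners_closure NI oU _.
pose J := formidx (n := n) W 0; pose E := Cr r N J.
pose V := @W0vec R W @^-1` U.
pose Th (j : J) (k : 'I_n) (A : E) x := fcomp (CQ Q A) (val j).1 x (k |: (val j).2)%SET.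
have /choice[th' thP'] : forall jk : J * 'I_n, exists th : E -> Cr r N unit,
    realizes V (@idx0 R n W) (Th jk.1 jk.2) th.
  by move=> [j k]; exact: realizable_CQ.
pose th j k := th' (j, k).
have thP j k : realizes V (@idx0 R n W) (Th j k) (th j k) by exact: (thP' (j, k)).
pose b (j : J) := @contract_sign R n (val j).2; pose q (j : J) := #|(val j).2|.
exists (fun A => A - volterra th b q A); split; last first.
  rewrite OmegaU_dom; apply: good_smooth_open_embedding.
  exact: (volterra_good cN sN NI oU b q thP).
move=> A; rewrite OmegaU_dom => OA j x Nx; rewrite Cr_subE; congr (_ - _).
rewrite (volterraE cN sN NI).
apply: esym; apply: (dR_homotopyE cN sN Nx) => [k|k y Ny].
  exact: (@Cr_within R n r N unit (th j k A) tt).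
by have [H _ _ _] := thP j k; rewrite H.
Qed.
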